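(* Let $p>3$ be a prime with $p\equiv 2$ or $3\pmod 5$, and let $G=\mathrm{PSL}(2,p)$. Let $E=S_4$ if $p\equiv\pm1\pmod 8$ and $E=A_4$ if $p\equiv\pm3\pmod 8$. For a non-identity element $x\in G$, the set $\mathrm{Sol}_G(x)$ is the union of the maximal subgroups of $G$ containing $x$. Let $b$, $d_-$, $d_+$, $e$ be the numbers of maximal subgroups of $G$ containing $x$ that are isomorphic to $C_p\rtimes C_{(p-1)/2}$, $D_{p-1}$, $D_{p+1}$, $E$, respectively; every maximal subgroup containing $x$ is of one of these types. Then the sets $\mathrm{Sol}_G(x)$ are classified, according to $|x|$ and $p$ modulo $24$, by the following values of $(b,d_-,d_+,e)$ and $|\mathrm{Sol}_G(x)|$. For every such $p$, where ''treated separately'' refers to the orders $|x|=2$, $|x|=3$ and, if $p\equiv\pm1\pmod 8$, also $|x|=4$: - if $|x|=p$: $(1,0,0,0)$ and $|\mathrm{Sol}_G(x)|=p(p-1)/2$; - if $|x|$ divides $p-1$ and is not one of the orders treated separately: $(2,1,0,0)$ and $|\mathrm{Sol}_G(x)|=p(p-1)$; - if $|x|$ divides $p+1$ and is not one of the orders treated separately: $(0,0,1,0)$ and $|\mathrm{Sol}_G(x)|=p+1$. For the orders treated separately: $p\equiv 1\pmod{24}$: - $|x|=2$: $\left(2,\frac{p+1}{2},\frac{p-1}{2},\frac{3(p-1)}{4}\right)$, $|\mathrm{Sol}_G(x)|=(p-1)(2p+3)$; - $|x|=3$: $\left(2,1,0,\frac{p-1}{3}\right)$, $|\mathrm{Sol}_G(x)|=(p-1)(p+6)$;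 - $|x|=4$: $\left(2,1,0,\frac{p-1}{4}\right)$, $|\mathrm{Sol}_G(x)|=(p-1)(p+4)$. $p\equiv 5\pmod{24}$: - $|x|=2$: $\left(2,\frac{p+1}{2},\frac{p-1}{2},\frac{p-1}{4}\right)$, $|\mathrm{Sol}_G(x)|=(p-1)(2p-1)$; - $|x|=3$: $\left(0,0,1,\frac{p+1}{3}\right)$, $|\mathrm{Sol}_G(x)|=4(p+1)$. $p\equiv 7\pmod{24}$: - $|x|=2$: $\left(0,\frac{p+1}{2},\frac{p+3}{2},\frac{3(p+1)}{4}\right)$, $|\mathrm{Sol}_G(x)|=(p+1)(p+4)$; - $|x|=3$: $\left(2,1,0,\frac{p-1}{3}\right)$, $|\mathrm{Sol}_G(x)|=(p-1)(p+6)$; - $|x|=4$: $\left(0,0,1,\frac{p+1}{4}\right)$, $|\mathrm{Sol}_G(x)|=5(p+1)$. $p\equiv 11\pmod{24}$: - $|x|=2$: $\left(0,\frac{p+1}{2},\frac{p+3}{2},\frac{p+1}{4}\right)$, $|\mathrm{Sol}_G(x)|=p(p+1)$; - $|x|=3$: $\left(0,0,1,\frac{p+1}{3}\right)$, $|\mathrm{Sol}_G(x)|=4(p+1)$. $p\equiv 13\pmod{24}$: - $|x|=2$: $\left(2,\frac{p+1}{2},\frac{p-1}{2},\frac{p-1}{4}\right)$, $|\mathrm{Sol}_G(x)|=(p-1)(2p-1)$; - $|x|=3$: $\left(2,1,0,\frac{p-1}{3}\right)$, $|\mathrm{Sol}_G(x)|=(p-1)(p+3)$. $p\equiv 17\pmod{24}$: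 - $|x|=2$: $\left(2,\frac{p+1}{2},\frac{p-1}{2},\frac{3(p-1)}{4}\right)$, $|\mathrm{Sol}_G(x)|=(p-1)(2p+3)$; - $|x|=3$: $\left(0,0,1,\frac{p+1}{3}\right)$, $|\mathrm{Sol}_G(x)|=7(p+1)$; - $|x|=4$: $\left(2,1,0,\frac{p-1}{4}\right)$, $|\mathrm{Sol}_G(x)|=(p-1)(p+4)$. $p\equiv 19\pmod{24}$: - $|x|=2$: $\left(0,\frac{p+1}{2},\frac{p+3}{2},\frac{p+1}{4}\right)$, $|\mathrm{Sol}_G(x)|=p(p+1)$; - $|x|=3$: $\left(2,1,0,\frac{p-1}{3}\right)$, $|\mathrm{Sol}_G(x)|=(p-1)(p+3)$. $p\equiv 23\pmod{24}$: - $|x|=2$: $\left(0,\frac{p+1}{2},\frac{p+3}{2},\frac{3(p+1)}{4}\right)$, $|\mathrm{Sol}_G(x)|=(p+1)(p+4)$; - $|x|=3$: $\left(0,0,1,\frac{p+1}{3}\right)$, $|\mathrm{Sol}_G(x)|=7(p+1)$; - $|x|=4$: $\left(0,0,1,\frac{p+1}{4}\right)$, $|\mathrm{Sol}_G(x)|=5(p+1)$.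
   Context: For a finite group $G$ and $x\in G$, the solubilizer of $x$ is the set $\mathrm{Sol}_G(x)=\{y\in G\mid \langle x,y\rangle \text{ is soluble}\}$. $|x|$ is the order of $x$. $C_n$ is the cyclic group of order $n$, $D_{2n}$ is the dihedral group of order $2n$ (so $D_{p\pm1}$ has order $p\pm1$), $A_4$ and $S_4$ are the alternating and symmetric groups of degree $4$, and $C_p\rtimes C_{(p-1)/2}$ is a semidirect product of order $p(p-1)/2$.
   Formalization: For p = 7 the groups D_{p-1} and D_{p+1} are not maximal in PSL(2,7) (they lie in copies of S_4), so the printed d_-, d_+ fail there; for p = 7 only, d_- and d_+ count all subgroups isomorphic to D_{p-1}, D_{p+1} containing x, maximal or not. *)

(* Defs.v *)
From HB Require Import structures.
From mathcomp Require Import all_boot all_order all_algebra.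
From mathcomp Require Import all_fingroup all_solvable.

Set Implicit Arguments.
Unset Strict Implicit.
Unset Printing Implicit Defensive.

Import GroupScope.
Local Open Scope nat_scope.

Lemma SL2_group_set (p : nat) :
  group_set [set u : {'GL_2(p)} | (\det (GLval u) == 1)%R].
Proof.
apply/group_setP; split=> [|u v]; rewrite !inE ?GL_1E ?det1 //.
by move=> /eqP du /eqP dv; rewrite GL_ME det_mulmx du dv GRing.mulr1.
Qed.

Definition SL2 (p : nat) : {group {'GL_2(p)}} := Group (SL2_group_set p).

Definition PSL2 (p : nat) : {group coset_of 'Z(SL2 p)} := (SL2 p / 'Z(SL2 p))%G.

Definition Sol (gT : finGroupType) (G : {group gT}) (x : gT) : {set gT} :=
  [set y in G | solvable <<[set x; y]>>].

Section Types.

Variable gT : finGroupType.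
Implicit Types M G : {group gT}.

(* A semidirect product C_p : C_((p-1)/2), with no condition on the action. *)
Definition borel_type (p : nat) M : bool :=
  [exists K : {group gT}, [exists H : {group gT},
    [&& K ><| H == M, cyclic K, #|K| == p, cyclic H & #|H| == (p - 1) %/ 2]]].

(* 'D_m has order m, for even m >= 4. *)
Definition dihedral_type (m : nat) M : bool := M \isog 'D_m.

(* For odd p, the alternative of p = 1, 7 mod 8 is p = 3, 5 mod 8. *)
Definition E_type (p : nat) M : bool :=
  if p %% 8 \in [:: 1; 7] then M \isog 'Sym_('I_4) else M \isog 'Alt_('I_4).

Definition maximal_through G (x : gT) (T : pred {group gT}) : {set {group gT}} :=
  [set M : {group gT} | [&& maximal M G, x \in M & T M]].

Definition subgroups_through G (x : gT) (T : pred {group gT}) :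
    {set {group gT}} :=
  [set M : {group gT} | [&& M \subset G, x \in M & T M]].

End Types.

Definition nb_borel (p : nat) (x : coset_of 'Z(SL2 p)) : nat :=
  #|maximal_through (PSL2 p) x (borel_type p)|.

(* In PSL(2,7) the dihedral subgroups D_6 and D_8 lie in copies of S_4, so    *)
(* none of them is maximal. The usual formulas for the numbers of dihedral    *)
(* groups of order p - 1 and p + 1 through x remain valid for p = 7 when all  *)
(* such subgroups are counted, maximal or not.                                *)
Definition nb_dihedral (p : nat) (x : coset_of 'Z(SL2 p)) (m : nat) : nat :=
  if p == 7 then #|subgroups_through (PSL2 p) x (dihedral_type m)|
  else #|maximal_through (PSL2 p) x (dihedral_type m)|.

Definition nb_E (p : nat) (x : coset_of 'Z(SL2 p)) : nat :=
  #|maximal_through (PSL2 p) x (E_type p)|.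

(* The quadruple (b, d_-, d_+, e). *)
Definition max_counts (p : nat) (x : coset_of 'Z(SL2 p)) : nat * nat * nat * nat :=
  (nb_borel x, nb_dihedral x (p - 1), nb_dihedral x (p + 1), nb_E x).

Definition sol_row (p : nat) (x : coset_of 'Z(SL2 p))
    (c : nat * nat * nat * nat) (s : nat) : Prop :=
  max_counts x = c /\ #|Sol (PSL2 p) x| = s.

Definition separate_order (p n : nat) : bool :=
  [|| n == 2, n == 3 | (p %% 8 \in [:: 1; 7]) && (n == 4)].

(* Main.v *)
Require Import Defs.
From mathcomp Require Import all_boot all_order all_algebra.
From mathcomp Require Import all_fingroup all_solvable.
From mathcomp Require Import integral_char zify ring.

Set Implicit Arguments.
Unset Strict Implicit.
Unset Printing Implicit Defensive.

(* A nonidentity element x of G = PSL(2, p), p = 2k + 1, lies in a unique     *)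
(* torus T x, the image of the centralizer in SL(2, p) of a preimage of x;    *)
(* its order is p, k or k + 1. Distinct tori meet trivially, so counting the  *)
(* elements of a subgroup H of order prime to p by the tori meeting H gives   *)
(* Dickson's class equation: if H normalizes no torus, then |H| is 12, 24 or  *)
(* 60. As 5 does not divide |G|, every proper subgroup is soluble, and a      *)
(* nontrivial soluble subgroup normalizes a torus or a Klein four-group.      *)
(* Hence every maximal subgroup is the normalizer of a torus or of a four-    *)
(* group, and Sol_G(x) is the union of the normalizers containing x. The      *)
(* counts follow by double counting incidences, and |Sol_G(x)| by inclusion-  *)
(* exclusion; the part of the normalizer of a four-group outside the          *)
(* normalizers of tori through x is computed inside A_4 or S_4.               *)

(** The tori of G = PSL(2, p), p = 2k + 1, are cyclic of order p, k or k + 1 and partition the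
    nonidentity elements. The group theory uses only the axioms of [torus_system];
    [PSL2_torus_system] checks them on matrices, where whatever commutes with a nonscalar A is a + b
    A ([comm2P]) and, for nonzero discriminant, the trace decides conjugacy in SL(2, p)
    ([SL2_conj]).

    Solubility: a subgroup of order divisible by p is G or has a normal Sylow p-subgroup
    ([p_subgroup_cases]). Any other nontrivial subgroup that normalizes no torus has order 12, 24 or
    60 ([class_equation]). The condition modulo 5 rules out 60, so proper subgroups are soluble
    ([proper_sol]), while G is perfect ([der1_G]); hence [Sol_bigcup].

    Maximal subgroups: a minimal normal subgroup of a soluble H lies in a torus or is a four-group V
    ([sol_sub_cases]). The normalizer of V permutes four Sylow 3-subgroups faithfully and is A_4 or
    S_4 ([klein_norm_embed], [card_klein_norm]). This gives [maximal_cases]. Apart from p = 7,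
    normalizers of different tori and four-groups are not nested ([T_norm_sub], [klein_norm_inj],
    [klein_norm_sub_T], [maximal_torus]), so maximal subgroups through x are counted by the tori and
    four-groups that x normalizes.

    Counting: these numbers come from double counting ([ntori_p_split], [ntori_inv], [nklein_mul]).
    For the size of the solubilizer, [Dset x] collects the y that normalize some torus together with
    x. Any other y in the solubilizer generates with x a group normalizing exactly one four-group
    ([klein_uniq]), so every V normalized by x adds the same number of elements ([card_Sol]), found
    inside A_4 or S_4. For x of order p, [Dset x] is a Borel subgroup; otherwise it is a union of a
    dihedral and at most two Borel subgroups, except that for an involution many dihedral groups
    occur, and [Dset_inv] replaces them by the y that commute with x, square to 1 or are inverted by
    x. *)

(* In a subgroup H of order h, the conjugates of a trace H :&: T x of order g *)
(* and of index f in its normalizer in H are i in number and contribute v = i *)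
(* (g - 1) nonidentity elements.                                              *)
Definition class_term (h v : nat) := exists g f i : nat,
  [/\ 1 < g, f = 1 \/ f = 2, 1 < i, h = (i * (f * g))%N & v = (i * g.-1)%N].

(** Since v = h (1 - 1/g) / f, listing the small g and bounding the others leaves conditions linear
    in h, i and v. *)
Lemma class_term_cases h v : class_term h v -> exists i, 1 < i /\
  ((h = 2 * i \/ h = 3 * i \/ 4 * i <= h) /\ v + i = h \/
   (h = 4 * i \/ h = 6 * i \/ h = 8 * i \/ h = 10 * i \/ 12 * i <= h) /\
     2 * v + 2 * i = h)%N.
Proof.
case=> g [f [i [g1 f12 i1 -> ->]]]; exists i; split=> //.
case: f12 => ->; [left | right]; split; try (case: g g1 => //= g _; nia).
  case: g g1 => [|[|[|[|g]]]] // _; first by left; lia.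
    by right; left; lia.
  by right; right; nia.
have [g5|g6] := leqP g 5; last by do 4 right; nia.
have: (g \in [:: 2; 3; 4; 5])%N by rewrite !inE; lia.
by rewrite !inE => /or4P[]/eqP->; lia.
Qed.

(** Each term is at least h / 4, so there are at most three, and one alone cannot be h - 1. Two
    terms leave g = 3, f = 1 and g = 2, f = 2, with h = 12. Three terms have f = 2 and 1/g1 + 1/g2 +
    1/g3 = 1 + 2/h; as i > 1 excludes (2, 2, n), the solutions are (2, 3, 3), (2, 3, 4) and (2, 3,
    5). *)
Lemma class_equation_arith h s :
  1 < h -> (forall v, v \in s -> class_term h v) -> (sumn s).+1 = h ->
  h \in [:: 12; 24; 60].
Proof.
move=> h1 sP; have {}sP v (vs : v \in s) := class_term_cases (sP v vs).
have quarter v : v \in s -> h <= 4 * v.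
  by case/sP=> i [i1 [[c e]|[c e]]]; lia.
case: s sP quarter => [|a [|b [|c [|d s]]]] sP quarter /=; try lia.
- by have [i [i1 [[c e]|[c e]]]] := sP a (mem_head _ _); lia.
- have [i [i1 ai]] := sP a (mem_head _ _).
  have [|j [j1 bj]] := sP b; first by rewrite !inE eqxx orbT.
  rewrite !inE => e; lia.
- have [i [i1 ai]] := sP a (mem_head _ _).
  have [|j [j1 bj]] := sP b; first by rewrite !inE eqxx orbT.
  have [|l [l1 cl]] := sP c; first by rewrite !inE eqxx !orbT.
  have qa : h <= 4 * a by apply: quarter; rewrite !inE eqxx.
  have qb : h <= 4 * b by apply: quarter; rewrite !inE eqxx orbT.
  have qc : h <= 4 * c by apply: quarter; rewrite !inE eqxx !orbT.
  rewrite !inE => e.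
  (* A term with f = 1 is at least h / 2, too much beside two quarters. *)
  case: ai => [|[ci ai]]; first by lia.
  case: bj => [|[cj bj]]; first by lia.
  case: cl => [|[cl cl']]; first by lia.
  by case: ci => [ci|[ci|[ci|[ci|ci]]]]; case: cj => [cj|[cj|[cj|[cj|cj]]]]; lia.
have qa : h <= 4 * a by apply: quarter; rewrite !inE eqxx.
have qb : h <= 4 * b by apply: quarter; rewrite !inE eqxx orbT.
have qc : h <= 4 * c by apply: quarter; rewrite !inE eqxx !orbT.
have qd : h <= 4 * d by apply: quarter; rewrite !inE eqxx !orbT.
lia.
Qed.

Import GroupScope.

(** * The symmetric group of degree 4 *)

Lemma faithful_isog_Sym (aT : finGroupType) (rT : finType) (to : {action aT &-> rT})
    (G : {group aT}) (S : {set rT}) :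
    0 < #|S| -> [acts G, on S | to] -> [faithful G, on S | to] ->
  exists H : {group 'S_#|S|}, G \isog H.
Proof.
case/card_gt0P=> s0 Ss0 actS ffG.
pose r := enum_rank_in Ss0.
(* Acting as the identity outside [G] makes [f0 g] injective for every [g], as [perm] requires. *)
pose f0 g (i : 'I_#|S|) := if g \in G then r (to (enum_val i) g) else i.
have f0K g : g \in G -> forall i, enum_val (f0 g i) = to (enum_val i) g.
  move=> Gg i; rewrite /f0 Gg /r enum_rankK_in //.
  by rewrite (acts_act actS Gg) enum_valP.
have f0_inj g : injective (f0 g).
  move=> i j; have [Gg e|/negPf Gg] := boolP (g \in G); last by rewrite /f0 Gg.
  by apply/enum_val_inj/(act_inj to g); rewrite -!f0K // e.
pose f g := perm (f0_inj g).
have fM : {in G &, {morph f : x y / x * y}}.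
  move=> x y Gx Gy; apply/permP=> i; rewrite permM !permE.
  by apply: enum_val_inj; rewrite !f0K ?groupM // actM.
have fI : 'injm (Morphism fM).
  apply/injmP=> x y Gx Gy /permP e; apply: (mulIg y^-1); rewrite mulgV.
  apply/eqP; move/faithfulP: ffG => ff; rewrite -in_set1 -[[set 1]]/(1%G : {set aT}).
  rewrite inE; apply/eqP/ff; first by rewrite groupM ?groupV.
  move=> s Ss; have := congr1 enum_val (e (r s)).
  by rewrite !permE !f0K //= enum_rankK_in // actM => ->; rewrite actK.
by exists (Morphism fM @* G)%G; apply: sub_isog.
Qed.

(* Encoding permutations of 'I_4 as lists makes statements about 'S_4         *)
(* decidable by computation.                                                  *)
Definition perms4 := permutations (iota 0 4).
Definition pmul (l m : seq nat) := [seq nth 0 m i | i <- l].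
Definition code (s : 'S_4) : seq nat := [seq val (s i) | i <- enum 'I_4].

Lemma codeM s t : code (s * t)%g = pmul (code s) (code t).
Proof.
rewrite /pmul /code -map_comp; apply: eq_map => i /=; rewrite permM.
by rewrite (nth_map ord0) ?size_enum_ord // nth_ord_enum.
Qed.

Lemma code1 : code 1 = iota 0 4.
Proof. by rewrite -val_enum_ord; apply: eq_map => i; rewrite perm1. Qed.

Lemma code_inj : injective code.
Proof.
move=> s t /eq_in_map e; apply/permP=> i; apply: val_inj.
by apply: e; rewrite mem_enum.
Qed.

Lemma perm_codes : perm_eq [seq code s | s : 'S_4] perms4.
Proof.
have u : uniq [seq code s | s : 'S_4] by rewrite map_inj_uniq ?enum_uniq //; apply: code_inj.
have sub : {subset [seq code s | s : 'S_4] <= perms4}.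
  move=> _ /mapP[s _ ->]; rewrite mem_permutations.
  have us : uniq (code s) by rewrite map_inj_uniq ?enum_uniq // => i j /val_inj/perm_inj.
  have ss : {subset code s <= iota 0 4}.
    by move=> _ /mapP[i _ ->]; rewrite mem_iota /= ltn_ord.
  have sz : size (iota 0 4) <= size (code s) by rewrite size_map size_enum_ord.
  by have [_ e] := uniq_min_size us ss sz; apply: uniq_perm.
have sz : size perms4 <= size [seq code s | s : 'S_4] by rewrite size_map -cardE card_Sn.
by have [_ e] := uniq_min_size u sub sz; apply: uniq_perm.
Qed.

Lemma code_mem s : code s \in perms4.
Proof. by rewrite -(perm_mem perm_codes) map_f ?mem_enum. Qed.

(** Cardinalities in ['S_4] become counts over an explicit list, left to [vm_compute]. *)
Lemma card_code (P : pred (seq nat)) (Q : pred 'S_4) :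
  (forall s, Q s = P (code s)) -> #|[set s | Q s]| = count P perms4.
Proof.
move=> eQ; rewrite cardE -(seq.permP perm_codes P) count_map -size_filter enumT.
by congr size; rewrite /enum_mem; apply: eq_filter => s /=; rewrite inE eQ.
Qed.

Lemma eq_code s t : (s == t) = (code s == code t).
Proof. by rewrite (inj_eq code_inj). Qed.

Definition codeE := (eq_code, codeM, code1).

Lemma S4_orders (s : 'S_4) : [|| s == 1, s * s == 1, s * s * s == 1 | s * s * (s * s) == 1].
Proof.
by rewrite !codeE; move: (code s) (code_mem s); apply/allP; vm_compute.
Qed.

Lemma S4_card2 : #|[set s : 'S_4 | (s * s == 1) && (s != 1)]| = 9.
Proof.
rewrite (@card_code (fun l => (pmul l l == iota 0 4) && (l != iota 0 4))); first by vm_compute.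
by move=> s; rewrite !codeE.
Qed.

Lemma S4_card3 : #|[set s : 'S_4 | (s * s * s == 1) && (s != 1)]| = 8.
Proof.
rewrite (@card_code (fun l => (pmul (pmul l l) l == iota 0 4) && (l != iota 0 4))); first by vm_compute.
by move=> s; rewrite !codeE.
Qed.

Lemma S4_card4 : #|[set s : 'S_4 | (s * s * (s * s) == 1) && (s * s != 1)]| = 6.
Proof.
rewrite (@card_code (fun l => (pmul (pmul l l) (pmul l l) == iota 0 4) && (pmul l l != iota 0 4))); first by vm_compute.
by move=> s; rewrite !codeE.
Qed.

(** The condition says that t conjugates s to s or to its inverse, so the set is the normalizer of
    the group generated by s. *)
Lemma S4_norm3 (s : 'S_4) : s * s * s == 1 -> s != 1 ->
  #|[set t : 'S_4 | (s * t == t * s) || (s * t * s == t)]| = 6.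
Proof.
rewrite (@card_code (fun l => (pmul (code s) l == pmul l (code s)) || (pmul (pmul (code s) l) (code s) == l))); last first.
  by move=> t; rewrite ?codeE.
rewrite !codeE => s3 s1.
apply/eqP; move: s1; apply/implyP; move: s3; apply/implyP.
by move: (code s) (code_mem s); apply/allP; vm_compute.
Qed.

Lemma S4_norm4 (s : 'S_4) : s * s * (s * s) == 1 -> s * s != 1 ->
  #|[set t : 'S_4 | (s * t == t * s) || (s * t * s == t)]| = 8.
Proof.
rewrite (@card_code (fun l => (pmul (code s) l == pmul l (code s)) || (pmul (pmul (code s) l) (code s) == l))); last first.
  by move=> t; rewrite ?codeE.
rewrite !codeE => s3 s1.
apply/eqP; move: s1; apply/implyP; move: s3; apply/implyP.
by move: (code s) (code_mem s); apply/allP; vm_compute.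
Qed.

(** The three conditions are those of [Uset] below. Transpositions and double transpositions give
    the same number, so the two classes need not be separated. *)
Lemma S4_inv2 (s : 'S_4) : s * s == 1 -> s != 1 ->
  #|[set t : 'S_4 | [|| s * t == t * s, t * t == 1 | s * t * s == t^-1]]| = 16.
Proof.
rewrite (@card_code (fun l => [|| pmul (code s) l == pmul l (code s), pmul l l == iota 0 4
  | pmul l (pmul (pmul (code s) l) (code s)) == iota 0 4])); last first.
  by move=> t; rewrite -[s * t * s == _](inj_eq (mulgI t)) mulgV !codeE.
rewrite !codeE => s3 s1.
apply/eqP; move: s1; apply/implyP; move: s3; apply/implyP.
by move: (code s) (code_mem s); apply/allP; vm_compute.
Qed.

Lemma odd_order3_Alt (s : 'S_4) : s * s * s = 1 -> s \in 'Alt_('I_4).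
Proof.
move/(congr1 (@odd_perm _)); rewrite Alt_even !odd_permM odd_perm1.
by case: (odd_perm s).
Qed.

Lemma card_Alt4 : #|'Alt_('I_4)| = 12.
Proof. by have := @card_Alt 'I_4; rewrite card_ord => /(_ isT); rewrite !factS fact0; lia. Qed.

(** Elements of cube 1 are even, so more than half of [H] lies in the alternating group, hence all
    of it. *)
Lemma order12_Alt (H : {group 'S_4}) : #|H| = 12 ->
  6 < #|[set s in H | s * s * s == 1]| -> H :=: 'Alt_('I_4).
Proof.
move=> cH h; have: H :&: 'Alt_('I_4) = H.
  have sub: [set s in H | s * s * s == 1] \subset H :&: 'Alt_('I_4).
    by apply/subsetP=> s /setIdP[Hs /eqP s3]; rewrite inE Hs odd_order3_Alt.
  have := cardSg (subsetIl H 'Alt_('I_4)); rewrite cH => /dvdnP[i ei].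
  apply/eqP; rewrite eqEcard subsetIl cH /=.
  have := leq_trans h (subset_leq_card sub); rewrite /= in ei *.
  by case: i ei => [|[|i]]; lia.
by move/setIidPl=> sHA; apply/eqP; rewrite eqEcard sHA card_Alt4 cH.
Qed.

(** * Torus systems *)

(** An abstract form of PSL(2, p), p = 2k + 1. The torus of x has order p (unipotent), k (split) or
    k + 1 (nonsplit). For the last two kinds [ts_norm], [ts_index] and [ts_invol] make the
    normalizer dihedral of twice the order; for order p the normalizer is found later from Sylow's
    theorem. *)
Record torus_system (gT : finGroupType) (G : {group gT}) (k : nat)
    (T : gT -> {group gT}) : Prop := TorusSystem {
  ts_sub : forall x, x \in G^# -> T x \subset G;
  ts_mem : forall x, x \in G^# -> x \in T x;
  ts_eq : forall x y, x \in G^# -> y \in (T x)^# -> T y = T x;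
  ts_conj : forall x g, x \in G^# -> g \in G -> T (x ^ g) = (T x :^ g)%G;
  ts_card : forall x, x \in G^# ->
    [\/ #|T x| = k.*2.+1, #|T x| = k | #|T x| = k.+1];
  ts_cyclic : forall x, x \in G^# -> #|T x| <> k.*2.+1 -> cyclic (T x);
  ts_trans : forall x y, x \in G^# -> y \in G^# ->
    #|T x| = #|T y| -> #|T x| <> k.*2.+1 ->
    exists2 g, g \in G & T y = (T x :^ g)%G;
  ts_norm : forall x, x \in G^# -> #|T x| <> k.*2.+1 ->
    exists2 n, n \in 'N_G(T x) & n \notin T x;
  ts_index : forall x m n, x \in G^# -> #|T x| <> k.*2.+1 ->
    m \in 'N_G(T x) :\: T x -> n \in 'N_G(T x) :\: T x -> m * n^-1 \in T x;
  ts_invol : forall x n, x \in G^# -> #|T x| <> k.*2.+1 ->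
    n \in 'N_G(T x) :\: T x -> n ^+ 2 = 1;
  ts_split : exists2 x, x \in G^# & #|T x| = k;
  ts_nonsplit : exists2 x, x \in G^# & #|T x| = k.+1;
  ts_order : #|G| = (2 * (k.*2.+1 * (k * k.+1)))%N
}.

Section TorusSystem.

Variables (gT : finGroupType) (G : {group gT}) (k : nat) (T : gT -> {group gT}).
Let p := k.*2.+1.
Hypotheses (tsG : torus_system G k T) (p_prime : prime p) (k_ge3 : 2 < k).

Implicit Types (x y g n : gT) (A B H M : {group gT}).

Let TsubG := ts_sub tsG.
Let memT := ts_mem tsG.
Let eqT := ts_eq tsG.
Let TJ := ts_conj tsG.

Lemma T_nontriv x y : x \in G^# -> y \in (T x)^# -> y \in G^#.
Proof.
by move=> Gx; rewrite !inE => /andP[-> /(subsetP (TsubG Gx))].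
Qed.

Lemma T_mem1 x : x \in G^# -> x \in (T x)^#.
Proof. by move=> Gx; have [x1 _] := setD1P Gx; rewrite !inE x1 memT. Qed.

Lemma T_J1 x g : x \in G^# -> g \in G -> x ^ g \in G^#.
Proof. by rewrite !inE conjg_eq1 => /andP[-> Gx] Gg; rewrite groupJ. Qed.

Lemma T_meet x y z :
  x \in G^# -> y \in G^# -> z \in T x -> z \in T y -> z != 1 -> T x = T y.
Proof.
move=> Gx Gy Tx Ty z1; transitivity (T z); last by apply: eqT; rewrite // !inE z1.
by apply/esym/eqT; rewrite // !inE z1.
Qed.

Lemma T_TI x y : x \in G^# -> y \in G^# -> T x <> T y -> T x :&: T y = 1.
Proof.
move=> Gx Gy ne; apply/trivgP/subsetP=> z /setIP[Tx Ty]; rewrite inE.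
by apply: contraT => z1; case: ne; apply: (T_meet Gx Gy Tx Ty).
Qed.

(** Tori meet only in 1, so one nonidentity element that stays in the torus makes the whole torus
    stable. *)
Lemma T_normP x y g :
  x \in G^# -> g \in G -> y \in (T x)^# -> y ^ g \in T x -> g \in 'N_G(T x).
Proof.
move=> Gx Gg Txy; have Gy := T_nontriv Gx Txy; have Tyx := eqT Gx Txy.
move=> Txyg; rewrite inE Gg /=; apply/normP.
suff: (T x :^ g)%G = T x by move/(congr1 (@gval _)).
rewrite -Tyx -TJ // Tyx; apply: eqT => //.
by rewrite !inE Txyg conjg_eq1; case/setD1P: Txy => ->.
Qed.

Lemma T_cyclic x : x \in G^# -> cyclic (T x).
Proof.
move=> Gx; have [eqp | ne] := eqVneq #|T x| p.
  by apply: prime_cyclic; rewrite eqp.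
by apply: (ts_cyclic tsG) => //; apply/eqP.
Qed.

Lemma T_abelian x : x \in G^# -> abelian (T x).
Proof. by move=> Gx; apply: cyclic_abelian; apply: T_cyclic. Qed.

Lemma T_order_dvd x : x \in G^# -> #[x] %| #|T x|.
Proof. by move=> Gx; apply: order_dvdG; apply: memT. Qed.

Lemma T_subN x : x \in G^# -> T x \subset 'N_G(T x).
Proof. by move=> Gx; rewrite subsetI normG TsubG. Qed.

(** * Tori of order k and k + 1 and their dihedral normalizers *)

Section SemisimpleTorus.

Variable x : gT.
Hypotheses (Gx : x \in G^#) (nep : #|T x| <> p).

(** Both n and n y lie outside the torus, hence square to 1. *)
Lemma T_invert n y : n \in 'N_G(T x) :\: T x -> y \in T x -> y ^ n = y^-1.
Proof.
move=> Nn Ty; have n2 := ts_invol tsG Gx nep Nn.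
have: (n * y) ^+ 2 = 1.
  apply: (ts_invol tsG Gx nep); case/setDP: Nn => Nn Tn.
  rewrite inE groupMr // Tn groupM //.
  exact: (subsetP (T_subN Gx)).
have nV : n^-1 = n by apply/eqP; rewrite eq_invg_mul -(expgS n 1) n2.
rewrite expgS expg1 => e; apply: (mulIg y); rewrite mulVg -e conjgE nV.
by rewrite -!mulgA.
Qed.

Lemma card_T_norm : #|'N_G(T x)| = (#|T x|).*2.
Proof.
have [n Nn Tn] := ts_norm tsG Gx nep.
have Dn: n \in 'N_G(T x) :\: T x by rewrite inE Tn.
have ->: 'N_G(T x) = T x :|: T x :* n.
  apply/eqP; rewrite eqEsubset subUset T_subN //= andbC.
  rewrite mul_subG ?T_subN ?sub1set //=; apply/subsetP => m Nm.
  rewrite inE; have [//|Tm /=] := boolP (m \in T x).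
  by rewrite mem_rcoset; apply: (ts_index tsG Gx nep); rewrite // inE Tm.
rewrite cardsU card_rcoset disjoint_setI0 ?cards0 ?subn0 ?addnn //.
rewrite -setI_eq0; apply/eqP/setP => m; rewrite !inE mem_rcoset.
by apply/andP => -[Tm]; rewrite groupMl // groupV (negPf Tn).
Qed.

Lemma card_T_normD : #|'N_G(T x) :\: T x| = #|T x|.
Proof.
by rewrite cardsD (setIidPr (T_subN Gx)) card_T_norm -addnn addnK.
Qed.

Lemma order_T_normD n : n \in 'N_G(T x) :\: T x -> #[n] = 2.
Proof.
move=> Nn; apply: nt_prime_order => //; first exact: (ts_invol tsG Gx nep).
by case/setDP: Nn => _; apply: contraNneq => ->; rewrite group1.
Qed.

Lemma T_mulD n y : n \in 'N_G(T x) :\: T x -> y \in 'N_G(T x) :\: T x ->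
  n * y \in T x.
Proof.
move=> Nn Ny; have y2 := ts_invol tsG Gx nep Ny.
have yV : y^-1 = y by apply/eqP; rewrite eq_invg_mul -(expgS y 1) y2.
by rewrite -yV (ts_index tsG Gx nep).
Qed.

End SemisimpleTorus.

(** * Sylow p-subgroups, centralizers and conjugacy *)

Lemma p_gt6 : 6 < p. Proof. rewrite /p; lia. Qed.

Lemma p_odd : odd p. Proof. by rewrite /p /= odd_double. Qed.

Lemma T_card_pE x : x \in G^# -> (#[x] == p) = (#|T x| == p).
Proof.
move=> Gx; have dx := T_order_dvd Gx; have x1: #[x] != 1%N.
  by rewrite order_eq1; case/setD1P: Gx.
apply/eqP/eqP => e.
  move: dx; rewrite e; case: (ts_card tsG Gx) => [//|h|h]; rewrite h => /dvdn_leq; rewrite /p; lia.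
by case/primeP: p_prime => _ /(_ #[x]); rewrite -e => /(_ dx)/orP[/idPn[]|/eqP].
Qed.

Lemma T_p_cycle x : x \in G^# -> #|T x| = p -> T x :=: <[x]>.
Proof.
move=> Gx cT; apply/eqP; rewrite eq_sym eqEcard cycle_subG memT //= cT.
by rewrite -orderE; move/eqP: cT; rewrite -T_card_pE // => /eqP ->.
Qed.

Lemma p_ndvd_type x : x \in G^# -> #|T x| <> p -> ~~ (p %| #|T x|).
Proof.
move=> Gx ne; apply/negP; case: (ts_card tsG Gx) => // -> /dvdn_leq; rewrite /p; lia.
Qed.

Lemma coprime_cofactor : coprime p (2 * (k * k.+1)).
Proof.
rewrite prime_coprime // !Euclid_dvdM // !negb_or.
by rewrite !gtnNdvd //; rewrite /p; lia.
Qed.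

Lemma cardG_p : #|G| = (p * (2 * (k * k.+1)))%N.
Proof. by rewrite (ts_order tsG) -/p mulnCA. Qed.

Lemma partG_p : (#|G|`_p)%N = p.
Proof.
rewrite cardG_p partnM ?muln_gt0 /=; try lia.
rewrite part_pnat_id ?pnat_id // part_p'nat ?muln1 //.
by rewrite p'natE // -prime_coprime // coprime_cofactor.
Qed.

Lemma pSylow_card A : A \subset G -> p.-Sylow(G) A = (#|A| == p).
Proof. by move=> sAG; rewrite pHallE sAG /= partG_p. Qed.

Lemma T_Sylow x : x \in G^# -> #|T x| = p -> p.-Sylow(G) (T x).
Proof. by move=> Gx cT; rewrite pSylow_card ?TsubG // cT. Qed.

Lemma Sylow_T A x : A \subset G -> #|A| = p -> x \in A^# -> [/\ x \in G^#, A = T x & #|T x| = p].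
Proof.
move=> sAG cA Ax; have [x1 xA] := setD1P Ax.
have Gx: x \in G^# by rewrite !inE x1 (subsetP sAG).
have ox: #[x] = p.
  have: #[x] %| p by rewrite -cA order_dvdG.
  by case/primeP: p_prime => _ /[apply]; rewrite order_eq1 (negPf x1) => /eqP.
have cT: #|T x| = p by apply/eqP; rewrite -T_card_pE // ox.
split=> //; apply/val_inj/eqP; rewrite /= T_p_cycle // eq_sym.
by rewrite eqEcard cycle_subG xA cA -orderE ox /=.
Qed.

(** If y commutes with x, then x normalizes [T y]. This torus is the normal Sylow p-subgroup of its
    normalizer or has only involutions outside it there, so x, of order p > 2, lies in it and the
    two tori agree. *)
Lemma cent_p x : x \in G^# -> #|T x| = p -> 'C_G[x] = T x.
Proof.
move=> Gx cT; apply/eqP; rewrite eqEsubset; apply/andP; split; last first.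
  rewrite subsetI TsubG // (subset_trans (T_abelian Gx)) //.
  by rewrite -cent_set1 centS // sub1set memT.
apply/subsetP=> y /setIP[yG /cent1P xy].
have [-> | y1] := eqVneq y 1; first exact: group1.
have Gy: y \in G^# by rewrite !inE y1.
have ox: #[x] = p by apply/eqP; rewrite T_card_pE // cT.
have xG: x \in G by case/setD1P: Gx.
have Nx: x \in 'N_G(T y).
  apply: (T_normP Gy xG (y := y)); first by rewrite !inE y1 memT.
  by rewrite conjgE xy mulKg memT.
have Txy: x \in T y.
  apply: contraT => Tx; have [cTy | nep] := eqVneq #|T y| p.
    have sy := T_Sylow Gy cTy.
    have: p.-elt x by rewrite /p_elt ox pnat_id.
    have sN: p.-Sylow('N_G(T y)) (T y).
      by rewrite (pHall_subl _ _ sy) ?subsetIl // T_subN.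
    rewrite -(mem_normal_Hall sN) ?(negPf Tx) //.
    by rewrite /normal T_subN // subsetIr.
  have := order_T_normD Gy (elimN eqP nep) (n := x).
  by rewrite inE Tx => /(_ Nx); rewrite ox /p; lia.
by rewrite (T_meet Gx Gy (memT Gx) Txy) ?memT //; case/setD1P: Gx.
Qed.

(** The normalizer fixes or inverts the elements of the torus, and for an involution these are the
    same. *)
Lemma cent_inv x : x \in G^# -> #[x] = 2 -> 'C_G[x] = 'N_G(T x).
Proof.
move=> Gx ox; have x2: x ^+ 2 = 1 by rewrite -ox expg_order.
have nep: #|T x| <> p by move/eqP; rewrite -T_card_pE // ox /p; lia.
have Tx := T_mem1 Gx.
apply/eqP; rewrite eqEsubset; apply/andP; split; apply/subsetP=> y.
  case/setIP=> Gy /cent1P xy; apply: (T_normP Gx Gy Tx).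
  by rewrite conjgE -xy mulKg memT.
move=> Ny; have [Gy _] := setIP Ny; rewrite inE Gy; apply/cent1P.
have [Ty | Ty] := boolP (y \in T x).
  exact: (centsP (T_abelian Gx) _ Ty _ (memT Gx)).
have /(_ x) := T_invert Gx nep (n := y) _ _; rewrite inE Ty Ny memT // => e.
rewrite /commute [RHS]conjgC e //; congr (_ * _).
by apply/esym/eqP; rewrite eq_invg_mul -(expgS x 1) x2.
Qed.

Lemma cent_semisimple x : x \in G^# -> #|T x| <> p -> #[x] != 2 -> 'C_G[x] = T x.
Proof.
move=> Gx nep ox; apply/eqP; rewrite eqEsubset; apply/andP; split; last first.
  rewrite subsetI TsubG // (subset_trans (T_abelian Gx)) //.
  by rewrite -cent_set1 centS // sub1set memT.
have Tx := T_mem1 Gx.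
apply/subsetP=> y /setIP[Gy /cent1P xy]; apply: contraT => Ty.
have xyx: x ^ y = x by rewrite conjgE -xy mulKg.
have Ny: y \in 'N_G(T x) by apply: (T_normP Gx Gy Tx); rewrite xyx memT.
have := T_invert Gx nep (n := y) _ (memT Gx); rewrite inE Ty Ny xyx => /(_ isT) /eqP.
rewrite eq_sym eq_invg_mul => /eqP x2; case/eqP: ox.
by apply: nt_prime_order => //; case/setD1P: Gx.
Qed.

Lemma TG x : x \in G^# -> x \in G. Proof. by case/setD1P. Qed.

Lemma T_inN x y : x \in G^# -> y \in T x -> y \in 'N_G(T x).
Proof. by move=> Gx; apply: subsetP; apply: T_subN. Qed.

(** The tori are conjugate, and a cyclic group has at most one subgroup of each order. *)
Lemma same_cycle_conj x y : x \in G^# -> y \in G^# -> #|T x| <> p ->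
  #|T x| = #|T y| -> #[x] = #[y] -> exists2 g, g \in G & <[x ^ g]> = <[y]>.
Proof.
move=> Gx Gy nep eT eo; have [g Gg Tyg] := ts_trans tsG Gx Gy eT nep.
exists g => //; apply/eqP; rewrite (eq_subG_cyclic (T_cyclic Gy)).
- by rewrite -!orderE orderJ eo.
- by rewrite cycle_subG Tyg /= memJ_conjg memT.
by rewrite cycle_subG memT.
Qed.

Lemma inv_type x : x \in G^# -> #[x] = 2 -> #|T x| = (if odd k then k.+1 else k).
Proof.
move=> Gx ox; have := T_order_dvd Gx; rewrite ox dvdn2.
case: (ts_card tsG Gx) => -> //=; first by rewrite odd_double.
  by case: (odd k).
by case: (odd k).
Qed.

Lemma inv_nep x : x \in G^# -> #[x] = 2 -> #|T x| <> p.
Proof. by move=> Gx ox; rewrite (inv_type Gx ox) /p; case: ifP; lia. Qed.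

Lemma inv_conj x y : x \in G -> y \in G -> #[x] = 2 -> #[y] = 2 ->
  exists2 g, g \in G & x ^ g = y.
Proof.
have nt z : z \in G -> #[z] = 2 -> z \in G^#.
  by move=> Gz oz; rewrite !inE Gz andbT -order_gt1 oz.
move=> Gx Gy ox oy; have [| | |g Gg] := @same_cycle_conj x y (nt x Gx ox) (nt y Gy oy).
- by apply: inv_nep; rewrite ?nt.
- by rewrite !inv_type ?nt.
- by rewrite ox.
rewrite !cycle2g ?orderJ // => /setP/(_ (x ^ g)); rewrite !inE eqxx orbT => /esym e.
exists g => //; apply/eqP.
by move: e; rewrite conjg_eq1 -[x == 1]order_eq1 ox.
Qed.

(** * Counting tori *)

Definition tori m := [set T x | x in G^# & #|T x| == m].

Lemma toriP m A : reflect (exists2 x, x \in G^# & A = T x /\ #|T x| = m) (A \in tori m).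
Proof.
apply: (iffP imsetP) => [[x /[!inE]/andP[Gx /eqP cT] ->] | [x Gx [-> cT]]].
  by exists x; rewrite ?inE.
by exists x; rewrite ?cT // !inE in Gx *; rewrite Gx cT eqxx.
Qed.

(** Orbit-stabilizer: these tori form one class, and the stabilizer has order 2m. *)
Lemma card_tori_mul m : m <> p -> (exists2 x, x \in G^# & #|T x| = m) ->
  (#|tori m| * m.*2)%N = #|G|.
Proof.
move=> nep [x Gx cT]; have nepx: #|T x| <> p by rewrite cT.
have ->: tori m = orbit 'JG G (T x).
  apply/setP=> A; apply/toriP/orbitP => [[y Gy [-> cTy]]|[g Gg <-]].
    have [|g Gg ->] := ts_trans tsG Gx Gy _ nepx; first by rewrite cT.
    by exists g.
  by exists (x ^ g); rewrite ?T_J1 // TJ //= cardJg.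
rewrite card_orbit astab1JG -cT -card_T_norm // mulnC.
by rewrite Lagrange ?subsetIl.
Qed.

Lemma card_tori_split : #|tori k| = (p * k.+1)%N.
Proof.
have := card_tori_mul _ (ts_split tsG); rewrite (ts_order tsG) -/p => e.
have {e}/e : k <> p by rewrite /p; lia.
nia.
Qed.

Lemma card_tori_nonsplit : #|tori k.+1| = (p * k)%N.
Proof.
have := card_tori_mul _ (ts_nonsplit tsG); rewrite (ts_order tsG) -/p => e.
have {e}/e : k.+1 <> p by rewrite /p; lia.
nia.
Qed.

Lemma card_T_fibers m : #|[set x in G^# | #|T x| == m]| = (#|tori m| * m.-1)%N.
Proof.
rewrite -sum1_card (partition_big_imset T) /= -sum_nat_const.
apply: eq_bigr => A /toriP[x Gx [-> cT]].
rewrite -cT; have -> : #|T x|.-1 = #|(T x)^#| by rewrite (cardsD1 1 (T x)) group1.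
rewrite sum1dep_card; congr #|pred_of_set _|; apply/setP=> y; apply/setIdP/idP.
  by case=> /setIdP[Gy _] /eqP <-; apply: T_mem1.
by move=> Ty; rewrite inE (T_nontriv Gx Ty) (eqT Gx Ty) !eqxx.
Qed.

(** The tori of the other two orders leave p^2 - 1 nonidentity elements, p - 1 for each torus of
    order p. *)
Lemma card_tori_p : #|tori p| = p.+1.
Proof.
have: #|G^#| = (#|[set x in G^# | #|T x| == p]| + (#|[set x in G^# | #|T x| == k]|
   + #|[set x in G^# | #|T x| == k.+1]|))%N.
  rewrite addnC; set A := [set x in _ | _ == k]; set B := [set x in _ | _ == k.+1].
  have dAB: A :&: B = set0.
    by apply/setP=> x; rewrite !inE; apply/negP => /andP[/andP[_ /eqP->] /andP[_]]; lia.
  set C := [set x in _ | _ == p].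
  have dC: (A :|: B) :&: C = set0.
    apply/setP=> x; rewrite !inE; apply/negP => /andP[h /andP[_ /eqP e]].
    by case/orP: h => /andP[_]; rewrite e /p; lia.
  rewrite -[X in (X + _)%N]cardsUI dAB cards0 addn0 -cardsUI dC cards0 addn0; congr #|pred_of_set _|; apply/setP=> x; apply/idP/idP => [Gx | ].
    have inT m: (x \in [set y in G^# | #|T y| == m]) = (#|T x| == m) by rewrite inE Gx.
    rewrite !in_setU !inT.
    by case: (ts_card tsG Gx) => ->; rewrite eqxx ?orbT.
  by case/setUP => [/setUP[]|] /setIdP[].
rewrite !card_T_fibers card_tori_split card_tori_nonsplit.
have := cardsD1 1 G; rewrite group1 (ts_order tsG) -/p => e1 e2.
have: (#|tori p| * p.-1 = p.+1 * p.-1)%N.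
  move: e1 e2; move: (_ * p.-1)%N #|_| => X Y; rewrite /p.
  by case: (k) k_ge3 => // m _ /=; lia.
by move/eqP; rewrite eqn_pmul2r => [/eqP //|]; rewrite /p; lia.
Qed.

(** * Borel subgroups, the normalizers of the Sylow p-subgroups *)

Lemma Syl_tori : 'Syl_p(G) = tori p.
Proof.
apply/setP=> A; rewrite inE; apply/idP/toriP => [sA | [x Gx [-> cT]]]; last exact: T_Sylow.
have sAG := pHall_sub sA; move: sA; rewrite pSylow_card // => /eqP cA.
have /trivgPn[x Ax x1]: A :!=: 1 by rewrite -cardG_gt1 cA prime_gt1.
have [|Gx eA cT] := Sylow_T sAG cA (x := x); first by rewrite !inE x1.
by exists x.
Qed.

Lemma exists_T_p : exists2 x, x \in G^# & #|T x| = p.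
Proof.
have /card_gt0P[A /toriP[x Gx [_ cT]]] : 0 < #|tori p| by rewrite card_tori_p.
by exists x.
Qed.

(** Its index is the number p + 1 of Sylow p-subgroups. *)
Lemma card_Borel u : u \in G^# -> #|T u| = p -> #|'N_G(T u)| = (p * k)%N.
Proof.
move=> Gu cT; have := card_Syl (T_Sylow Gu cT); rewrite Syl_tori card_tori_p.
have := Lagrange (subsetIl G 'N(T u)); rewrite (ts_order tsG) -/p => e eI; rewrite -eI in e.
apply/eqP; rewrite -(@eqn_pmul2r p.+1) // e; apply/eqP; rewrite /p; lia.
Qed.

(** A Schur-Zassenhaus complement acts faithfully on [T u], because u is centralized by [T u] alone,
    so it embeds in a cyclic automorphism group. The torus of a generator then has order divisible
    by k, which leaves k. *)
Lemma Borel_sdprod u : u \in G^# -> #|T u| = p ->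
  exists2 h, h \in G^# & #|T h| = k /\ T u ><| T h = 'N_G(T u).
Proof.
move=> Gu cT; have nP: T u <| 'N_G(T u) by rewrite /normal T_subN ?subsetIr.
have hP: Hall 'N_G(T u) (T u).
  apply: (@pHall_Hall _ p); apply: (pHall_subl (T_subN Gu) (subsetIl _ _)).
  exact: T_Sylow.
have /splitsP[K /complP[tiPK defN]] := SchurZassenhaus_split hP nP.
have sKN: K \subset 'N_G(T u) by rewrite -defN mulG_subr.
have [sKG nPK] := subsetIP sKN.
have cK: #|K| = k.
  have := card_Borel Gu cT; rewrite -defN TI_cardMg // cT => /eqP.
  by rewrite eqn_pmul2l // => /eqP.
have cycK: cyclic K.
  have inj: 'injm (restrm nPK (conj_aut (T u))).
    rewrite ker_restrm ker_conj_aut -tiPK subsetI subsetIl andbT.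
    apply/subsetP=> y /setIP[Ky cy]; rewrite -(cent_p Gu cT) inE (subsetP sKG) //=.
    by apply/cent1P/(centP cy)/memT.
  rewrite -(injm_cyclic inj) //.
  apply: cyclicS (Aut_prime_cyclic (G := T u) _); last by rewrite cT.
  by rewrite /= morphim_restrm setIid Aut_conj_aut.
have [h eK] := cyclicP cycK; have Kh: h \in K by rewrite eK cycle_id.
have Gh: h \in G^#.
  by rewrite !inE (subsetP sKG) // andbT -order_gt1 orderE -eK cK; lia.
have cTh: #|T h| = k.
  have: #|K| %| #|T h| by rewrite cardSg // eK cycle_subG memT.
  rewrite cK; case: (ts_card tsG Gh) => // ->.
    case/primeP: p_prime => _ /(_ k) ip /ip /orP[]/eqP; rewrite /p; lia.
  by rewrite -addn1 dvdn_addr // dvdn1 => /eqP; lia.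
have eKT: K = T h.
  apply/val_inj/eqP; rewrite /= eqEcard cTh cK leqnn andbT eK.
  by rewrite cycle_subG memT.
exists h => //; split => //; rewrite -eKT sdprodE //.
Qed.

(** * Perfectness of G *)

Definition pgen : {group gT} := <<[set x in G | #[x] == p]>>%G.

Lemma pgen_norm : G \subset 'N(pgen).
Proof.
apply: norms_gen; apply/subsetP=> g Gg; rewrite inE; apply/subsetP=> _ /imsetP[x xP ->].
by move: xP; rewrite !inE orderJ => /andP[Gx ->]; rewrite groupJ.
Qed.

Lemma T_sub_pgen u : u \in G^# -> #|T u| = p -> T u \subset pgen.
Proof.
move=> Gu cT; rewrite T_p_cycle // cycle_subG mem_gen // inE T_card_pE //.
by rewrite cT eqxx (TG Gu).
Qed.

(** Frattini's argument gives G = [pgen] times [T h], so G modulo [pgen] is abelian. For a generator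
    t of [T h], the involutions w and w t are conjugate, so t is a commutator and lies in [pgen]
    too. *)
Lemma pgenE : pgen :=: G.
Proof.
have nN := pgen_norm; have [u Gu cT] := exists_T_p.
have sNG: pgen \subset G by rewrite gen_subG; apply/subsetP=> x /setIdP[].
have nsN: pgen <| G by rewrite /normal sNG nN.
have sP: p.-Sylow(pgen) (T u).
  by apply: pHall_subl (T_Sylow Gu cT); rewrite ?T_sub_pgen.
have [h Gh [cTh defB]] := Borel_sdprod Gu cT.
have neh: #|T h| <> p by rewrite cTh /p; lia.
have defG: pgen * T h = G.
  have <- := Frattini_arg nsN sP; have [_ <- _ _] := sdprodP defB.
  by rewrite mulgA (mulGSid (T_sub_pgen Gu cT)).
suff sTh: T h \subset pgen by rewrite -defG mulGSid.
have [w Nw Tw] := ts_norm tsG Gh neh.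
have /cyclicP[t eT] := T_cyclic Gh.
have Th: t \in T h by rewrite eT cycle_id.
have Dw: w \in 'N_G(T h) :\: T h by rewrite inE Tw.
have Dwt: w * t \in 'N_G(T h) :\: T h.
  by rewrite inE groupMr // Tw groupM // T_inN.
have [Gw _] := setIP Nw; have Gt := subsetP (TsubG Gh) _ Th.
have [||||g Gg ewt] := @inv_conj w (w * t); rewrite ?groupM //.
- exact: (order_T_normD Gh neh).
- exact: (order_T_normD Gh neh).
have dG: G^`(1) \subset pgen.
  apply: der1_min => //; rewrite -defG quotientMidl.
  by rewrite quotient_abelian // T_abelian.
have et: t = [~ w, g] by rewrite commgEl ewt mulKg.
by rewrite eT cycle_subG et (subsetP dG) // mem_commg.
Qed.

(** For u of order p, a complement in its Borel subgroup moves u, and the nontrivial commutator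
    [u, h] generates the group of order p containing u. *)
Lemma der1_G : G^`(1) = G.
Proof.
apply/eqP; rewrite eqEsubset der_sub -{1}pgenE gen_subG; apply/subsetP=> u.
rewrite inE => /andP[Gu /eqP ou].
have {}Gu: u \in G^# by rewrite !inE Gu andbT -order_gt1 ou prime_gt1.
have cT: #|T u| = p by apply/eqP; rewrite -T_card_pE // ou.
have [h Gh [cTh defB]] := Borel_sdprod Gu cT.
have [_ _ nPT tiPT] := sdprodP defB.
have Ph: u ^ h \in T u by rewrite memJ_norm ?memT // (subsetP nPT) ?memT.
have c1: [~ u, h] != 1.
  apply/negP => /commgP cuh.
  have: h \in 'C_G[u] by rewrite inE (TG Gh); apply/cent1P/commute_sym.
  rewrite cent_p // => Pu; have: h \in T u :&: T h by rewrite !inE Pu memT.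
  by rewrite tiPT inE; case/setD1P: Gh => /negPf->.
have cP: [~ u, h] \in (T u)^# by rewrite !inE c1 commgEl groupM ?groupV ?memT.
have cG: [~ u, h] \in G^`(1) by rewrite mem_commg ?TG.
have e := eqT Gu cP; rewrite -cycle_subG -T_p_cycle // -e.
have Gc := T_nontriv Gu cP.
by rewrite T_p_cycle ?e // cycle_subG.
Qed.

Lemma not_solG : ~~ solvable G.
Proof.
apply/negP=> /sol_der1_proper/(_ (subxx G)); rewrite der1_G properxx => /(_ _) h.
have: G :!=: 1 by rewrite -cardG_gt1 cardG_p /p; nia.
by move/h.
Qed.

(** * Subgroups of G and solubility of the proper ones *)

Lemma p_subgroup_cases H : H \subset G -> p %| #|H| ->
  H :=: G \/ exists2 u, u \in G^# & #|T u| = p /\ H \subset 'N_G(T u).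
Proof.
move=> sHG pH; have [P sP] := Sylow_exists p H.
have sPG := subset_trans (pHall_sub sP) sHG.
have cP: #|P| = p.
  rewrite (card_Hall sP); apply/eqP; rewrite eqn_dvd.
  by rewrite -{2}partG_p partn_dvd ?cardSg //= -{1}(part_pnat_id (pnat_id p_prime)) partn_dvd.
have /trivgPn[u Pu u1]: P :!=: 1 by rewrite -cardG_gt1 cP prime_gt1.
have [|Gu eP cT] := Sylow_T sPG cP (x := u); first by rewrite !inE u1.
have [c1 | cn1] := eqVneq #|'Syl_p(H)| 1%N.
  right; exists u => //; split=> //; rewrite -eP.
  move: c1; rewrite (card_Syl sP) => /eqP; rewrite indexg_eq1 => /subsetIP[_ nPH].
  by rewrite subsetI sHG.
(* The number of Sylow p-subgroups is 1 modulo p; if not 1, it is at least p + 1, and [H] has all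
   those of [G]. *)
left; have := card_Syl_mod H p_prime => cm.
have sS: 'Syl_p(H) \subset 'Syl_p(G).
  apply/subsetP=> Q; rewrite !inE => sQ; rewrite pSylow_card; last exact: subset_trans (pHall_sub sQ) sHG.
  by rewrite (card_Hall sQ) -(card_Hall sP) cP.
have eS: 'Syl_p(H) = 'Syl_p(G).
  apply/eqP; rewrite eqEcard sS Syl_tori card_tori_p leqNgt; apply/negP => lt.
  have := divn_eq #|'Syl_p(H)| p; rewrite cm.
  by case: (_ %/ _) => [|n]; [rewrite add0n => /eqP; rewrite (negPf cn1)|rewrite /p in lt *; nia].
apply/eqP; rewrite eqEsubset sHG -{1}pgenE gen_subG; apply/subsetP=> v.
rewrite inE => /andP[Gv /eqP ov].
have {}Gv: v \in G^# by rewrite !inE Gv andbT -order_gt1 ov prime_gt1.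
have cTv: #|T v| = p by apply/eqP; rewrite -T_card_pE // ov.
have: T v \in 'Syl_p(H) by rewrite eS inE T_Sylow.
by rewrite inE => /pHall_sub/subsetP; apply; apply: memT.
Qed.

Lemma p'_type H x : H \subset G -> ~~ (p %| #|H|) -> x \in H^# ->
  x \in G^# /\ #|T x| <> p.
Proof.
move=> sHG pH /setD1P[x1 Hx]; have Gx: x \in G^# by rewrite !inE x1 (subsetP sHG).
split=> // cT; case/negP: pH; rewrite -cT T_p_cycle // -orderE.
exact: order_dvdG.
Qed.

(** The traces [T x :&: H] cover [H] and meet pairwise in 1. Their nonidentity elements, summed over
    the conjugacy classes of traces, make up [H^#]; i > 1 in each term because [H] normalizes no
    torus. *)
Lemma class_equation H : H \subset G -> ~~ (p %| #|H|) -> H :!=: 1 ->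
  (forall x, x \in G^# -> ~~ (H \subset 'N_G(T x))) ->
  #|H| \in [:: 12; 24; 60]%N.
Proof.
move=> sHG pH H1 nHT; have typ x := @p'_type H x sHG pH.
pose I x := (T x :&: H)%G; pose S := I @: H^#.
have I_J x g : x \in H^# -> g \in H -> I (x ^ g) = (I x :^ g)%G.
  move=> Hx Hg; have [Gx _] := typ x Hx; apply/val_inj.
  by rewrite /= TJ ?(subsetP sHG) // conjIg (conjGid Hg).
have HJ x g : x \in H^# -> g \in H -> x ^ g \in H^#.
  by rewrite !inE conjg_eq1 => /andP[-> Hx] Hg; rewrite groupJ.
have actS: [acts H, on S | 'JG].
  apply/actsP=> g Hg A; apply/imsetP/imsetP => [] [x Hx eA].
    exists (x ^ g^-1); first by rewrite HJ ?groupV.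
    by rewrite I_J ?groupV // -eA /=; apply/val_inj; rewrite /= conjsgK.
  by exists (x ^ g); rewrite ?HJ // I_J // eA.
pose O := [set orbit 'JG H A | A in S].
pose v (X : {set {group gT}}) := \sum_(A in X) #|A|.-1.
have h1 : 1 < #|H| by rewrite cardG_gt1.
apply: (class_equation_arith (s := [seq v X | X <- enum O])) => //.
  move=> _ /mapP[X /[!mem_enum] /imsetP[A SA ->] ->].
  have [x Hx eA] := imsetP SA; have [Gx nep] := typ x Hx.
  have xH : x \in H by case/setD1P: Hx.
  have Ax : x \in A by rewrite eA inE memT.
  have x1 : x != 1 by case/setD1P: Hx.
  (* A trace has nonidentity elements, so normalizing it amounts to normalizing the torus. *)
  have eN : 'N_H(A) = H :&: 'N_G(T x).
    apply/setP=> g; rewrite 2![in LHS]inE [in RHS]inE; apply: andb_id2l => Hg.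
    have Gg := subsetP sHG _ Hg; apply/idP/idP => Ng.
      apply: (T_normP Gx Gg (T_mem1 Gx)).
      have: x ^ g \in A by rewrite memJ_norm // inE.
      by rewrite eA => /setIP[].
    have [_ ng] := setIP Ng.
    by rewrite eA /= conjIg (normP ng) (conjGid Hg).
  exists #|A|, #|'N_H(A) : A|, #|H : 'N_H(A)|.
  have sAN: A \subset 'N_H(A) by rewrite subsetI normG eA subsetIr.
  split.
  - by rewrite cardG_gt1; apply/trivgPn; exists x.
  (* In its normalizer a torus has a single nontrivial coset, so the index is 1 or 2. *)
  - have [sNA | /subsetPn[n Nn An]] := boolP ('N_H(A) \subset A).
      by left; apply/eqP; rewrite indexg_eq1.
    right; apply/eqP; rewrite -(eqn_pmul2l (cardG_gt0 A)) Lagrange //.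
    have Dn y : y \in 'N_H(A) -> y \notin A -> y \in 'N_G(T x) :\: T x.
      rewrite eN eA => /setIP[Hy Ny] /= TyH; apply/setDP; split=> //.
      by apply: contra TyH => Ty; rewrite inE Ty.
    rewrite /=; have ->: 'N_H(A) = A :|: A :* n.
      apply/eqP; rewrite eqEsubset subUset sAN /= andbC.
      rewrite mul_subG ?sub1set //=; apply/subsetP => m Nm.
      rewrite inE; have [//|Am /=] := boolP (m \in A).
      have Tmn := ts_index tsG Gx nep (Dn m Nm Am) (Dn n Nn An).
      rewrite mem_rcoset; move: (m * n^-1) Tmn (groupM (subsetP (subsetIl _ _) _ Nm) (groupVr (subsetP (subsetIl _ _) _ Nn))) => z Tz Hz.
      by rewrite eA inE Tz.
    rewrite cardsU card_rcoset disjoint_setI0 ?cards0 ?subn0 ?addnn ?muln2 //.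
    rewrite -setI_eq0; apply/eqP/setP => m; rewrite !inE mem_rcoset.
    by apply/andP => -[Am]; rewrite groupMl // groupV (negPf An).
  - rewrite indexg_gt1 /= eN; apply: contra (nHT x Gx) => /subset_trans; apply.
    exact: subsetIr.
  - by rewrite [(#|_ : _| * #|A|)%N]mulnC Lagrange // mulnC Lagrange ?subsetIl.
  have := card_orbit 'JG H A; rewrite astab1JG => <-.
  rewrite -sum_nat_const; apply: eq_bigr => B /orbitP[g _ <-] /=.
  by rewrite cardJg.
rewrite sumnE big_map big_enum /= -(set_partition_big _ (orbit_partition actS)).
have -> : #|H| = #|H^#|.+1 by rewrite (cardsD1 1 H) group1.
congr _.+1; rewrite -[in RHS]sum1_card (partition_big_imset I) /=.
apply: eq_bigr => A /imsetP[x Hx ->]; have [Gx _] := typ x Hx.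
have -> : #|I x|.-1 = #|(I x)^#| by rewrite (cardsD1 1 (I x)) group1.
rewrite sum1dep_card; congr #|pred_of_set _|; apply/setP=> y; apply/idP/idP.
  move=> /setD1P[y1 /setIP[Ty Hy]]; have Dy: y \in (T x)^# by rewrite !inE y1.
  by rewrite inE /I (eqT Gx Dy) !inE y1 Hy eqxx.
case/setIdP=> Hy /eqP <-; have [Gy _] := typ y Hy.
by case/setD1P: Hy => y1 Hy; rewrite !inE y1 Hy memT.
Qed.

Lemma sol_T_norm x : x \in G^# -> solvable 'N_G(T x).
Proof.
move=> Gx; have nT: T x <| 'N_G(T x) by rewrite /normal T_subN // subsetIr.
rewrite (series_sol nT) (abelian_sol (T_abelian Gx)) /=.
have [cT | /eqP nep] := eqVneq #|T x| p.
  have [h Gh [_ /sdprodP[_ <- _ _]]] := Borel_sdprod Gx cT.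
  by rewrite quotientMidl quotient_sol // abelian_sol // T_abelian.
apply: abelian_sol; apply: cyclic_abelian; apply: cyclic_small.
rewrite card_quotient ?subsetIr // -divgS ?T_subN // card_T_norm //.
by rewrite -muln2 mulKn.
Qed.

Hypothesis n5G : ~~ (5 %| #|G|)%N.

(** Burnside's two-prime theorem covers the orders 12 and 24 left by the class equation; 60 is
    excluded since 5 does not divide |G|. *)
Lemma proper_sol H : H \proper G -> solvable H.
Proof.
case/andP=> sHG nsGH; have [pH | pH] := boolP (p %| #|H|).
  have [eHG|[u Gu [_ sH]]] := p_subgroup_cases sHG pH; last first.
    exact: solvableS sH (sol_T_norm Gu).
  by rewrite eHG subxx in nsGH.
have [-> | H1] := eqVneq (H : {set gT}) 1; first exact: solvable1.
have [/existsP[x /andP[Gx sHN]] | nH] := boolP [exists x in G^#, H \subset 'N_G(T x)].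
  exact: solvableS sHN (sol_T_norm Gx).
have/(class_equation sHG pH H1) : forall x, x \in G^# -> ~~ (H \subset 'N_G(T x)).
  by move=> x Gx; apply: contra nH => sHN; apply/existsP; exists x; rewrite Gx.
rewrite !inE => /or3P[]/eqP cH; first by apply: Burnside_p_a_q_b; rewrite cH.
  by apply: Burnside_p_a_q_b; rewrite cH.
by case/negP: n5G; apply: dvdn_trans (cardSg sHG); rewrite cH.
Qed.

(** * Involutions and Klein four-groups *)

Lemma double_sum (F : {set {group gT}}) (f : {group gT} -> {set gT}) (X : {set gT}) :
  \sum_(x in X) #|[set A in F | x \in f A]| = \sum_(A in F) #|f A :&: X|.
Proof.
under eq_bigr => x _ do rewrite -sum1dep_card.
rewrite (exchange_big_dep (mem F)) /=; last by move=> x A _ /andP[].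
apply: eq_bigr => A FA; rewrite sum1dep_card; congr #|pred_of_set _|.
by apply/setP=> x; rewrite !inE FA andbC.
Qed.

Lemma double_count (F : {set {group gT}}) (f : {group gT} -> {set gT}) (X : {set gT}) c :
  (forall x, x \in X -> #|[set A in F | x \in f A]| = c) ->
  (#|X| * c)%N = \sum_(A in F) #|f A :&: X|.
Proof. by move=> cX; rewrite -double_sum -sum_nat_const; apply/esym/eq_bigr. Qed.

Lemma count_conj (F : {set {group gT}}) (f : {group gT} -> {set gT}) x g :
    (forall A, A \in F -> forall h, h \in G -> (A :^ h)%G \in F) ->
    (forall (A : {group gT}) h, h \in G -> f (A :^ h)%G = f A :^ h) -> g \in G ->
  #|[set A in F | x ^ g \in f A]| = #|[set A in F | x \in f A]|.
Proof.
move=> FJ fJ Gg; rewrite -(card_imset (mem [set A in F | x \in f A]) (act_inj 'JG g)).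
congr #|pred_of_set _|; apply/setP=> A; apply/idP/imsetP.
  move=> /setIdP[FA xA]; exists ('JG%act A g^-1); last by rewrite actKV.
  by rewrite inE /= FJ ?groupV //= fJ ?groupV // mem_conjgV xA.
by case=> B /setIdP[FB xB] -> /=; rewrite inE FJ //= fJ // memJ_conjg xB.
Qed.

Lemma uniq_inv x a b : x \in G^# -> a \in T x -> b \in T x ->
  #[a] = 2 -> #[b] = 2 -> a = b.
Proof.
move=> Gx Ta Tb oa ob.
have : <[a]> == <[b]> by rewrite (eq_subG_cyclic (T_cyclic Gx)) ?cycle_subG // -!orderE oa ob.
rewrite eqEsubset => /andP[_]; rewrite cycle_subG /= cycle2g // !inE => /orP[/eqP b1|/eqP//].
by rewrite b1 order1 in ob.
Qed.

(* q is the order of the torus of an involution (see inv_type). *)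
Definition q := if odd k then k.+1 else k.

Lemma q_even : ~~ odd q. Proof. by rewrite /q; case: ifP => //= ->. Qed.

Lemma q_ge4 : 3 < q.
Proof. by rewrite /q; case: ifP => //; case: (k) k_ge3 => [|[|[|[|?]]]]. Qed.

Lemma invG x : x \in G -> #[x] = 2 -> x \in G^#.
Proof. by move=> Gx ox; rewrite !inE Gx andbT -order_gt1 ox. Qed.

Lemma card_cent_inv a : a \in G -> #[a] = 2 -> #|'C_G[a]| = q.*2.
Proof.
move=> Ga oa; have Ga1 := invG Ga oa.
rewrite cent_inv // card_T_norm //; last exact: inv_nep.
by rewrite (inv_type Ga1).
Qed.

Definition invols := [set x in G | #[x] == 2].

Lemma cent_invD a b : a \in G -> #[a] = 2 -> b \in G -> #[b] = 2 -> b != a ->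
  commute a b -> b \in 'N_G(T a) :\: T a.
Proof.
move=> Ga oa Gb ob nab cab; have Ga1 := invG Ga oa.
rewrite inE -cent_inv // inE Gb; apply/andP; split; last exact/cent1P/commute_sym.
apply: contra nab => Tb; apply/eqP; apply: (uniq_inv Ga1) => //; exact: memT.
Qed.

Lemma card_invols : (#|invols| * q.*2)%N = #|G|.
Proof.
have [x Gx cT] : exists2 x, x \in G^# & #|T x| = q.
  by rewrite /q; case: ifP => _; [apply: (ts_nonsplit tsG) | apply: (ts_split tsG)].
have [|a Ta oa] := @Cauchy _ 2 (T x) isT; first by rewrite cT dvdn2 q_even.
have Ga := subsetP (TsubG Gx) _ Ta.
have -> : invols = a ^: G.
  apply/setP=> b; rewrite inE; apply/andP/imsetP => [[Gb /eqP ob]|[g Gg ->]].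
    by have [g Gg <-] := inv_conj Ga Gb oa ob; exists g.
  by rewrite groupJ // orderJ oa.
by rewrite -index_cent1 -(card_cent_inv Ga oa) mulnC Lagrange ?subsetIl.
Qed.

Definition kleins := [set V : {group gT} | [&& V \subset G, 2.-abelem V & #|V| == 4]].

Lemma kleins_J V g : V \in kleins -> g \in G -> (V :^ g)%G \in kleins.
Proof. by rewrite !inE => /and3P[sVG aV cV] Gg; rewrite abelemJ aV cardJg cV -{1}(conjGid Gg) conjSg sVG. Qed.

Section Klein.

Variable V : {group gT}.
Hypothesis kV : V \in kleins.

Lemma klein_sub : V \subset G. Proof. by move: kV; rewrite inE => /and3P[]. Qed.
Lemma klein_abel : abelian V. Proof. by move: kV; rewrite inE => /and3P[_ /abelem_abelian]. Qed.
Lemma klein_card : #|V| = 4. Proof. by move: kV; rewrite inE => /and3P[_ _ /eqP]. Qed.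
Lemma klein_order a : a \in V -> a != 1 -> #[a] = 2.
Proof. by move: kV; rewrite inE => /and3P[_ aV _]; apply: abelem_order_p. Qed.
Lemma klein_sq a : a \in V -> a * a = 1.
Proof.
move=> Va; have [->|a1] := eqVneq a 1; first by rewrite mulg1.
by rewrite -(expgS a 1) -(klein_order Va a1) expg_order.
Qed.

Lemma klein_set a b : a \in V -> b \in V -> a != 1 -> b != 1 -> a != b ->
  V :=: [set 1; a; b; a * b].
Proof.
move=> Va Vb a1 b1 ab; apply/eqP; rewrite eq_sym eqEcard klein_card.
rewrite !subUset !sub1set group1 Va Vb groupM //=.
have ab1: a * b != 1 by rewrite -eq_invg_mul; apply: contra ab => /eqP <-; rewrite eq_sym eq_invg_mul klein_sq.
have aba: a * b != a by rewrite -{2}[a]mulg1 (inj_eq (mulgI a)).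
have abb: a * b != b by rewrite -{2}[b]mul1g (inj_eq (mulIg b)).
rewrite [_ |: [set a]]setUC -!setUA [[set b] :|: _]setUC.
by rewrite !cardsU1 cards1 !inE !negb_or ![1 == _]eq_sym [a == a * b]eq_sym a1 b1 ab1 ab aba abb.
Qed.

Lemma klein_normD a b : a \in V -> b \in V -> a != 1 -> b != 1 -> b != a ->
  b \in 'N_G(T a) :\: T a.
Proof.
move=> Va Vb a1 b1 ba; apply: cent_invD; rewrite ?klein_order ?(subsetP klein_sub) //.
exact: (centsP klein_abel).
Qed.

Lemma klein_other a : a \in V -> exists2 b, b \in V & (b != 1) && (b != a).
Proof.
move=> Va; have: 2 < #|V| by rewrite klein_card.
case: (pickP [pred b in V | (b != 1) && (b != a)]) => [b /andP[Vb nb] _ | h]; first by exists b.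
have/subset_leq_card: V \subset [set 1; a].
  by apply/subsetP=> b Vb; have := h b; rewrite !inE Vb /= => /negbT; rewrite negb_and !negbK.
by rewrite cards2 klein_card; case: (1 != a).
Qed.

(** A centralizing element lies in C(a) = N(T a). If in [T a], it is inverted by b as well as fixed,
    so it is 1 or a; if not, multiplication by b brings it into [T a]. *)
Lemma klein_cent : 'C_G(V) = V.
Proof.
apply/eqP; rewrite eqEsubset subsetI klein_sub [V \subset 'C(V)]klein_abel !andbT.
have /trivgPn[a Va a1]: V :!=: 1 by rewrite -cardG_gt1 klein_card.
have [b Vb /andP[b1 ba]] := klein_other Va; have oa := klein_order Va a1.
have Ga := subsetP klein_sub _ Va; have Ga1 := invG Ga oa; have nep := inv_nep Ga1 oa.
have Db := klein_normD Va Vb a1 b1 ba.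
have inT y : y \in T a -> commute y b -> y \in V.
  move=> Ty cyb; have := T_invert Ga1 nep Db Ty.
  rewrite conjgE cyb mulKg => /esym/eqP; rewrite eq_invg_mul => yy.
  have [->|y1] := eqVneq y 1; first exact: group1.
  rewrite (_ : y = a) //; apply: (uniq_inv Ga1) => //; first exact: memT.
  by apply: nt_prime_order => //; apply/eqP.
apply/subsetP=> y /setIP[Gy Cy]; have cb := centP Cy b Vb.
have Ny: y \in 'N_G(T a) by rewrite -cent_inv // inE Gy; apply/cent1P/(centP Cy).
have [Ty | Ty] := boolP (y \in T a); first exact: inT.
rewrite -(groupMl _ Vb); apply: inT; first by apply: T_mulD; rewrite // !inE Ty in Ny *; case/andP: Ny => -> ->.
by rewrite /commute -mulgA cb.
Qed.

(** An element r of [T a] with square a is inverted by b, so b ^ r = r^-2 b = a b. *)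
Lemma klein_swap a b : 4 %| q -> a \in V -> b \in V -> a != 1 -> b != 1 -> b != a ->
  exists2 g, g \in 'N_G(V) & a ^ g = a /\ b ^ g = a * b.
Proof.
move=> q4 Va Vb a1 b1 ba; have oa := klein_order Va a1.
have Ga := subsetP klein_sub _ Va; have Ga1 := invG Ga oa; have nep := inv_nep Ga1 oa.
have Db := klein_normD Va Vb a1 b1 ba; have cT := inv_type Ga1 oa; rewrite -/q in cT.
have [t eT] := cyclicP (T_cyclic Ga1); have ot : #[t] = q by rewrite orderE -eT.
have [m em] := dvdnP q4; have m0: 0 < m by have := q_ge4; rewrite em; case: (m).
pose r := t ^+ m; have Tr: r \in T a by rewrite eT groupX ?cycle_id.
have or: #[r] = 4 by rewrite orderXdiv ot em ?dvdn_mulr // mulKn.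
have r2: r ^+ 2 = a.
  apply: (uniq_inv Ga1) => //; [exact: groupX | exact: memT |].
  by rewrite orderXdiv or.
have br: b ^ r = a * b.
  have := T_invert Ga1 nep Db Tr; rewrite conjgE => e.
  rewrite conjgE -[a]invgK; have -> : a^-1 = a by apply/eqP; rewrite eq_invg_mul klein_sq.
  rewrite -r2 expgS expg1 invMg -mulgA -e; congr (_ * _).
  by have: b^-1 = b; [apply/eqP; rewrite eq_invg_mul klein_sq| move=> {1}->; rewrite -!mulgA klein_sq // mulg1].
have ar: a ^ r = a by rewrite conjgE (centsP (T_abelian Ga1) _ (memT Ga1) _ Tr) mulKg.
exists r => //; rewrite inE (subsetP (TsubG Ga1)) //=.
rewrite (klein_set Va Vb) // 1?eq_sym // inE; apply/subsetP=> _ /imsetP[y yV ->]; move: yV.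
rewrite !inE -!orbA => /or4P[]/eqP->; rewrite ?conj1g ?conjMg ?ar ?br ?mulgA ?klein_sq ?mul1g ?eqxx ?orbT //.
Qed.

End Klein.

Lemma part_q : ~~ (4 %| q)%N -> (q.*2`_2)%N = 4.
Proof.
move=> q4; have := q_even; rewrite -dvdn2 => /dvdnP[m em].
have mo : odd m by apply: contraR q4 => om; rewrite em (@dvdn_mul 2 2) // dvdn2.
rewrite em -muln2 -mulnA mulnC partnM //; last by case: (m) mo.
by rewrite part_pnat_id // part_p'nat ?muln1 // p'natE // dvdn2 mo.
Qed.

Lemma klein_subC V b : V \in kleins -> b \in V -> V \subset 'C_G[b].
Proof.
move=> kV Vb; rewrite subsetI klein_sub // -cent_set1.
by rewrite (subset_trans (klein_abel kV)) // centS // sub1set.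
Qed.

(** If 4 divides q, the swap fixing a b takes a to b. Otherwise V is a Sylow 2-subgroup of C(b), and
    Sylow's theorem in C(b) turns an element conjugating a to b into one normalizing V. *)
Lemma klein_trans V a b : V \in kleins -> a \in V -> b \in V -> a != 1 -> b != 1 ->
  exists2 g, g \in 'N_G(V) & a ^ g = b.
Proof.
move=> kV Va Vb a1 b1; have [-> | ab] := eqVneq a b.
  by exists 1; rewrite ?group1 ?conjg1.
have sVG := klein_sub kV; have oa := klein_order kV Va a1; have ob := klein_order kV Vb b1.
have Ga := subsetP sVG _ Va; have Gb := subsetP sVG _ Vb.
have [q4 | q4] := boolP (4 %| q)%N.
  have [|||g Ng [_ eg]] := @klein_swap V kV (a * b) a q4 _ Va _ a1; rewrite ?groupM //.
  - by apply: contra ab => /eqP e; rewrite -[a]mulg1 -(klein_sq kV Vb) mulgA e mul1g.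
  - by rewrite -{1}[a]mulg1 (inj_eq (mulgI a)) eq_sym.
  exists g => //; rewrite eg (centsP (klein_abel kV) a Va b Vb) -mulgA (klein_sq kV Va).
  exact: mulg1.
have syl A : A \in kleins -> b \in A -> 2.-Sylow('C_G[b]) A.
  by move=> kA Ab; rewrite pHallE (klein_card kA) card_cent_inv // part_q // klein_subC.
have [g Gg eb] := inv_conj Ga Gb oa ob.
have [c Cc eV] : exists2 c, c \in 'C_G[b] & V :=: (V :^ g)%G :^ c.
  by apply: Sylow_trans; apply: syl => //; rewrite ?kleins_J //= -eb memJ_conjg.
have [Gc cb] := setIP Cc; exists (g * c).
  by rewrite inE groupM //=; apply/normP; rewrite conjsgM -eV.
by rewrite conjgM eb conjgE -(cent1P cb) mulKg.
Qed.

Lemma klein_orbit V a : V \in kleins -> a \in V -> a != 1 -> a ^: 'N_G(V) = V^#.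
Proof.
move=> kV Va a1; apply/setP=> b; apply/imsetP/setD1P => [[g /setIP[_ Ng] ->]|[b1 Vb]].
  by rewrite conjg_eq1 memJ_norm.
by have [g Ng <-] := klein_trans kV Va Vb a1 b1; exists g.
Qed.

(** The normalizer is transitive on the three involutions of V. The stabilizer of a permutes b and a
    b, and V is the part fixing both. They are exchanged if 4 divides q; otherwise an exchange would
    give C(a), of order 2q, a subgroup of order 8. *)
Lemma card_klein_norm V : V \in kleins -> #|'N_G(V)| = (if 4 %| q then 24 else 12)%N.
Proof.
move=> kV; have /trivgPn[a Va a1]: V :!=: 1 by rewrite -cardG_gt1 klein_card.
have [b Vb /andP[b1 ba]] := klein_other kV Va.
have sVG := klein_sub kV; have oa := klein_order kV Va a1.
have Ga := subsetP sVG _ Va.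
have := Lagrange (subsetIl 'N_G(V) 'C[a]); rewrite index_cent1 (klein_orbit kV Va a1).
have -> : #|V^#| = 3 by have := cardsD1 1 V; rewrite group1 klein_card // => -[].
move=> <-; set C := ('N_G(V) :&: 'C[a])%G.
have sVC: V \subset C.
  by rewrite /= setIAC subsetI klein_subC // normG.
have eC: 'C_C[b] = V.
  apply/eqP; rewrite eqEsubset; apply/andP; split; last first.
    by rewrite subsetI sVC (subset_trans (klein_subC kV Vb)) ?subsetIr.
  apply/subsetP=> y /setIP[/setIP[/setIP[Gy _] ya] yb].
  rewrite -(klein_cent kV) inE Gy; apply/centP=> c.
  have eab: a != b by rewrite eq_sym.
  have cya := cent1P ya; have cyb := cent1P yb.
  rewrite (klein_set kV Va Vb a1 b1 eab) !inE -!orbA => /or4P[]/eqP-> //.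
  - exact: commute1.
  by apply: commuteM.
have cC: #|C| = (4 * #|b ^: C|)%N.
  have := Lagrange (subsetIl C 'C[b]); rewrite index_cent1 => <-; congr (_ * _)%N.
  by rewrite -(klein_card kV); congr #|pred_of_set _|; exact: eC.
rewrite cC.
have abab : a * b \notin [set b] by rewrite inE -{2}[b]mul1g (inj_eq (mulIg b)).
have sb : b ^: C \subset [set a * b; b].
  apply/subsetP=> _ /imsetP[g /setIP[/setIP[Gg Ng] Cg] ->].
  have ag : a ^ g = a by rewrite conjgE -(cent1P Cg) mulKg.
  have: b ^ g \in V by rewrite memJ_norm.
  rewrite {1}(klein_set kV Va Vb a1 b1) 1?eq_sym // !inE conjg_eq1 (negPf b1) /=.
  by rewrite -{1}ag (inj_eq (conjg_inj g)) (negPf ba) /= orbC.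
case: ifP => q4.
  have [g Ng [ag bg]] := klein_swap kV q4 Va Vb a1 b1 ba.
  have -> : b ^: C = [set a * b; b].
    apply/eqP; rewrite eqEsubset sb subUset !sub1set class_refl andbT -bg.
    by rewrite imset_f // inE Ng; apply/cent1P; rewrite /commute [RHS]conjgC ag.
  by rewrite cardsU1 abab cards1.
suff -> : b ^: C = [set b] by rewrite cards1.
apply/eqP; rewrite eqEsubset sub1set class_refl andbT; apply/subsetP=> y yC.
have := subsetP sb y yC; rewrite !inE => /orP[/eqP ey|//].
have c8: #|C| = 8.
  rewrite cC; have -> : b ^: C = [set a * b; b].
    by apply/eqP; rewrite eqEsubset sb subUset !sub1set class_refl andbT -ey.
  by rewrite cardsU1 abab cards1.
have: #|C| %| #|'C_G[a]| by rewrite cardSg //= setSI // subsetIl.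
rewrite c8 card_cent_inv // -muln2 -[8]/(4 * 2)%N dvdn_pmul2r // => /idPn[].
by rewrite q4.
Qed.

Definition klein_of a b : {group gT} := (<[a]> <*> <[b]>)%G.

Lemma klein_ofP a b : a \in G -> #[a] = 2 -> b \in 'N_G(T a) :\: T a ->
  klein_of a b \in kleins /\ klein_of a b :=: [set 1; a; b; a * b].
Proof.
move=> Ga oa Db; have Ga1 := invG Ga oa; have nep := inv_nep Ga1 oa.
have ob := order_T_normD Ga1 nep Db.
have [Nb Tb] := setDP Db; have [Gb _] := setIP Nb.
have a2: a ^+ 2 = 1 by rewrite -oa expg_order.
have b2: b ^+ 2 = 1 by rewrite -ob expg_order.
have cab: commute a b.
  by have: b \in 'C_G[a]; [rewrite cent_inv | case/setIP=> _ /cent1P/commute_sym].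
have ba: b != a by apply: contraNneq Tb => ->; apply: memT.
have dW: <[a]> \x <[b]> = klein_of a b.
  rewrite dprodEY //; first by rewrite cent_cycle cycle_subG; apply/cent1P/commute_sym.
  apply/trivgP; rewrite /= !cycle2g //; apply/subsetP=> y; rewrite !inE.
  case/andP=> /orP[->//|/eqP->] /orP[->//|/eqP e].
  by rewrite -e eqxx in ba.
have kW: klein_of a b \in kleins.
  rewrite inE (dprod_abelem _ dW) !cycle_abelem ?orbT // oa ob dvdnn.
  by rewrite -(dprod_card dW) -!orderE oa ob join_subG !cycle_subG Ga Gb.
split=> //; apply: klein_set; rewrite // -?order_gt1 ?oa ?ob // 1?eq_sym //.
  by rewrite (subsetP (joing_subl _ _)) ?cycle_id.
by rewrite (subsetP (joing_subr _ _)) ?cycle_id.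
Qed.

Definition kleins_at a := [set V in kleins | a \in V].

(** The four-groups through a correspond to the pairs {b, a b} among the q elements of C(a) outside
    [T a]. *)
Lemma card_kleins_at a : a \in G -> #[a] = 2 -> (#|kleins_at a| * 2)%N = q.
Proof.
move=> Ga oa; have Ga1 := invG Ga oa; have nep := inv_nep Ga1 oa.
have a1 : a != 1 by rewrite -order_gt1 oa.
have := card_T_normD Ga1 nep; rewrite (inv_type Ga1 oa) -/q => <-.
rewrite -[RHS]sum1_card (partition_big_imset (klein_of a)) /= -sum_nat_const.
have in_of V b : V \in kleins -> a \in V -> b \in V -> b != 1 -> b != a -> klein_of a b = V.
  move=> kV Va Vb b1 ba; have Db := klein_normD kV Va Vb a1 b1 ba.
  have [_ e] := klein_ofP Ga oa Db; apply/val_inj; rewrite /= e.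
  by rewrite -(klein_set kV Va Vb) // eq_sym.
have sat b : b \in 'N_G(T a) :\: T a -> [/\ klein_of a b \in kleins_at a, b \in klein_of a b, b != 1 & b != a].
  move=> Db; have [kW e] := klein_ofP Ga oa Db; rewrite inE kW e !inE !eqxx ?orbT.
  have ob := order_T_normD Ga1 nep Db; split=> //; first by rewrite -order_gt1 ob.
  by case/setDP: Db => _; apply: contraNneq => ->; apply: memT.
have -> : [set klein_of a b | b in 'N_G(T a) :\: T a] = kleins_at a.
  apply/setP=> V; apply/imsetP/idP => [[b /sat[]// ? _ _ _ ->//]|/setIdP[kV Va]].
  have [b Vb /andP[b1 ba]] := klein_other kV Va; exists b; last by rewrite (in_of V).
  exact: (klein_normD kV Va Vb a1 b1 ba).
apply: eq_bigr => V /setIdP[kV Va]; rewrite sum1dep_card.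
have -> : [set b in 'N_G(T a) :\: T a | klein_of a b == V] = V :\: [set 1; a].
  apply/setP=> b; apply/setIdP/setDP => [[/sat[_ bV b1 ba] /eqP <-]|[Vb]].
    by rewrite bV !inE negb_or b1 ba.
  rewrite !inE negb_or => /andP[b1 ba]; rewrite (in_of V) // eqxx; split=> //.
  by have := klein_normD kV Va Vb a1 b1 ba; rewrite !inE.
rewrite cardsD (setIidPr _) ?subUset ?sub1set ?group1 // klein_card // cards2.
by rewrite eq_sym a1.
Qed.

(** Each four-group has three involutions, and q / 2 four-groups pass through each involution. *)
Lemma card_kleins : (12 * #|kleins|)%N = #|G|.
Proof.
have cI V : V \in kleins -> #|V :&: invols| = 3.
  move=> kV; have := cardsD1 1 V; rewrite group1 klein_card // => -[->].
  congr #|pred_of_set _|; apply/setP=> a; rewrite !inE andbC.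
  apply/idP/idP => [/andP[/andP[_ /eqP oa] Va]|/andP[a1 Va]].
    by rewrite Va -order_gt1 oa.
  by rewrite Va (subsetP (klein_sub kV)) // (klein_order kV Va).
have := @double_count kleins (@gval _) invols (q %/ 2).
have -> : \sum_(V in kleins) #|V :&: invols| = (#|kleins| * 3)%N.
  by rewrite -sum_nat_const; apply: eq_bigr.
move=> e; have {}e: (#|invols| * (q %/ 2))%N = (#|kleins| * 3)%N.
  by apply: e => a /setIdP[Ga /eqP oa]; rewrite -(card_kleins_at Ga oa) mulnK.
have q2: (q = q %/ 2 * 2)%N by rewrite divnK // dvdn2 q_even.
by move: e q2; rewrite -card_invols; move: (q %/ 2)%N => m e ->; lia.
Qed.

(** * Soluble subgroups and inclusions between normalizers *)

Lemma sub_torus_norm H x : x \in G^# -> H \subset G -> x \in H -> H \subset 'N(<[x]>) ->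
  H \subset 'N_G(T x).
Proof.
move=> Gx sHG Hx nH; apply/subsetP=> h Hh; apply: (T_normP Gx (subsetP sHG h Hh) (T_mem1 Gx)).
have: x ^ h \in <[x]> by rewrite memJ_norm ?cycle_id // (subsetP nH).
by apply: subsetP; rewrite cycle_subG memT.
Qed.

(** A minimal normal subgroup M is elementary abelian. If it is not in a torus, it has commuting x
    and y with y outside [T x], so x is an involution and M contains a four-group; four-groups are
    self-centralizing, so M is one. *)
Lemma sol_sub_cases H : H \subset G -> solvable H -> H :!=: 1 ->
  (exists2 x, x \in G^# & H \subset 'N_G(T x)) \/
  (exists2 V, V \in kleins & V \subset H /\ H \subset 'N_G(V)).
Proof.
move=> sHG solH H1; have [M minM sMH] := minnormal_exists H1 (normG H).
have [nMH M1 /is_abelemP[r pr aM]] := minnormal_solvable minM sMH solH.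
have sMG := subset_trans sMH sHG; have [x Mx x1] := trivgPn _ M1.
have Gx: x \in G^# by rewrite !inE x1 (subsetP sMG).
have ox : #[x] = r by apply: (abelem_order_p aM).
have [sMT | /subsetPn[y My Ty]] := boolP (M \subset T x).
  left; exists x => //; apply/subsetP=> h Hh.
  apply: (T_normP Gx (subsetP sHG h Hh) (T_mem1 Gx)).
  by rewrite (subsetP sMT) // memJ_norm // (subsetP nMH).
right; have cxy : commute x y := centsP (abelem_abelian aM) x Mx y My.
have Gy := subsetP sMG y My; have Cy: y \in 'C_G[x] by rewrite inE Gy; apply/cent1P/commute_sym.
have r2 : #[x] = 2.
  apply/eqP; apply: contraR Ty => nx; have [cT|/eqP nep] := eqVneq #|T x| p.
    by rewrite -(cent_p Gx cT).
  by rewrite -(cent_semisimple Gx nep nx).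
have Dy : y \in 'N_G(T x) :\: T x by rewrite inE Ty -cent_inv.
have [kV _] := klein_ofP (TG Gx) r2 Dy.
have eM : M = klein_of x y.
  apply/val_inj/eqP; rewrite /= eqEsubset join_subG !cycle_subG Mx My andbT.
  have sMC : M \subset 'C_G(klein_of x y).
    rewrite subsetI sMG; apply: subset_trans (abelem_abelian aM) _.
    by rewrite centS // join_subG !cycle_subG Mx My.
  by rewrite andbT (subset_trans sMC) // klein_cent.
exists (klein_of x y) => //; rewrite -eM; split=> //.
by rewrite subsetI sHG.
Qed.

Lemma norm_T_mem x y : x \in G^# -> y \in G^# -> #|T y| <> p -> #[x] != 2 ->
  x \in 'N_G(T y) -> x \in T y.
Proof.
move=> Gx Gy nep ox Nx; apply: contraR ox => Tx.
by rewrite (order_T_normD Gy nep) // inE Tx.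
Qed.

Lemma norm_T_p x u : x \in G^# -> u \in G^# -> #|T u| = p -> #|T x| = p ->
  x \in 'N_G(T u) -> x \in T u.
Proof.
move=> Gx Gu cT cTx Nx; have nT: T u <| 'N_G(T u) by rewrite /normal T_subN // subsetIr.
have sN: p.-Sylow('N_G(T u)) (T u) by rewrite (pHall_subl _ _ (T_Sylow Gu cT)) ?subsetIl // T_subN.
rewrite (mem_normal_Hall sN nT Nx) /p_elt.
by have /eqP -> : #[x] == p; [rewrite T_card_pE // cTx | rewrite pnat_id].
Qed.

(** Such a subgroup embeds in the abelian quotient of the Borel subgroup by [T u]. *)
Lemma Borel_p'_abelian H u : u \in G^# -> #|T u| = p -> H \subset 'N_G(T u) ->
  ~~ (p %| #|H|) -> abelian H.
Proof.
move=> Gu cT sHB pH; have nT: 'N_G(T u) \subset 'N(T u) by apply: subsetIr.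
have [h Gh [_ /sdprodP[_ defB _ _]]] := Borel_sdprod Gu cT.
have tiH: H :&: T u = 1.
  by apply: coprime_TIg; rewrite coprime_sym cT prime_coprime.
have iso: H \isog H / T u by apply: quotient_isog; rewrite ?(subset_trans sHB nT) // setIC.
rewrite (isog_abelian iso); apply: abelianS (quotientS _ sHB) _.
by rewrite -defB quotientMidl quotient_abelian // T_abelian.
Qed.

Lemma card_T_ge3 x : x \in G^# -> 2 < #|T x|.
Proof. by move=> Gx; case: (ts_card tsG Gx) => ->; rewrite ?ltnS; lia. Qed.

Lemma T_gen x : x \in G^# -> exists2 t, T x :=: <[t]> & [/\ t \in G^#, #[t] = #|T x| & T t = T x].
Proof.
move=> Gx; have [t eT] := cyclicP (T_cyclic Gx); have ot : #[t] = #|T x| by rewrite eT.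
have Tt: t \in (T x)^#.
  by rewrite !inE -order_gt1 ot (ltnW (card_T_ge3 Gx)) eT cycle_id.
exists t => //; split=> //; first exact: (T_nontriv Gx).
exact: eqT.
Qed.

(** A generator of the torus has order above 2, so only the torus centralizes it, and the normalizer
    is larger. *)
Lemma T_norm_nonabelian x : x \in G^# -> ~~ abelian 'N_G(T x).
Proof.
move=> Gx; have [t eT [Gt ot _]] := T_gen Gx; apply/negP => ab.
have Tt: t \in T x by rewrite eT cycle_id.
have sub : 'N_G(T x) \subset T x.
  have nt: 2 < #[t] by rewrite ot card_T_ge3.
  have sN : 'N_G(T x) \subset 'C_G[t].
    rewrite subsetI subsetIl -cent_set1 (subset_trans ab) // centS // sub1set.
    exact: T_inN.
  have eTt : T t = T x by apply: eqT; rewrite // !inE Tt -order_gt1 ltnW.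
  apply: (subset_trans sN); have [cT|/eqP nep] := eqVneq #|T t| p.
    by rewrite cent_p // eTt.
  by rewrite (cent_semisimple Gt nep) ?eTt // neq_ltn nt orbT.
have := subset_leq_card sub; have [cT|/eqP nep] := eqVneq #|T x| p.
  rewrite (card_Borel Gx cT) cT; have := p_gt6; nia.
by rewrite (card_T_norm Gx nep); have := card_T_ge3 Gx; lia.
Qed.

(** A generator of [T x] normalizes [T y], hence lies in it, except when only [T y] has order p; but
    then the normalizer of [T x] would be an abelian subgroup of a Borel subgroup. *)
Lemma T_norm_sub x y : x \in G^# -> y \in G^# -> 'N_G(T x) \subset 'N_G(T y) -> T x = T y.
Proof.
move=> Gx Gy sN; have [t eT [Gt ot eTt]] := T_gen Gx.
have Nt: t \in 'N_G(T y) by rewrite (subsetP sN) // T_inN // eT cycle_id.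
have nt: #[t] != 2 by rewrite neq_ltn ot card_T_ge3 ?orbT.
suff Tyt: t \in T y.
  by rewrite -eTt; apply: eqT => //; case/setD1P: Gt => t1 _; rewrite !inE t1.
have [cTy|/eqP nep] := eqVneq #|T y| p; last exact: norm_T_mem nt Nt.
have [cTx|/eqP nepx] := eqVneq #|T x| p; first by apply: norm_T_p; rewrite ?eTt.
case/negP: (T_norm_nonabelian Gx); apply: (Borel_p'_abelian Gy cTy sN).
rewrite card_T_norm // -mul2n Euclid_dvdM // negb_or p_ndvd_type // andbT.
by rewrite gtnNdvd //; have := p_gt6; lia.
Qed.

Lemma p'_klein_norm V : V \in kleins -> ~~ (p %| #|'N_G(V)|).
Proof.
move=> kV; rewrite card_klein_norm //; case: ifP => _.
  by rewrite -[24]/(2 * (2 * (2 * 3)))%N !Euclid_dvdM // !gtnNdvd //; have := p_gt6; lia.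
by rewrite -[12]/(2 * (2 * 3))%N !Euclid_dvdM // !gtnNdvd //; have := p_gt6; lia.
Qed.

(** In a Borel subgroup ['N_G(V)] would be abelian, so contained in C(V) = V. In a dihedral
    normalizer some involution c of V would lie in the torus and be centralized by ['N_G(V)], which
    is transitive on the involutions of V. *)
Lemma klein_norm_sub_T V x : V \in kleins -> x \in G^# -> ~~ ('N_G(V) \subset 'N_G(T x)).
Proof.
move=> kV Gx; apply/negP=> sN; have sVN: V \subset 'N_G(V) by rewrite subsetI klein_sub // normG.
have big : 4 < #|'N_G(V)| by rewrite card_klein_norm //; case: ifP.
have [cTx|/eqP nepx] := eqVneq #|T x| p.
  have ab := Borel_p'_abelian Gx cTx sN (p'_klein_norm kV).
  have : 'N_G(V) \subset V.
    apply: (@subset_trans _ _ (mem 'C_G(V))); last by rewrite klein_cent.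
    by rewrite subsetI subsetIl (subset_trans ab) ?centS.
  by move/subset_leq_card; rewrite klein_card // leqNgt big.
have /trivgPn[a Va a1]: V :!=: 1 by rewrite -cardG_gt1 klein_card.
have [b Vb /andP[b1 ba]] := klein_other kV Va.
have [c Vc [c1 Tc]] : exists2 c, c \in V & c != 1 /\ c \in T x.
  have [Ta|Ta] := boolP (a \in T x); first by exists a.
  have [Tb|Tb] := boolP (b \in T x); first by exists b.
  exists (a * b); first exact: groupM.
  split; first by rewrite -eq_invg_mul; apply: contra ba => /eqP <-; rewrite eq_invg_mul (klein_sq kV Va).
  have D z : z \in V -> z \notin T x -> z \in 'N_G(T x) :\: T x.
    by move=> Vz Tz; rewrite inE Tz (subsetP sN) // (subsetP sVN).
  by apply: T_mulD; rewrite // D.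
have oc := klein_order kV Vc c1; have Gc := subsetP (klein_sub kV) c Vc.
have eTc : T c = T x by apply: eqT; rewrite // !inE c1.
have: 'N_G(V) \subset 'C_G[c] by rewrite cent_inv ?invG // eTc.
move=> sC; have [d Vd /andP[d1 dc]] := klein_other kV Vc.
have [g /(subsetP sC)/setIP[_ /cent1P cg] eg] := klein_trans kV Vc Vd c1 d1.
by case/negP: dc; rewrite -eg conjgE -cg mulKg.
Qed.

(** By solubility [H] contains a four-group U that it normalizes. Let it normalize A as well. If A
    and U meet in 1, they generate a group of order 16, not a divisor of 12 or 24; if in one
    involution, [H] centralizes it and normalizes its torus. *)
Lemma klein_uniq H (V W : {group gT}) : H \subset 'N_G(V) -> H \subset 'N_G(W) ->
  V \in kleins -> W \in kleins ->
  (forall x, x \in G^# -> ~~ (H \subset 'N_G(T x))) -> V = W.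
Proof.
move=> sHV sHW kV kW nHT; have [sHG _] := subsetIP sHV.
have H1 : H :!=: 1.
  have [x Gx _] := exists_T_p; apply: contraNneq (nHT x Gx) => ->.
  by rewrite sub1G.
(* [H] lies in ['N_G(V)], soluble by its order, so it is not [G]. *)
have solH : solvable H.
  apply: proper_sol; rewrite properEneq sHG andbT.
  apply: contra not_solG => /eqP eHG; have sol12 : size (primes #|'N_G(V)|) <= 2.
    by rewrite card_klein_norm //; case: ifP.
  by have := Burnside_p_a_q_b sol12; apply: solvableS; rewrite -eHG.
have [[x Gx sHT]|[U kU [sUH sHU]]] := sol_sub_cases sHG solH H1.
  by case/negP: (nHT x Gx).
suff eU A : A \in kleins -> H \subset 'N_G(A) -> A = U by rewrite (eU V kV sHV) (eU W kW sHW).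
move=> kA sHA; apply/val_inj/eqP; rewrite /= eqEcard !klein_card // andbT.
have [/trivgPn[a /setIP[Aa Ua] a1] | ] := boolP (A :&: U != 1); last first.
  move/negbNE/eqP => tiAU; have := cardSg (_ : (A <*> U)%G \subset 'N_G(A)).
  have nUA: U \subset 'N(A) by apply: subset_trans sUH (subset_trans sHA (subsetIr _ _)).
  rewrite /= norm_joinEr // TI_cardMg // (klein_card kA) (klein_card kU) card_klein_norm //.
  rewrite mul_subG ?subsetI ?klein_sub ?normG //.
  by move=> /(_ isT); case: ifP.
have [/subsetPn[b Ab Ub] | /negbNE //] := boolP (~~ (A \subset U)).
have eAU : A :&: U = [set 1; a].
  apply/eqP; rewrite eq_sym eqEcard subUset !sub1set group1 inE Aa Ua /=.
  rewrite cards2 eq_sym a1; have : #|A :&: U| %| #|A| by rewrite cardSg ?subsetIl.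
  have : #|A :&: U| < #|A|.
    by rewrite proper_card // properE subsetIl subsetI subxx; apply/subsetPn; exists b.
  by rewrite klein_card //; case: #|_| => [|[|[|[|?]]]].
have Ga := subsetP (klein_sub kA) a Aa; have oa := klein_order kA Aa a1.
case/negP: (nHT a (invG Ga oa)); rewrite -cent_inv ?invG //.
apply/subsetP=> h Hh; have Gh := subsetP sHG h Hh; rewrite inE Gh /=.
have ah: a ^ h \in A :&: U.
  by rewrite inE !memJ_norm ?Aa ?Ua //; [case/subsetIP: sHU => _ /subsetP->|case/subsetIP: sHA => _ /subsetP->].
have /eqP e: a ^ h == a by move: ah; rewrite eAU !inE conjg_eq1 (negPf a1).
apply/cent1P.
by rewrite /commute [RHS]conjgC e.
Qed.

Lemma klein_norm_inj (V W : {group gT}) : V \in kleins -> W \in kleins -> 'N_G(V) \subset 'N_G(W) -> V = W.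
Proof.
move=> kV kW sN; apply: (@klein_uniq 'N_G(V)) => // x Gx; exact: klein_norm_sub_T.
Qed.

Lemma TI_norm_commute A B x y : A \subset 'N(B) -> B \subset 'N(A) -> A :&: B = 1 ->
  x \in A -> y \in B -> commute x y.
Proof.
move=> nBA nAB tiAB Ax By; apply/commgP; rewrite -in_set1.
have: [~ x, y] \in A :&: B.
  rewrite inE {1}commgEl groupM ?groupV //= ?memJ_norm ?(subsetP nAB) //.
  by rewrite commgEr groupM // memJ_norm ?groupV // (subsetP nBA).
by rewrite tiAB.
Qed.

Lemma klein_cent_ndvd3 V v : V \in kleins -> v \in V -> v != 1 -> ~~ (3 %| #|'C_('N_G(V))[v]|).
Proof.
move=> kV Vv v1; have := Lagrange (subsetIl 'N_G(V) 'C[v]).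
rewrite index_cent1 (klein_orbit kV Vv v1) card_klein_norm //.
have -> : #|V^#| = 3 by have := cardsD1 1 V; rewrite group1 klein_card // => -[].
case: ifP => _ /=; move: #|_| => n e; last by have -> : n = 4 by lia.
by have -> : n = 8 by lia.
Qed.

(** A single Sylow 3-subgroup would be normal and so commute with V, against [klein_cent_ndvd3]. *)
Lemma klein_norm_Syl3 V : V \in kleins -> #|'Syl_3('N_G(V))| = 4.
Proof.
move=> kV; have := card_Syl_dvd 3 'N_G(V); have := @card_Syl_mod 3 _ 'N_G(V)%G isT.
set n := #|_|; rewrite card_klein_norm // => m3 dn.
have n_le : n <= 24 by apply: dvdn_leq => //; apply: dvdn_trans dn _; case: ifP.
have: n \in [:: 1; 4]%N.
  have {}dn : n %| 24 by apply: dvdn_trans dn _; case: ifP.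
  move: dn m3; rewrite dvdn_divisors // -[divisors 24]/[:: 1; 2; 3; 4; 6; 8; 12; 24]%N.
  by rewrite !inE; lia.
rewrite !inE => /orP[/eqP n1|/eqP//].
have [Q sQ] := Sylow_exists 3 'N_G(V).
have cQ : #|Q| = 3 by rewrite (card_Hall sQ) card_klein_norm // p_part; case: ifP.
move: n1; rewrite /n (card_Syl sQ) => /eqP; rewrite indexg_eq1 => /subsetIP[_ nQN].
have /trivgPn[v Vv v1]: V :!=: 1 by rewrite -cardG_gt1 klein_card.
have sQN := pHall_sub sQ; have [_ nVN] := subsetIP sQN.
have sVN : V \subset 'N_G(V) by rewrite subsetI klein_sub // normG.
have tiVQ : V :&: Q = 1 by apply: coprime_TIg; rewrite klein_card // cQ.
case/negP: (klein_cent_ndvd3 kV Vv v1); rewrite -cQ cardSg //= subsetI sQN.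
apply/subsetP=> y Qy; apply/cent1P/commute_sym.
exact: (TI_norm_commute (subset_trans sVN nQN) nVN tiVQ).
Qed.

(** The action on the four Sylow 3-subgroups is faithful. Its kernel meets V in 1, because an
    element of V normalizing a Sylow 3-subgroup centralizes it; so the kernel centralizes V, lies in
    V and is trivial. *)
Lemma klein_norm_embed V : V \in kleins -> exists H : {group 'S_4}, 'N_G(V) \isog H.
Proof.
move=> kV; pose N := 'N_G(V)%G; pose S := 'Syl_3(N).
have actS : [acts N, on S | 'JG] := atrans_acts (Syl_trans 3 N).
rewrite -(klein_norm_Syl3 kV); apply: (faithful_isog_Sym (to := 'JG)) => //.
  by rewrite klein_norm_Syl3.
have sVN : V \subset N by rewrite subsetI klein_sub // normG.
have nVN : N \subset 'N(V) by apply: subsetIr.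
apply/faithfulP=> g Ng fg; pose K := 'C_N(S | 'JG)%G.
have Kg : g \in K by rewrite inE Ng; apply/astabP.
have nKN : N \subset 'N(K).
  by rewrite normsI ?normG // (subset_trans actS) // astab_norm.
have tiVK : V :&: K = 1.
  apply/trivgP/subsetP=> v /setIP[Vv /setIP[_ Kv]]; rewrite inE; apply: contraT => v1.
  have [Q sQ] := Sylow_exists 3 N; have sQN := pHall_sub sQ.
  have cQ : #|Q| = 3 by rewrite (card_Hall sQ) card_klein_norm // p_part; case: ifP.
  have nQv : v \in 'N(Q).
    have : 'JG%act Q v = Q by apply: (astabP Kv); rewrite inE.
    by move/(congr1 val) => /= e; apply/normP.
  have tiVQ : V :&: Q = 1 by apply: coprime_TIg; rewrite klein_card // cQ.
  case/negP: (klein_cent_ndvd3 kV Vv v1); rewrite -cQ cardSg //= subsetI sQN.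
  apply/subsetP=> y Qy; apply/cent1P/commgP; rewrite -in_set1.
  have : [~ y, v] \in V :&: Q.
    rewrite inE commgEr groupM ?memJ_norm ?groupV ?(subsetP nVN) ?(subsetP sQN) //=.
    by rewrite -commgEr commgEl groupM ?groupV // memJ_norm.
  by rewrite tiVQ.
have Vg : g \in V.
  have [Gg _] := setIP Ng; rewrite -(klein_cent kV) inE Gg; apply/centP=> v Vv.
  apply: (commute_sym (TI_norm_commute (subset_trans sVN nKN) _ tiVK Vv Kg)).
  by apply: subset_trans nVN; apply: subsetIl.
have : g \in V :&: K by rewrite in_setI Vg.
by rewrite tiVK => /set1P.
Qed.

Lemma S4_image_orders (rT : finGroupType) (H : {group rT}) (L : {group 'S_4}) (y : rT) :
  H \isog L -> y \in H -> [|| y == 1, y * y == 1, y * y * y == 1 | y * y * (y * y) == 1].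
Proof.
case/isogP=> f injf _ Hy; have := S4_orders (f y).
by rewrite -!morphM ?groupM // !(morph_injm_eq1 injf) ?groupM.
Qed.

Lemma klein_norm_orders V y : V \in kleins -> y \in 'N_G(V) ->
  [|| y == 1, y * y == 1, y * y * y == 1 | y * y * (y * y) == 1].
Proof. by move=> kV; have [H iso] := klein_norm_embed kV; apply: S4_image_orders iso. Qed.

Lemma order2E (rT : finGroupType) (y : rT) : (#[y] == 2) = (y * y == 1) && (y != 1).
Proof.
rewrite -[y * y]/(y ^+ 2) -order_dvdn -order_eq1; case: #[y] (order_gt0 y) => [|[|[|n]]] //= _.
Qed.

Lemma order3E (rT : finGroupType) (y : rT) : (#[y] == 3) = (y * y * y == 1) && (y != 1).
Proof.
rewrite -[y * y * y]mulgA -[y * (y * y)]/(y ^+ 3) -order_dvdn -order_eq1.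
case: #[y] (order_gt0 y) => [|[|[|[|n]]]] //= _.
Qed.

Lemma order4E (rT : finGroupType) (y : rT) : (#[y] == 4) = (y * y * (y * y) == 1) && (y * y != 1).
Proof.
rewrite -[y * y * _]mulgA -[y * (y * (y * y))]/(y ^+ 4) -[y * y]/(y ^+ 2) -!order_dvdn.
case: #[y] (order_gt0 y) => [|[|[|[|[|n]]]]] //= _.
Qed.

Lemma klein_norm_order_in V y : V \in kleins -> y \in 'N_G(V) -> y != 1 ->
  #[y] \in [:: 2; 3; 4].
Proof.
move=> kV Ny y1; have := klein_norm_orders kV Ny.
rewrite !inE order2E order3E order4E y1 !andbT (negPf y1) /=.
by case: (y * y == 1) => //=; rewrite andbT.
Qed.

(** * Normalizers of four-groups of order 12 *)

Section KleinNorm12.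

Hypothesis q4 : ~~ (4 %| q)%N.
Variable V : {group gT}.
Hypothesis kV : V \in kleins.

Let sVN : V \subset 'N_G(V). Proof. by rewrite subsetI klein_sub // normG. Qed.
Let cN : #|'N_G(V)| = 12. Proof. by rewrite card_klein_norm // (negPf q4). Qed.

(** V is a normal Sylow 2-subgroup and contains every 2-element. *)
Lemma klein12_norm3 y : y \in 'N_G(V) -> y \notin V -> y * y * y = 1.
Proof.
move=> Ny Vy; have hallV : 2.-Sylow('N_G(V)) V.
  by rewrite pHallE sVN klein_card // cN p_part.
have nV := normalSG (klein_sub kV); have memV := mem_normal_Hall hallV nV Ny.
have := klein_norm_orders kV Ny; case/or4P=> [/eqP->|y2|/eqP//|y4].
- by rewrite !mulg1.
- by rewrite memV /p_elt (@pnat_dvd _ 2) // order_dvdn in Vy.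
by rewrite memV /p_elt (@pnat_dvd _ 4) // order_dvdn -[y ^+ 4]/(y * (y * (y * y))) mulgA y4 in Vy.
Qed.

Lemma klein12_order2 y : y \in 'N_G(V) -> (#[y] == 2) = (y \in V^#).
Proof.
move=> Ny; rewrite !inE; apply/idP/andP => [o2|[y1 Vy]]; last by rewrite (klein_order kV).
split; first by rewrite -order_gt1 (eqP o2).
apply: contraLR o2 => Vy; rewrite order2E; apply/negP => /andP[/eqP y2].
by have := klein12_norm3 Ny Vy; rewrite y2 mul1g => ->; rewrite eqxx.
Qed.

Lemma klein12_order3 y : y \in 'N_G(V) -> (#[y] == 3) = (y \notin V).
Proof.
move=> Ny; apply/idP/idP => [o3|Vy].
  apply: contraL o3 => Vy; have [->|y1] := eqVneq y 1; first by rewrite order1.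
  by rewrite (klein_order kV).
rewrite order3E klein12_norm3 // eqxx /=.
by apply: contraNneq Vy => ->.
Qed.

Lemma card_klein12_order j : #|'N_G(V) :&: [set y in G | #[y] == j]| =
  (if j == 1 then 1 else if j == 2 then 3 else if j == 3 then 8 else 0)%N.
Proof.
have -> : 'N_G(V) :&: [set y in G | #[y] == j] = [set y in 'N_G(V) | #[y] == j].
  by apply/setP=> y; rewrite !inE; case: (y \in G); rewrite ?andbF.
have cV1 : #|V^#| = 3 by have := cardsD1 1 V; rewrite group1 klein_card // => -[].
case: eqP => [->|j1].
  rewrite -[RHS](cards1 (1 : gT)); congr #|pred_of_set _|; apply/setP=> y.
  by rewrite inE order_eq1 in_set1; case: eqP => [->|_]; rewrite ?group1 // andbF.
case: eqP => [->|j2].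
  rewrite -cV1; congr #|pred_of_set _|; apply/setP=> y; apply/setIdP/idP.
    by case=> Ny; rewrite klein12_order2.
  move=> Vy; have Ny : y \in 'N_G(V) by case/setD1P: Vy => _ /(subsetP sVN).
  by rewrite klein12_order2.
case: eqP => [->|j3].
  have <- : #|'N_G(V) :\: V| = 8 by rewrite cardsD (setIidPr sVN) cN klein_card.
  congr #|pred_of_set _|; apply/setP=> y; apply/setIdP/setDP => -[Ny].
    by rewrite klein12_order3.
  by rewrite -klein12_order3.
apply/eqP; rewrite cards_eq0; apply/eqP/setP=> y; rewrite in_set0; apply/setIdP => -[Ny /eqP oy].
have [Vy|Vy] := boolP (y \in V).
  have [y1|y1] := eqVneq y 1; first by case: j1; rewrite -oy y1 order1.
  by case: j2; rewrite -oy (klein_order kV).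
by case: j3; rewrite -oy; apply/eqP; rewrite klein12_order3.
Qed.

Lemma klein12_cent v y : v \in V -> v != 1 -> y \in 'N_G(V) -> commute y v -> y \in V.
Proof.
move=> Vv v1 Ny cyv; apply: contraT; rewrite -klein12_order3 // => /eqP o3.
case/negP: (klein_cent_ndvd3 kV Vv v1); rewrite -o3 order_dvdG // inE Ny.
exact/cent1P.
Qed.

(** The set is the group generated by x: writing y = v c with v in V and c a power of x, the
    condition passes from y to v. *)
Lemma klein12_conj3 x : x \in 'N_G(V) -> #[x] = 3 ->
  #|[set y in 'N_G(V) | (x * y == y * x) || (x * y * x == y)]| = 3.
Proof.
move=> Nx ox; have Vx : x \notin V by rewrite -klein12_order3 // ox.
have nVx : x \in 'N(V) by case/setIP: Nx.
have x4 : x ^+ 2 * x ^+ 2 = x by rewrite -expgD -[(2 + 2)%N]/(3 + 1)%N expgD -ox expg_order mul1g.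
have defN : V * <[x]> = 'N_G(V).
  apply/eqP; rewrite eqEcard mul_subG ?cycle_subG //= TI_cardMg.
    by rewrite -orderE ox klein_card // cN.
  by apply: coprime_TIg; rewrite -orderE ox klein_card.
have -> : [set y in 'N_G(V) | (x * y == y * x) || (x * y * x == y)] = <[x]>.
  apply/setP=> y; apply/setIdP/idP => [[]|xy]; last first.
    split; first by move: xy; apply: subsetP; rewrite cycle_subG.
    by have /cycleP[j ->] := xy; rewrite -expgS -expgSr eqxx.
  rewrite -defN => /mulsgP[v c Vv xc ->].
  have cxc : c * x = x * c by have /cycleP[j ->] := xc; rewrite -expgSr expgS.
  rewrite mulgA -[v * c * x]mulgA cxc mulgA (inj_eq (mulIg c)).
  rewrite -[x * v * c * x]mulgA cxc mulgA (inj_eq (mulIg c)) => /orP[] /eqP e.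
    suff -> : v = 1 by rewrite mul1g.
    by apply: contraNeq Vx => v1; apply: (klein12_cent Vv v1 Nx).
  (* From x v x = v, the square of x is a product of elements of V, and then so is x = x^4. *)
  case/negP: Vx; rewrite -x4; suff Vx2 : x ^+ 2 \in V by apply: groupM.
  have -> : x ^+ 2 = (v ^ x^-1)^-1 * v.
    by rewrite -{2}e conjgE invgK !invMg !invgK expgS expg1 !mulgA; rewrite mulgKV mulgKV.
  by rewrite groupM ?groupV // memJ_norm // groupV.
by rewrite -orderE.
Qed.

(** The set is V, which holds all elements of square 1 and is the centralizer of each of its
    involutions; x y x = y^-1 means that x y squares to 1. *)
Lemma klein12_inv2 x : x \in 'N_G(V) -> #[x] = 2 ->
  #|[set y in 'N_G(V) | [|| x * y == y * x, y * y == 1 | x * y * x == y^-1]]| = 4.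
Proof.
move=> Nx ox; have /setD1P[x1 Vx] : x \in V^# by rewrite -klein12_order2 // ox.
rewrite -(klein_card kV); congr #|pred_of_set _|; apply/setP=> y; apply/setIdP/idP.
  have sq z : z \in 'N_G(V) -> z * z == 1 -> z \in V.
    move=> Nz z2; have [->|z1] := eqVneq z 1; first exact: group1.
    by have /setD1P[] : z \in V^# by rewrite -klein12_order2 // order2E z2.
  case=> Ny /or3P[/eqP cxy|y2|/eqP e]; first exact: (klein12_cent Vx).
    exact: sq.
  rewrite -(groupMl _ Vx); apply: sq; first by rewrite groupM.
  by rewrite mulgA e mulVg.
move=> Vy; split; first exact: subsetP sVN y Vy.
by rewrite (centsP (klein_abel kV) x Vx y Vy) eqxx.
Qed.

End KleinNorm12.

(** * Normalizers of four-groups of order 24 *)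

Section KleinNorm24.

Hypothesis q4 : (4 %| q)%N.
Variable V : {group gT}.
Hypothesis kV : V \in kleins.

Lemma klein24_isog : 'N_G(V) \isog 'Sym_('I_4).
Proof.
have [H iso] := klein_norm_embed kV.
suff <- : H :=: 'Sym_('I_4) by [].
apply/eqP; rewrite eqEcard subsetT -(card_isog iso) card_klein_norm // q4.
by rewrite card_Sym card_ord.
Qed.

Lemma card_inj_pred (f : {morphism 'N_G(V) >-> 'S_4}) (injf : 'injm f) (Q : pred gT) (Q' : pred 'S_4) :
  {in 'N_G(V), forall y, Q y = Q' (f y)} ->
  #|[set y in 'N_G(V) | Q y]| = #|[set s | Q' s]|.
Proof.
move=> e; rewrite -(card_injm injf); last by apply/subsetP=> y /setIdP[].
have imf : f @* 'N_G(V) = setT.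
  apply/eqP; rewrite eqEcard subsetT card_injm // card_klein_norm // q4.
  by rewrite -/('Sym_('I_4)) card_Sym card_ord.
congr #|pred_of_set _|; apply/setP=> s; rewrite inE; apply/imsetP/idP.
  by case=> y /setIP[_ /setIdP[Ny Qy]] ->; rewrite -e.
have : s \in f @* 'N_G(V) by rewrite imf inE.
case/imsetP=> y /setIP[Ny _] -> Qy; exists y => //.
by rewrite inE Ny inE Ny e.
Qed.

Lemma card_klein24_order j : #|'N_G(V) :&: [set y in G | #[y] == j]| =
  (if j == 1 then 1 else if j == 2 then 9 else if j == 3 then 8
   else if j == 4 then 6 else 0)%N.
Proof.
have -> : 'N_G(V) :&: [set y in G | #[y] == j] = [set y in 'N_G(V) | #[y] == j].
  by apply/setP=> y; rewrite !inE; case: (y \in G); rewrite ?andbF.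
have [f injf _] := isogP klein24_isog.
have E : {in 'N_G(V), forall y i, (#[y] == i) = (#[f y] == i)}.
  by move=> y Ny i; rewrite order_injm.
case: eqP => [->|j1].
  rewrite -[RHS](cards1 (1 : gT)); congr #|pred_of_set _|; apply/setP=> y.
  by rewrite inE order_eq1 in_set1; case: eqP => [->|_]; rewrite ?group1 // andbF.
case: eqP => [->|j2].
  by rewrite -S4_card2; apply: (card_inj_pred injf) => y Ny; rewrite E // order2E.
case: eqP => [->|j3].
  by rewrite -S4_card3; apply: (card_inj_pred injf) => y Ny; rewrite E // order3E.
case: eqP => [->|j4].
  by rewrite -S4_card4; apply: (card_inj_pred injf) => y Ny; rewrite E // order4E.
apply/eqP; rewrite cards_eq0; apply/eqP/setP=> y; rewrite in_set0; apply/setIdP => -[Ny /eqP oy].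
have [y1|y1] := eqVneq y 1; first by case: j1; rewrite -oy y1 order1.
have := klein_norm_order_in kV Ny y1; rewrite !inE oy.
by case/or3P=> /eqP; [apply: j2 | apply: j3 | apply: j4].
Qed.

Lemma klein24_conj x : x \in 'N_G(V) -> 2 < #[x] ->
  #|[set y in 'N_G(V) | (x * y == y * x) || (x * y * x == y)]| = (if #[x] == 3 then 6 else 8)%N.
Proof.
move=> Nx ox; have [f injf _] := isogP klein24_isog.
rewrite (@card_inj_pred f injf _ (fun s => (f x * s == s * f x) || (f x * s * f x == s))); last first.
  by move=> y Ny; rewrite -!morphM ?groupM // !(inj_in_eq (injmP injf)) ?groupM.
have x1 : x != 1 by rewrite -order_gt1 ltnW.
have := klein_norm_order_in kV Nx x1; rewrite -(order_injm injf Nx) in ox *.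
rewrite !inE; case: (#[f x] =P 2) ox => [-> //|_ _ /=]; case/orP=> o; rewrite ?o.
  by move: o; rewrite order3E => /andP[]; apply: S4_norm3.
have -> : (#[f x] == 3) = false by rewrite (eqP o).
by move: o; rewrite order4E => /andP[]; apply: S4_norm4.
Qed.

Lemma klein24_inv2 x : x \in 'N_G(V) -> #[x] = 2 ->
  #|[set y in 'N_G(V) | [|| x * y == y * x, y * y == 1 | x * y * x == y^-1]]| = 16.
Proof.
move=> Nx ox; have [f injf _] := isogP klein24_isog.
rewrite (@card_inj_pred f injf _ (fun s => [|| f x * s == s * f x, s * s == 1 | f x * s * f x == s^-1])); last first.
  move=> y Ny; rewrite -morphV // -!morphM ?groupM // (morph_injm_eq1 injf) ?groupM //.
  by rewrite !(inj_in_eq (injmP injf)) ?groupM ?groupV.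
have /andP[] : (f x * f x == 1) && (f x != 1) by rewrite -order2E (order_injm injf Nx) ox.
exact: S4_inv2.
Qed.

End KleinNorm24.

(** * Maximal subgroups *)

Lemma klein12_isog (V : {group gT}) : ~~ (4 %| q)%N -> V \in kleins -> 'N_G(V) \isog 'Alt_('I_4).
Proof.
move=> q4 kV; have [H iso] := klein_norm_embed kV.
suff <- : H :=: 'Alt_('I_4) by [].
have cN : #|'N_G(V)| = 12 by rewrite card_klein_norm // (negPf q4).
apply: order12_Alt; first by rewrite -(card_isog iso) cN.
have [f injf imf] := isogP iso.
have sVN : V \subset 'N_G(V) by rewrite subsetI klein_sub // normG.
have c8 : #|'N_G(V) :\: V| = 8 by rewrite cardsD (setIidPr sVN) cN klein_card.
suff : 8 <= #|[set s in H | s * s * s == 1]| by apply: leq_trans.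
rewrite -c8 -(card_injm injf) ?subsetDl //; apply/subset_leq_card/subsetP=> s.
case/imsetP=> y /setIP[Ny Dy] ->; rewrite inE -imf mem_morphim //=.
by case/setDP: Dy => _ Vy; rewrite -!morphM ?groupM // (klein12_norm3 q4 kV Ny Vy) morph1.
Qed.

Lemma mod8_q : (p %% 8 \in [:: 1; 7]%N) = (4 %| q)%N.
Proof. by rewrite !inE /p /q; case: ifP; lia. Qed.

Lemma klein_norm_E (V : {group gT}) : V \in kleins -> E_type p 'N_G(V)%G.
Proof.
move=> kV; rewrite /E_type mod8_q; case: ifPn => q4; first exact: klein24_isog.
exact: klein12_isog.
Qed.

Lemma T_norm_proper x : x \in G^# -> 'N_G(T x) \proper G.
Proof.
move=> Gx; rewrite properEneq subsetIl andbT; apply: contra not_solG => /eqP eG.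
by apply: (solvableS _ (sol_T_norm Gx)); rewrite /= eG.
Qed.

Lemma klein_norm_proper (V : {group gT}) : V \in kleins -> 'N_G(V) \proper G.
Proof.
move=> kV; rewrite properEcard subsetIl (leq_trans (n := 25)) //.
  by rewrite card_klein_norm //; case: ifP.
by rewrite cardG_p /p; nia.
Qed.

Lemma maximal_cases M : maximal M G ->
  (exists2 x, x \in G^# & M = 'N_G(T x)%G) \/ (exists2 V, V \in kleins & M = 'N_G(V)%G).
Proof.
case/maxgroupP=> prM maxM; have [sMG _] := andP prM.
have M1 : M :!=: 1.
  have [u Gu cT] := exists_T_p; apply/eqP=> M1.
  have prT : T u \proper G.
    exact: sub_proper_trans (T_subN Gu) (T_norm_proper Gu).
  have := maxM (T u) prT; rewrite M1 sub1G => /(_ isT) e.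
  by have := p_gt6; rewrite -cT e cards1.
have [[x Gx sMN]|[V kV [_ sMN]]] := sol_sub_cases sMG (proper_sol prM) M1.
  left; exists x => //; apply/val_inj/esym; apply: maxM sMN; exact: T_norm_proper.
right; exists V => //; apply/val_inj/esym; apply: maxM sMN; exact: klein_norm_proper.
Qed.

(** A maximal subgroup above ['N_G(A)] is the normalizer of a torus or a four-group, which the
    hypotheses identify with A. *)
Lemma maximal_norm A : 'N_G(A) \proper G ->
  (forall x, x \in G^# -> 'N_G(A) \subset 'N_G(T x) -> A = T x) ->
  (forall V : {group gT}, V \in kleins -> 'N_G(A) \subset 'N_G(V) -> A = V) ->
  maximal 'N_G(A) G.
Proof.
move=> prN nT nV; have [eG|[M maxM sNM]] := maximal_exists (subsetIl G 'N(A)).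
  by rewrite /= eG properxx in prN.
suff -> : 'N_G(A) = M by [].
by case: (maximal_cases maxM) sNM => [[x Gx ->]|[V kV ->]] s; [rewrite (nT x)|rewrite (nV V)].
Qed.

Lemma maximal_Borel u : u \in G^# -> #|T u| = p -> maximal 'N_G(T u) G.
Proof.
move=> Gu cT; apply: maximal_norm; first exact: T_norm_proper.
  by move=> x Gx; apply: T_norm_sub.
move=> V kV /cardSg; rewrite card_Borel // => d; case/negP: (p'_klein_norm kV).
exact: dvdn_trans (dvdn_mulr _ (dvdnn p)) d.
Qed.

Lemma maximal_klein (V : {group gT}) : V \in kleins -> maximal 'N_G(V) G.
Proof.
move=> kV; apply: maximal_norm; first exact: klein_norm_proper.
  by move=> x Gx; rewrite (negPf (klein_norm_sub_T kV Gx)).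
by move=> W kW; apply: klein_norm_inj.
Qed.

(** A generator of the torus has order above 4, too large for the normalizer of a four-group. The
    bound on k leaves out p = 7. *)
Lemma maximal_torus x : 4 < k -> x \in G^# -> #|T x| <> p -> maximal 'N_G(T x) G.
Proof.
move=> k5 Gx nep; apply: maximal_norm; first exact: T_norm_proper.
  by move=> y Gy; apply: T_norm_sub.
move=> V kV sN; have [t eT [Gt ot _]] := T_gen Gx.
have Nt : t \in 'N_G(V) by rewrite (subsetP sN) // T_inN // eT cycle_id.
have t1 : t != 1 by case/setD1P: Gt.
have := klein_norm_order_in kV Nt t1; rewrite !inE ot.
by case: (ts_card tsG Gx) => [/nep//|->|->]; lia.
Qed.

(** For a generator t of the torus, the involutions n and n t generate the normalizer. *)
Lemma T_norm_dihedral x : x \in G^# -> #|T x| <> p -> dihedral_type (#|T x|).*2 'N_G(T x)%G.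
Proof.
move=> Gx nep; have [n Nn Tn] := ts_norm tsG Gx nep.
have [t eT [Gt ot _]] := T_gen Gx; have Tt : t \in T x by rewrite eT cycle_id.
have Dn : n \in 'N_G(T x) :\: T x by rewrite inE Tn.
have Dnt : n * t \in 'N_G(T x) :\: T x by rewrite inE groupMr // Tn groupM // T_inN.
have on := order_T_normD Gx nep Dn; have ont := order_T_normD Gx nep Dnt.
have nnt : n != n * t.
  by rewrite -{1}[n]mulg1 (inj_eq (mulgI n)) eq_sym; case/setD1P: Gt.
have := involutions_gen_dihedral on ont nnt.
suff -> : <<[set n; n * t]>> = 'N_G(T x) by rewrite card_T_norm.
have Ent : t \in <<[set n; n * t]>>.
  have En : n \in <<[set n; n * t]>> by rewrite mem_gen // !inE eqxx.
  by rewrite -(groupMl _ En) mem_gen // !inE eqxx orbT.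
apply/eqP; rewrite eqEsubset gen_subG subUset !sub1set Nn /=; apply/andP; split.
  by rewrite groupM // T_inN.
have sT : T x \subset <<[set n; n * t]>> by rewrite eT cycle_subG.
apply/subsetP=> y Ny; have [/(subsetP sT) //|Ty] := boolP (y \in T x).
have Dy : y \in 'N_G(T x) :\: T x by rewrite inE Ty.
have := subsetP sT _ (T_mulD Gx nep Dn Dy).
by rewrite groupMl // mem_gen // !inE eqxx.
Qed.

Lemma Borel_borel_type u : u \in G^# -> #|T u| = p -> borel_type p 'N_G(T u)%G.
Proof.
move=> Gu cT; have [h Gh [cTh defN]] := Borel_sdprod Gu cT.
apply/existsP; exists (T u); apply/existsP; exists (T h).
rewrite defN eqxx !T_cyclic // cT cTh eqxx /=; apply/eqP; rewrite /p; lia.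
Qed.

Lemma card_borel_type M : borel_type p M -> #|M| = (p * k)%N.
Proof.
case/existsP=> K /existsP[H /and5P[/eqP defM _ /eqP cK _ /eqP cH]].
by rewrite -(sdprod_card defM) cK cH; congr (_ * _)%N; rewrite /p; lia.
Qed.

Lemma p_ndvd_T_norm x : x \in G^# -> #|T x| <> p -> ~~ (p %| #|'N_G(T x)|).
Proof.
move=> Gx nep; rewrite card_T_norm // -mul2n Euclid_dvdM // negb_or p_ndvd_type // andbT.
by rewrite gtnNdvd //; have := p_gt6; lia.
Qed.

Lemma borel_typeP M : maximal M G -> borel_type p M ->
  exists2 u, u \in G^# & #|T u| = p /\ M = 'N_G(T u)%G.
Proof.
move=> maxM /card_borel_type cM; have pM : p %| #|M| by rewrite cM dvdn_mulr.
have [[x Gx eM]|[V kV eM]] := maximal_cases maxM; rewrite eM in pM.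
  have [cT|/eqP nep] := eqVneq #|T x| p; first by exists x.
  by rewrite (negPf (p_ndvd_T_norm Gx nep)) in pM.
by rewrite (negPf (p'_klein_norm kV)) in pM.
Qed.

(** A torus normalizer of order 12 or 24 has an element of order 6 or 12, and S_4 has none. *)
Lemma E_typeP M : maximal M G -> E_type p M -> exists2 V, V \in kleins & M = 'N_G(V)%G.
Proof.
move=> maxM EM; have [[x Gx eM]|//] := maximal_cases maxM.
have [L isoL cM] : exists2 L : {group 'S_4}, M \isog L & #|M| = 12 \/ #|M| = 24.
  move: EM; rewrite /E_type; case: ifP => _ iso.
    exists ('Sym_('I_4))%G => //; right; rewrite (card_isog iso) card_Sym card_ord.
    by rewrite !factS fact0.
  by exists ('Alt_('I_4))%G => //; left; rewrite (card_isog iso) -card_Alt4.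
have pM : ~~ (p %| #|M|).
  have p7 := p_gt6.
  case: cM => ->; first by rewrite -[12]/(2 * (2 * 3))%N !Euclid_dvdM // !gtnNdvd //; lia.
  by rewrite -[24]/(2 * (2 * (2 * 3)))%N !Euclid_dvdM // !gtnNdvd //; lia.
have nep : #|T x| <> p.
  by move=> cT; case/negP: pM; rewrite eM card_Borel // dvdn_mulr.
have [t eT [Gt ot _]] := T_gen Gx.
have Mt : t \in M by rewrite eM T_inN // eT cycle_id.
have := S4_image_orders isoL Mt; have t1 : t != 1 by case/setD1P: Gt.
have ot6 : #[t] = 6 \/ #[t] = 12.
  have e2 : #|M| = (#[t]).*2 by rewrite eM ot -card_T_norm.
  by case: cM; rewrite e2; lia.
have big : 4 < #[t] by case: ot6 => ->.
have [o2 o3 o4] : [/\ #[t] != 2, #[t] != 3 & #[t] != 4] by split; rewrite neq_ltn ?(ltnW big) ?orbT //; lia.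
move: o2 o3 o4; rewrite order2E order3E order4E t1 !andbT (negPf t1) /=.
by move=> /negPf-> /negPf-> /=; rewrite andbT => /negPf->.
Qed.

(** The rotation x has order m > 2 and M normalizes its cyclic group, so M lies in the normalizer of
    [T x]. As m divides the order of [T x], that order is m, and M is the full normalizer. *)
Lemma dihedral_typeP m M : M \subset G -> m = k \/ m = k.+1 -> dihedral_type m.*2 M ->
  exists2 x, x \in G^# & #|T x| = m /\ M = 'N_G(T x)%G.
Proof.
move=> sMG mk; have m3 : 2 < m by case: mk => ->; lia.
have m1 : 1 < m by apply: ltnW.
case/(isoGrpP _ (Grp_dihedral m1)); rewrite card_dihedral // => cM.
case/existsP=> -[x y] /= /eqP[defM xm y2 xy].
have nxy : <[y]> \subset 'N(<[x]>) by rewrite norms_cycle xy groupV cycle_id.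
have eM : <[x]> * <[y]> = M by rewrite -norm_joinEr.
have Mx : x \in M by rewrite -cycle_subG -eM mulG_subl.
(* The relations bound the orders of x and y by m and 2, and |M| = 2m leaves no slack. *)
have ox : #[x] = m.
  have := mul_cardG <[x]>%G <[y]>%G; rewrite /= eM cM -!orderE.
  have /dvdn_leq : #[x] %| m by rewrite order_dvdn xm.
  have /dvdn_leq : #[y] %| 2 by rewrite order_dvdn y2.
  by have := cardG_gt0 (<[x]> :&: <[y]>)%G; rewrite /=; move: #|_| #[x] #[y] => a b c; nia.
have Gx : x \in G^#.
  by rewrite !inE (subsetP sMG) // andbT -order_gt1 ox.
have nM : M \subset 'N(<[x]>) by rewrite -eM mul_subG ?normG.
have sMN := sub_torus_norm Gx sMG Mx nM.
have dT := T_order_dvd Gx; rewrite ox in dT.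
have nep : #|T x| <> p.
  by move/eqP; rewrite -T_card_pE // ox /p; case: mk => ->; lia.
have cT : #|T x| = m.
  case: (ts_card tsG Gx) => [/nep//|eT|eT]; rewrite eT in dT *; case: mk => em //.
    by have := dvdn_leq _ dT; rewrite em; lia.
  by move: dT; rewrite em -addn1 dvdn_addr // dvdn1 => /eqP; lia.
exists x => //; split=> //; apply/val_inj/eqP.
by rewrite /= eqEcard sMN card_T_norm // cT cM leqnn.
Qed.

(** * Numbers of normalized tori and four-groups *)

Lemma tori_J m A g : A \in tori m -> g \in G -> (A :^ g)%G \in tori m.
Proof.
case/toriP=> x Gx [-> cT] Gg; apply/toriP; exists (x ^ g); first exact: T_J1.
by rewrite TJ //= cardJg.
Qed.

Lemma normG_J A g : g \in G -> 'N_G(A :^ g) = 'N_G(A) :^ g.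
Proof. by move=> Gg; rewrite normJ conjIg (conjGid Gg). Qed.

Definition ntori m x := #|[set A in tori m | x \in 'N_G(A)]|.
Definition nklein x := #|[set V in kleins | x \in 'N_G(V)]|.

(** A subgroup of the given kind is the normalizer of exactly one A in F. *)
Lemma card_through (F : {set {group gT}}) x (P : pred {group gT}) (Q : pred {group gT}) :
    {in F &, forall A B, 'N_G(A) \subset 'N_G(B) -> A = B} ->
    (forall A, A \in F -> Q 'N_G(A)%G && P 'N_G(A)%G) ->
    (forall M, Q M -> P M -> exists2 A, A \in F & M = 'N_G(A)%G) ->
  #|[set M : {group gT} | [&& Q M, x \in M & P M]]| = #|[set A in F | x \in 'N_G(A)]|.
Proof.
move=> injN QP PQ; rewrite -[RHS](card_in_imset (f := fun A : {group gT} => 'N_G(A)%G)).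
  congr #|pred_of_set _|; apply/setP=> M; rewrite inE; apply/and3P/imsetP.
    case=> QM Mx PM; have [A FA eM] := PQ M QM PM; exists A => //.
    by rewrite inE FA -[_ \in _]/(x \in 'N_G(A)%G) -eM.
  by case=> A /setIdP[FA NAx] ->; have /andP[? ?] := QP A FA.
move=> A B /setIdP[FA _] /setIdP[FB _] /(congr1 val) /= eN.
by apply: injN; rewrite // eN.
Qed.

Lemma tori_inj (m n : nat) : {in tori m & tori n, forall A B, 'N_G(A) \subset 'N_G(B) -> A = B}.
Proof. by move=> A B /toriP[x Gx [-> _]] /toriP[y Gy [-> _]]; apply: T_norm_sub. Qed.

Lemma nb_borelE x : #|maximal_through G x (borel_type p)| = ntori p x.
Proof.
apply: (@card_through (tori p) x (borel_type p) (fun M => maximal M G)); first exact: tori_inj.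
  by move=> A /toriP[u Gu [-> cT]]; rewrite maximal_Borel ?Borel_borel_type.
move=> M maxM bM; have [u Gu [cT ->]] := borel_typeP maxM bM.
by exists (T u) => //; apply/toriP; exists u.
Qed.

Lemma nb_dihedral_subE m x : m = k \/ m = k.+1 ->
  #|subgroups_through G x (dihedral_type m.*2)| = ntori m x.
Proof.
move=> mk; have nep : m <> p by case: mk => ->; rewrite /p; lia.
apply: (@card_through (tori m) x (dihedral_type m.*2) (fun M => M \subset G)); first exact: tori_inj.
  by move=> A /toriP[u Gu [-> cT]]; rewrite subsetIl -cT T_norm_dihedral ?cT.
move=> M sMG dM; have [u Gu [cT ->]] := dihedral_typeP sMG mk dM.
by exists (T u) => //; apply/toriP; exists u.
Qed.

Lemma nb_dihedral_maxE m x : 4 < k -> m = k \/ m = k.+1 ->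
  #|maximal_through G x (dihedral_type m.*2)| = ntori m x.
Proof.
move=> k5 mk; have nep : m <> p by case: mk => ->; rewrite /p; lia.
apply: (@card_through (tori m) x (dihedral_type m.*2) (fun M => maximal M G)); first exact: tori_inj.
  by move=> A /toriP[u Gu [-> cT]]; rewrite maximal_torus -?cT ?T_norm_dihedral ?cT.
move=> M /maxgroupp/proper_sub sMG dM; have [u Gu [cT ->]] := dihedral_typeP sMG mk dM.
by exists (T u) => //; apply/toriP; exists u.
Qed.

Lemma nb_EE x : #|maximal_through G x (E_type p)| = nklein x.
Proof.
apply: (@card_through kleins x (E_type p) (fun M => maximal M G)).
- by move=> V W; apply: klein_norm_inj.
- by move=> V kV; rewrite maximal_klein ?klein_norm_E.
by move=> M; apply: E_typeP.
Qed.

Lemma tori_mem m x A : x \in G^# -> A \in tori m -> x \in A -> A = T x.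
Proof. by move=> Gx /toriP[y Gy [-> _]] Tx; apply/esym/eqT; rewrite // !inE Tx andbT; case/setD1P: Gx. Qed.

Lemma ntori_ge3 m x : x \in G^# -> m <> p -> #[x] != 2 -> ntori m x = (#|T x| == m).
Proof.
move=> Gx nep ox; rewrite /ntori.
have -> : [set A in tori m | x \in 'N_G(A)] = if #|T x| == m then [set T x] else set0.
  apply/setP=> A; apply/setIdP/idP => [[tA NAx]|].
    have eA : A = T x.
      apply: (tori_mem Gx tA); case/toriP: tA NAx => y Gy [-> cT] Nx.
      by apply: norm_T_mem; rewrite ?cT.
    have cTx : #|T x| = m by case/toriP: tA => y _ [eAy <-]; rewrite -eAy eA.
    by rewrite cTx eqxx inE eA.
  case: eqP => [cT|_]; rewrite inE // => /eqP->; split; first by apply/toriP; exists x.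
  by apply: T_inN; rewrite ?memT.
by case: eqP => _; rewrite ?cards1 ?cards0.
Qed.

Lemma ntori_p_p x : x \in G^# -> #|T x| = p -> ntori p x = 1%N.
Proof.
move=> Gx cT; rewrite /ntori -(cards1 (T x)); congr #|pred_of_set _|.
apply/setP=> A; rewrite [RHS]inE; apply/setIdP/eqP => [[tA NAx]|->].
  apply: (tori_mem Gx tA); case/toriP: tA NAx => y Gy [-> cTy].
  by apply: norm_T_p.
by split; [apply/toriP; exists x | apply: T_inN; rewrite ?memT].
Qed.

(** The quotient by [T u] has order k, so x^k lies in [T u] as well as in the different torus [T x],
    and is 1. *)
Lemma Borel_mem_dvd x u : x \in G^# -> u \in G^# -> #|T u| = p -> #|T x| <> p ->
  x \in 'N_G(T u) -> #[x] %| k.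
Proof.
move=> Gx Gu cT nep Nx; have nT : 'N_G(T u) \subset 'N(T u) by apply: subsetIr.
have : x ^+ k \in T u.
  have cQ : #|'N_G(T u) / T u| = k.
    by rewrite card_quotient // -divgS ?T_subN // card_Borel // cT mulKn // prime_gt0.
  apply: coset_idr; first by rewrite groupX // (subsetP nT).
  rewrite morphX ?(subsetP nT) //; apply/eqP; rewrite -order_dvdn -cQ order_dvdG //.
  exact: mem_quotient.
move=> Tuxk; rewrite order_dvdn; apply: contraT => xk1; case: nep.
by rewrite -cT (T_meet Gx Gu (z := x ^+ k)) // groupX // memT.
Qed.

Lemma ntori_p_nonsplit x : x \in G^# -> #|T x| = k.+1 -> ntori p x = 0.
Proof.
move=> Gx cT; apply/eqP; rewrite cards_eq0; apply/eqP/setP=> A; rewrite in_set0.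
apply/setIdP => -[/toriP[u Gu [-> cTu]] Nx].
have nep : #|T x| <> p by rewrite cT /p; lia.
have d1 := Borel_mem_dvd Gx Gu cTu nep Nx; have := T_order_dvd Gx.
rewrite cT -addn1 dvdn_addr // dvdn1 order_eq1.
by case/setD1P: Gx => /negPf->.
Qed.

(** [T x] is conjugate to the complement in a Borel subgroup, so it normalizes some A. An element w
    of N(T x) outside [T x] gives another, [A :^ w]: otherwise N(T x) would lie in N(A). *)
Lemma ntori_p_split_ge2 x : x \in G^# -> #|T x| = k -> 1 < ntori p x.
Proof.
move=> Gx cT; have nep : #|T x| <> p by rewrite cT /p; lia.
have [u Gu cTu] := exists_T_p; have [h Gh [cTh defB]] := Borel_sdprod Gu cTu.
have [g Gg eT] : exists2 g, g \in G & T x = (T h :^ g)%G.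
  by apply: (ts_trans tsG) => //; rewrite cTh ?cT // /p; lia.
have sTB : T h \subset 'N_G(T u) by case/sdprodP: defB => _ <- _ _; apply: mulG_subr.
set A := (T u :^ g)%G; have tA : A \in tori p by rewrite tori_J //; apply/toriP; exists u.
have sTA : T x \subset 'N_G(A) by rewrite normG_J // eT conjSg.
have [w Nw Tw] := ts_norm tsG Gx nep; have [Gw NTw] := setIP Nw.
have Dw : w \in 'N_G(T x) :\: T x by rewrite inE Tw.
have nAB : A != (A :^ w)%G.
  apply: contraTneq (T_norm_nonabelian Gx) => eAw.
  have NAw : w \in 'N_G(A) by rewrite inE Gw; apply/normP; rewrite -[RHS]/(gval A) {2}eAw.
  have sN : 'N_G(T x) \subset 'N_G(A).
    apply/subsetP=> y Ny; have [/(subsetP sTA) //|Ty] := boolP (y \in T x).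
    rewrite -(groupMl _ NAw); apply: (subsetP sTA); apply: T_mulD => //.
    by rewrite inE Ty.
  have tTx : T x \in tori k by apply/toriP; exists x.
  have eTA := tori_inj tTx tA sN.
  have cA : #|A| = p by rewrite cardJg.
  by case: nep; rewrite -cA -eTA.
have <- : #|[set A; (A :^ w)%G]| = 2 by rewrite cards2 nAB.
have xTx := memT Gx; apply/subset_leq_card/subsetP=> B.
rewrite in_set2 => /orP[] /eqP ->; apply/setIdP; split; rewrite ?(tori_J tA Gw) ?(subsetP sTA) //.
have sTAw : T x \subset 'N_G(A) :^ w by rewrite -(normP NTw) conjSg.
by have := subsetP sTAw x xTx; rewrite -normG_J.
Qed.

(** A Borel subgroup has at most p (k - 1) elements of split type, so there are at most (p + 1) p (k
    - 1) incidences, twice the number of such elements. Each element has at least two, hence exactly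
    two. *)
Lemma ntori_p_split x : x \in G^# -> #|T x| = k -> ntori p x = 2.
Proof.
move=> Gx cT; pose X := [set y in G^# | #|T y| == k].
have ge2 y : y \in X -> 1 < ntori p y by case/setIdP=> Gy /eqP; apply: ntori_p_split_ge2.
have sumX : \sum_(y in X) ntori p y <= \sum_(y in X) 2.
  rewrite (double_sum (tori p) (fun A => 'N_G(A)) X) sum_nat_const card_T_fibers card_tori_split.
  apply: leq_trans (_ : \sum_(A in tori p) p * k.-1 <= _)%N.
    apply: leq_sum => A /toriP[u Gu [-> cTu]].
    have -> : (p * k.-1)%N = #|'N_G(T u) :\: T u|.
      by rewrite cardsD (setIidPr (T_subN Gu)) card_Borel // cTu -subn1 mulnBr muln1.
    apply/subset_leq_card/subsetP=> y /setIP[Ny /setIdP[Gy /eqP cTy]]; rewrite inE Ny andbT.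
    apply/negP=> Ty; move: cTy; rewrite (eqT Gu) ?cTu; first by rewrite /p; lia.
    by case/setD1P: Gy => y1 _; rewrite !inE y1.
  by rewrite sum_nat_const card_tori_p /p; lia.
have e0 : \sum_(y in X) (ntori p y - 2) = 0.
  apply/eqP; rewrite -leqn0 -(leq_add2r (\sum_(y in X) 2)) -big_split /=.
  rewrite (eq_bigr (ntori p)) // => y Xy; rewrite subnK //; exact: ge2.
have Xx : x \in X by rewrite inE Gx cT eqxx.
move/eqP: e0; rewrite sum_nat_eq0 => /forall_inP/(_ x Xx).
by rewrite subn_eq0 => le2; apply/eqP; rewrite eqn_leq le2 ge2.
Qed.

(** Involutions are conjugate, so tori normalized by x and not containing it can be counted on
    average: each torus has m involutions in its normalizer outside it, which gives q. The torus of
    x itself adds one if m = q. *)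
Lemma ntori_inv m x : m = k \/ m = k.+1 -> x \in G -> #[x] = 2 ->
  ntori m x = (q + (m == q))%N.
Proof.
move=> mk Gx ox; have Gx1 := invG Gx ox.
have nep : m <> p by case: mk => ->; rewrite /p; lia.
have cTx : #|T x| = q by rewrite inv_type.
pose f (A : {group gT}) := 'N_G(A) :\: A.
have fJ (A : {group gT}) h : h \in G -> f (A :^ h)%G = f A :^ h.
  by move=> Gh; rewrite /f /= normG_J // conjDg.
pose c := #|[set A in tori m | x \in f A]|.
have cX y : y \in invols -> #|[set A in tori m | y \in f A]| = c.
  case/setIdP=> Gy /eqP oy; have [g Gg <-] := inv_conj Gx Gy ox oy.
  by apply: count_conj => // A tA h Gh; apply: tori_J.
have := double_count cX; rewrite (eq_bigr (fun _ => m)) => [e|A /toriP[y Gy [-> cT]]]; last first.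
  rewrite -[RHS]cT -(card_T_normD Gy) ?cT //; congr #|pred_of_set _|; apply/setIidPl.
  apply/subsetP=> z Dz; rewrite inE (order_T_normD Gy _ Dz) ?cT // eqxx andbT.
  by case/setDP: Dz => /setIP[].
have ec : c = q.
  have em : (#|tori m| * m.*2)%N = #|G|.
    apply: card_tori_mul => //; case: mk => ->; [exact: ts_split tsG|exact: ts_nonsplit tsG].
  have i0 : 0 < #|invols| by apply/card_gt0P; exists x; rewrite inE Gx ox.
  apply/eqP; rewrite -(eqn_pmul2l i0) -(eqn_pmul2r (ltn0Sn 1)); apply/eqP.
  move: em e; rewrite sum_nat_const -card_invols.
  by move: #|invols| #|tori m| {cX}c q => I t c' q'; rewrite -!muln2; lia.
rewrite /ntori; have -> : [set A in tori m | x \in 'N_G(A)] =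
    [set A in tori m | x \in f A] :|: (if m == q then [set T x] else set0).
  apply/setP=> A; apply/setIdP/setUP => [[tA NAx] | [/setIdP[tA /setDP[]] // |]].
    have [Ax | Ax] := boolP (x \in A); last by left; rewrite inE tA inE Ax.
    have eA := tori_mem Gx1 tA Ax; right.
    have -> : m = q by case/toriP: tA => y _ [eAy <-]; rewrite -eAy eA.
    by rewrite eqxx inE eA.
  case: eqP => [em|_]; rewrite inE // => /eqP->; split; last by apply: T_inN; rewrite ?memT.
  by apply/toriP; exists x; rewrite // em.
rewrite cardsU (_ : _ :&: _ = set0) ?cards0 ?subn0; last first.
  apply/setP=> A; rewrite in_set0; apply/setIP => -[/setIdP[_ /setDP[_ Ax]]].
  by case: eqP => _; rewrite inE // => /eqP eA; case/negP: Ax; rewrite eA memT.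
by rewrite -/c ec; case: eqP => _; rewrite ?cards1 ?cards0.
Qed.

Lemma card_cyclic_order A j : cyclic A -> (j %| #|A|)%N -> #|[set y in A | #[y] == j]| = totient j.
Proof.
move=> cycA jA; have [t eA] := cyclicP cycA; have ot : #[t] = #|A| by rewrite eA.
have [m em] := dvdnP jA; have m0 : 0 < m by case: (m) em => [|//]; have := cardG_gt0 A; lia.
pose r := t ^+ m; have Ar : r \in A by rewrite eA groupX ?cycle_id.
have or : #[r] = j by rewrite orderXdiv ot em ?dvdn_mulr // mulKn.
rewrite -or totient_gen; congr #|pred_of_set _|; apply/setP=> y; rewrite !inE /generator.
apply/andP/eqP => [[Ay /eqP oy]|e].
  apply/eqP; rewrite (eq_subG_cyclic cycA) ?cycle_subG // -!orderE oy //.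
by rewrite -cycle_subG -e cycle_subG Ar !orderE e.
Qed.

Lemma order_type x y : x \in G^# -> y \in G^# -> #|T x| <> p -> #[x] = #[y] -> #|T x| = #|T y|.
Proof.
move=> Gx Gy nepx eo; have nepy : #|T y| <> p.
  by move/eqP; rewrite -T_card_pE // -eo T_card_pE // => /eqP.
have [o2|o2] := eqVneq #[x] 2; first by rewrite !inv_type // -eo.
have dx := T_order_dvd Gx; have dy := T_order_dvd Gy; rewrite -eo in dy.
have o1 : #[x] != 1%N by rewrite order_eq1; case/setD1P: Gx.
case: (ts_card tsG Gx) (ts_card tsG Gy) dx dy => [/nepx//|->|->] [/nepy//|->|->] // dx dy.
  by move: dy; rewrite -addn1 dvdn_addr // dvdn1 (negPf o1).
by move: dx; rewrite -addn1 dvdn_addr // dvdn1 (negPf o1).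
Qed.

Lemma card_order x : x \in G^# -> #|T x| <> p ->
  #|[set y in G | #[y] == #[x]]| = (#|tori #|T x| | * totient #[x])%N.
Proof.
move=> Gx nep; rewrite -sum1_card (partition_big T (mem (tori #|T x|))) /=; last first.
  move=> y /setIdP[Gy /eqP oy]; have x1 : x != 1 by case/setD1P: Gx.
  have Gy1 : y \in G^# by rewrite !inE Gy -order_eq1 oy order_eq1 x1.
  by apply/toriP; exists y; rewrite // (order_type Gx Gy1).
rewrite -sum_nat_const; apply: eq_bigr => A tA; have /toriP[z Gz [eA cz]] := tA.
rewrite -(@card_cyclic_order A) ?eA ?T_cyclic ?cz ?T_order_dvd // -eA sum1dep_card.
congr #|pred_of_set _|; apply/setP=> y; apply/setIdP/setIdP => [[/setIdP[Gy oy] /eqP <-]|[Ay oy]].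
  split=> //; apply: memT; rewrite !inE Gy -order_eq1 (eqP oy) order_eq1.
  by case/setD1P: Gx => ->.
have y1 : y != 1 by rewrite -order_eq1 (eqP oy) order_eq1; case/setD1P: Gx.
have Gy : y \in G^# by rewrite !inE y1 (subsetP (TsubG Gz)) // -eA.
by rewrite inE (TG Gy) oy -(tori_mem Gy tA Ay).
Qed.

(** Incidences of the elements of order #[x] with normalizers of four-groups, where |G| is both 12
    times the number of four-groups and 2 |T x| times the number of tori of that order. Elements of
    equal order generate conjugate groups, so they normalize equally many four-groups. *)
Lemma nklein_mul x (n : nat) : x \in G^# -> #|T x| <> p ->
    (forall V : {group gT}, V \in kleins ->
       #|'N_G(V) :&: [set y in G | #[y] == #[x]]| = n) ->
  (6 * (nklein x * totient #[x]) = #|T x| * n)%N.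
Proof.
move=> Gx nep cV; pose X := [set y in G | #[y] == #[x]].
have cX y : y \in X -> #|[set V in kleins | y \in 'N_G(V)]| = nklein x.
  case/setIdP=> Gy /eqP oy; have x1 : x != 1 by case/setD1P: Gx.
  have Gy1 : y \in G^# by rewrite !inE Gy -order_eq1 oy order_eq1 x1.
  have [g Gg exy] := same_cycle_conj Gx Gy1 nep (order_type Gx Gy1 nep (esym oy)) (esym oy).
  rewrite /nklein -(@count_conj kleins (fun V => 'N_G(V)) x g) //; last first.
  - by move=> A h Gh; rewrite normG_J.
  - by move=> A kA h Gh; apply: kleins_J.
  have eN (V : {group gT}) : (y \in 'N_G(V)) = (x ^ g \in 'N_G(V)) by rewrite -!cycle_subG exy.
  congr #|pred_of_set _|; apply/setP=> V.
  by apply/setIdP/setIdP; rewrite eN.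
have := double_count cX; rewrite (eq_bigr _ cV) sum_nat_const card_order //.
have em := card_tori_mul nep (ex_intro2 _ _ x Gx erefl).
have := card_kleins; rewrite -em => eK e.
have t0 : 0 < #|tori #|T x| | by apply/card_gt0P; exists (T x); apply/toriP; exists x.
apply/eqP; rewrite -(eqn_pmul2l t0); apply/eqP.
have {}eK := congr1 (fun i => i * n)%N eK; move: eK e; rewrite -muln2.
by move: #|tori #|T x| | (totient #[x]) => b d; lia.
Qed.

(** * Solubilizers *)

Lemma sol_pair_proper x y : x \in G -> y \in G -> solvable <<[set x; y]>> ->
  <<[set x; y]>> \proper G.
Proof.
move=> Gx Gy solH; rewrite properEneq gen_subG subUset !sub1set Gx Gy !andbT.
by apply: contra not_solG => /eqP <-.
Qed.

(** Proper subgroups are soluble and [G] is not. *)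
Lemma Sol_bigcup x : x \in G ->
  Sol G x = \bigcup_(M : {group gT} | maximal M G && (x \in M)) M.
Proof.
move=> Gx; apply/setP=> y; rewrite inE; apply/andP/bigcupP => [[Gy solH]|[M /andP[maxM Mx] My]].
  have prH := sol_pair_proper Gx Gy solH.
  have [eG|[M maxM sHM]] := maximal_exists (proper_sub prH).
    by rewrite /= eG properxx in prH.
  have [Mx My] : x \in M /\ y \in M.
    by split; apply: (subsetP sHM); rewrite mem_gen // !inE eqxx ?orbT.
  by exists M; rewrite ?maxM.
have prM := maxgroupp maxM; split; first exact: (subsetP (proper_sub prM)).
apply: solvableS (proper_sol prM); rewrite gen_subG subUset !sub1set Mx.
exact: My.
Qed.

(* The part of Sol_G(x) covered by the maximal subgroups that normalize a torus. *)
Definition Dset x := [set y in G | [exists z in G^#, (x \in 'N_G(T z)) && (y \in 'N_G(T z))]].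

Lemma DsetP x y : reflect (exists2 z, z \in G^# & x \in 'N_G(T z) /\ y \in 'N_G(T z)) (y \in Dset x).
Proof.
rewrite [y \in Dset x]inE; apply: (iffP andP) => [[_ /exists_inP[z Gz /andP[Nx Ny]]]|[z Gz [Nx Ny]]].
  by exists z.
split; first by case/setIP: Ny.
by apply/exists_inP; exists z => //; rewrite Nx Ny.
Qed.

Lemma mem_Sol H x y : H \subset G -> solvable H -> x \in H -> y \in H -> y \in Sol G x.
Proof.
move=> sHG solH Hx Hy; rewrite inE (subsetP sHG) //=; apply: solvableS solH.
by rewrite gen_subG subUset !sub1set Hx Hy.
Qed.

Lemma sol_klein_norm (V : {group gT}) : V \in kleins -> solvable 'N_G(V).
Proof. by move=> kV; apply: proper_sol; apply: klein_norm_proper. Qed.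

(** For y outside [Dset x], the group generated by x and y normalizes no torus, so exactly one
    four-group; the pieces ['N_G(V) :\: Dset x] are disjoint. *)
Lemma card_Sol x (n : nat) : x \in G^# ->
    (forall V : {group gT}, V \in kleins -> x \in 'N_G(V) -> #|'N_G(V) :\: Dset x| = n) ->
  #|Sol G x| = (#|Dset x| + nklein x * n)%N.
Proof.
move=> Gx cN; have sDS : Dset x \subset Sol G x.
  apply/subsetP=> y /DsetP[z Gz [Nx Ny]].
  exact: (mem_Sol (subsetIl _ _) (sol_T_norm Gz)).
rewrite -(cardsID (Dset x) (Sol G x)) (setIidPr sDS); congr (_ + _)%N.
have := double_sum [set V in kleins | x \in 'N_G(V)] (fun V => 'N_G(V)) (Sol G x :\: Dset x).
rewrite -sum1_card (eq_bigr (fun _ => 1%N)) => [->|y /setDP[Sy Dy]].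
  rewrite -sum_nat_const; apply: eq_bigr => V /setIdP[kV NVx].
  rewrite setIDA (setIidPl _) ?cN //; apply/subsetP=> y Ny.
  exact: (mem_Sol (subsetIl _ _) (sol_klein_norm kV)).
have [Gy solH] := setIdP Sy; set H := <<[set x; y]>> in solH.
have [Hx Hy] : x \in H /\ y \in H by split; rewrite mem_gen // !inE eqxx ?orbT.
have prH := sol_pair_proper (TG Gx) Gy solH; have sHG := proper_sub prH.
have nHT z : z \in G^# -> ~~ (H \subset 'N_G(T z)).
  move=> Gz; apply: contra Dy => /subsetP sHN; apply/DsetP; exists z => //.
  by split; apply: sHN.
have H1 : H != 1.
  by apply: contraTneq Hx => ->; rewrite inE; case/setD1P: Gx.
have [[z Gz sHN]|[V kV [_ sHV]]] := sol_sub_cases (H := [group of H]) sHG solH H1.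
  by case/negP: (nHT z Gz).
rewrite -(cards1 V); congr #|pred_of_set _|; apply/setP=> W; rewrite inE in_set1.
apply/andP/eqP => [[/setIdP[kW Wx] Wy]|->].
  apply: (klein_uniq (H := [group of H])) => //.
  by rewrite gen_subG subUset !sub1set Wx Wy.
by rewrite inE kV !(subsetP sHV).
Qed.

Lemma Dset_p x : x \in G^# -> #|T x| = p -> Dset x = 'N_G(T x).
Proof.
move=> Gx cT; apply/setP=> y; apply/DsetP/idP => [[z Gz [Nx Ny]]|Ny]; last first.
  by exists x; rewrite // T_inN ?memT.
suff Tzx : x \in T z by rewrite (T_meet Gx Gz (memT Gx) Tzx) //; case/setD1P: Gx.
have [cz|/eqP nep] := eqVneq #|T z| p; first exact: norm_T_p.
apply: norm_T_mem => //; have /eqP -> : #[x] == p by rewrite T_card_pE // cT.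
by have := p_gt6; case: (p) => [|[|[|]]].
Qed.

Lemma klein_Borel_commute (V : {group gT}) x y u : V \in kleins -> u \in G^# -> #|T u| = p ->
  x \in 'N_G(V) -> y \in 'N_G(V) -> x \in 'N_G(T u) -> y \in 'N_G(T u) -> commute x y.
Proof.
move=> kV Gu cT Vx Vy Bx By.
have ab : abelian ('N_G(V) :&: 'N_G(T u)).
  apply: (Borel_p'_abelian (H := ('N_G(V) :&: 'N_G(T u))%G) Gu cT (subsetIr _ _)).
  by apply: contra (p'_klein_norm kV) => /dvdn_trans; apply; rewrite cardSg ?subsetIl.
by apply: (centsP ab); rewrite inE ?Vx ?Vy.
Qed.

Lemma T_norm_conj x y : x \in G^# -> #|T x| <> p -> 2 < #[x] -> y \in G ->
  (y \in 'N_G(T x)) = (x * y == y * x) || (x * y * x == y).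
Proof.
move=> Gx nep ox Gy; have o2 : #[x] != 2 by rewrite neq_ltn ox orbT.
apply/idP/orP => [Ny|].
  have [Ty|Ty] := boolP (y \in T x).
    by left; rewrite (centsP (T_abelian Gx) x (memT Gx) y Ty).
  right; have := T_invert Gx nep (n := y) _ (memT Gx); rewrite inE Ty Ny => /(_ isT) e.
  by rewrite (conjgC x y) e mulgKV.
case=> /eqP e; apply: (T_normP Gx Gy (T_mem1 Gx)).
  by rewrite conjgE e mulKg memT.
suff -> : x ^ y = x^-1 by rewrite groupV memT.
by apply: (mulIg x); rewrite mulVg conjgE -!mulgA [x * (y * x)]mulgA e mulVg.
Qed.

Lemma Dset_ge3 x : x \in G^# -> #|T x| <> p -> #[x] != 2 ->
  Dset x = 'N_G(T x) :|: \bigcup_(A in [set A in tori p | x \in 'N_G(A)]) 'N_G(A).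
Proof.
move=> Gx nep o2; apply/setP=> y; apply/DsetP/setUP => [[z Gz [Nx Ny]]|[Ny|/bigcupP[A]]].
- have [cz|/eqP nepz] := eqVneq #|T z| p.
    right; apply/bigcupP; exists (T z) => //; rewrite inE Nx andbT.
    by apply/toriP; exists z.
  left; have Tzx := norm_T_mem Gx Gz nepz o2 Nx.
  by rewrite (T_meet Gx Gz (memT Gx) Tzx) //; case/setD1P: Gx.
- by exists x; rewrite // T_inN ?memT.
by case/setIdP=> /toriP[z Gz [-> _]] Nx Ny; exists z.
Qed.

(** Within ['N_G(V)] Borel subgroups add nothing: an element sharing one with x commutes with x, so
    it already normalizes [T x]. *)
Lemma klein_Dset_ge3 (V : {group gT}) x : V \in kleins -> x \in 'N_G(V) ->
    x \in G^# -> #|T x| <> p -> 2 < #[x] ->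
  #|'N_G(V) :\: Dset x| =
    (#|'N_G(V)| - #|[set y in 'N_G(V) | (x * y == y * x)%g || (x * y * x == y)%g]|)%N.
Proof.
move=> kV Vx Gx nep ox; have o2 : #[x] != 2 by rewrite neq_ltn ox orbT.
rewrite cardsD; congr (_ - #|pred_of_set _|)%N; apply/setP=> y.
apply/setIP/setIdP => -[Vy]; have Gy : y \in G by case/setIP: Vy.
  rewrite Dset_ge3 // -T_norm_conj // => /setUP[//|/bigcupP[A]].
  case/setIdP=> /toriP[z Gz [-> cz]] Nx Ny; split=> //.
  have cxy := klein_Borel_commute kV Gz cz Vx Vy Nx Ny.
  apply: T_inN => //; rewrite -(cent_semisimple Gx nep o2) inE Gy.
  by apply/cent1P/commute_sym.
by rewrite -T_norm_conj // => Ny; split=> //; rewrite Dset_ge3 // inE Ny.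
Qed.

(** * Elements of split tori and their two Borel subgroups *)

Section SplitBorels.

Variable x : gT.
Hypotheses (Gx : x \in G^#) (cT : #|T x| = k).

Let nep : #|T x| <> p. Proof. by rewrite cT /p; lia. Qed.

(** A generator of [T x] lies in exactly two Borel subgroups; both contain x, which has only two. *)
Lemma Borel_sub_T A : A \in tori p -> x \in 'N_G(A) -> T x \subset 'N_G(A).
Proof.
move=> tA NAx; have [t eT [Gt ot eTt]] := T_gen Gx.
have sub : [set A in tori p | t \in 'N_G(A)] \subset [set A in tori p | x \in 'N_G(A)].
  apply/subsetP=> B /setIdP[tB NBt]; rewrite inE tB.
  have : x \in T x by apply: memT.
  by apply: subsetP; rewrite eT cycle_subG.
have eN : [set A in tori p | t \in 'N_G(A)] = [set A in tori p | x \in 'N_G(A)].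
  by apply/eqP; rewrite eqEcard sub -!/(ntori p _) !ntori_p_split // eTt.
have : A \in [set A in tori p | x \in 'N_G(A)] by rewrite inE tA.
by rewrite -eN eT cycle_subG => /setIdP[].
Qed.

(** An element of the intersection outside [T x] would, with [T x], put all of N(T x) into N(A). *)
Lemma Borel_meet_T_norm A : A \in tori p -> x \in 'N_G(A) -> 'N_G(T x) :&: 'N_G(A) = T x.
Proof.
move=> tA NAx; have sTA := Borel_sub_T tA NAx; apply/eqP.
rewrite eqEsubset subsetI sTA T_subN // !andbT; apply/subsetP=> y /setIP[Ny NAy].
apply: contraT => Ty; have tTx : T x \in tori k by apply/toriP; exists x.
have sN : 'N_G(T x) \subset 'N_G(A).
  apply/subsetP=> z Nz; have [/(subsetP sTA) //|Tz] := boolP (z \in T x).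
  rewrite -(groupMl _ NAy); apply: (subsetP sTA); apply: (T_mulD Gx nep).
    by rewrite inE Ty.
  by rewrite inE Tz.
have eTA := tori_inj tTx tA sN.
by case/toriP: tA => u Gu [eA cA]; case: nep; rewrite eTA eA.
Qed.

(** An element of order p in the intersection would lie in both A and B. So the intersection is
    abelian and centralizes a generator of [T x]. *)
Lemma Borels_meet A B : A \in tori p -> B \in tori p -> A != B ->
  x \in 'N_G(A) -> x \in 'N_G(B) -> 'N_G(A) :&: 'N_G(B) = T x.
Proof.
move=> tA tB nAB Ax Bx; have sTA := Borel_sub_T tA Ax; have sTB := Borel_sub_T tB Bx.
apply/eqP; rewrite eqEsubset subsetI sTA sTB !andbT.
have [u Gu [eA cA]] := toriP _ _ tA; have [v Gv [eB cB]] := toriP _ _ tB.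
pose M := ('N_G(A) :&: 'N_G(B))%G.
have pM : ~~ (p %| #|M|).
  apply/negP=> /(Cauchy p_prime)[w /setIP[Aw Bw] ow].
  have Gw : w \in G^# by rewrite !inE -order_gt1 ow prime_gt1 //; case/setIP: Aw.
  have cw : #|T w| = p by apply/eqP; rewrite -T_card_pE // ow.
  case/eqP: nAB; rewrite eA eB in Aw Bw *.
  have w1 : w != 1 by case/setD1P: Gw.
  exact: (T_meet Gu Gv (norm_T_p Gw Gu cA cw Aw) (norm_T_p Gw Gv cB cw Bw) w1).
have abM : abelian M.
  by apply: (Borel_p'_abelian Gu cA _ pM); rewrite -eA subsetIl.
have [t eT [Gt ot eTt]] := T_gen Gx.
have Mt : t \in M by rewrite inE !(subsetP sTA, subsetP sTB) // eT cycle_id.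
rewrite -eTt -(cent_semisimple Gt); last by rewrite ot cT; case: (k) k_ge3 => [|[|[|]]].
  apply/subsetP=> y My; rewrite inE; apply/andP; split; first by case/setIP: My => /setIP[].
  exact/cent1P/(centsP abM).
by rewrite eTt.
Qed.

Lemma split_Borels : exists A B, [/\ A != B, A \in tori p, B \in tori p &
  [set C in tori p | x \in 'N_G(C)] = [set A; B]].
Proof.
have /eqP h := ntori_p_split Gx cT; have [A [B [nAB e]]] := cards2P _ h.
exists A, B; split=> //.
  by have : A \in [set A; B]; [rewrite !inE eqxx | rewrite -e => /setIdP[]].
by have : B \in [set A; B]; [rewrite !inE eqxx orbT | rewrite -e => /setIdP[]].
Qed.

Lemma card_Borels_U (U : {set gT}) (n : nat) : T x \subset U ->
    (forall A, A \in tori p -> x \in 'N_G(A) -> #|'N_G(A) :\: U| = n) ->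
  #|U :|: \bigcup_(A in [set A in tori p | x \in 'N_G(A)]) 'N_G(A)| = (#|U| + 2 * n)%N.
Proof.
move=> sTU cU; have [A [B [nAB tA tB eAB]]] := split_Borels.
have /setIdP[_ Ax] : A \in [set C in tori p | x \in 'N_G(C)] by rewrite eAB set21.
have /setIdP[_ Bx] : B \in [set C in tori p | x \in 'N_G(C)] by rewrite eAB set22.
rewrite eAB bigcup_setU !big_set1.
have -> : U :|: ('N_G(A) :|: 'N_G(B)) = U :|: (('N_G(A) :\: U) :|: ('N_G(B) :\: U)).
  by apply/setP=> y; rewrite !in_setU !in_setD; case: (y \in U).
have d0 : U :&: (('N_G(A) :\: U) :|: ('N_G(B) :\: U)) = set0.
  by apply/setP=> y; rewrite in_setI in_setU !in_setD in_set0; case: (y \in U).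
have d1 : ('N_G(A) :\: U) :&: ('N_G(B) :\: U) = set0.
  apply/setP=> y; rewrite in_setI !in_setD in_set0; apply/negP.
  case/andP=> /andP[Uy Ay] /andP[_ By]; case/negP: Uy; apply: (subsetP sTU).
  by rewrite -(Borels_meet tA tB nAB Ax Bx) in_setI Ay.
by rewrite cardsU d0 cards0 subn0 cardsU d1 cards0 subn0 !cU // mul2n addnn.
Qed.

End SplitBorels.

Lemma card_Dset_split x : x \in G^# -> #|T x| = k -> #[x] != 2 -> #|Dset x| = (p * k.*2)%N.
Proof.
move=> Gx cT o2; have nep : #|T x| <> p by rewrite cT /p; lia.
rewrite Dset_ge3 // (@card_Borels_U x Gx cT _ (p * k - k)) ?T_subN //.
  by rewrite card_T_norm // cT /p; nia.
move=> A tA Ax; rewrite cardsD (setIC 'N_G(A)) (Borel_meet_T_norm Gx cT tA Ax) cT.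
by case/toriP: tA => u Gu [-> cu]; rewrite card_Borel.
Qed.

Lemma card_Dset_nonsplit x : x \in G^# -> #|T x| = k.+1 -> #[x] != 2 -> #|Dset x| = k.+1.*2.
Proof.
move=> Gx cT o2; have nep : #|T x| <> p by rewrite cT /p; lia.
rewrite Dset_ge3 //; have /eqP := ntori_p_nonsplit Gx cT.
by rewrite cards_eq0 => /eqP->; rewrite big_set0 setU0 card_T_norm // cT.
Qed.

(** * Solubilizers of involutions *)

Section InvolutionSol.

Variable x : gT.
Hypotheses (Gx : x \in G) (ox : #[x] = 2).

Let Gx1 : x \in G^#. Proof. exact: invG. Qed.
Let cTx : #|T x| = q. Proof. exact: inv_type. Qed.
Let nep : #|T x| <> p. Proof. exact: inv_nep. Qed.
Let xx : x * x = 1. Proof. by rewrite -(expgS x 1) -ox expg_order. Qed.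
Let xV : x^-1 = x. Proof. by apply/eqP; rewrite eq_invg_mul xx. Qed.
Let x1 : x != 1. Proof. by case/setD1P: Gx1. Qed.

(** If x and y normalize a torus of order prime to p, then x is in the torus and commutes with y, or
    both are outside and y is an involution, or only y is inside and x inverts it. *)
Definition Uset := [set y in G | [|| x * y == y * x, y * y == 1 | x * y * x == y^-1]].

(** For the converse inclusion, if x and y square to 1 they invert x y and normalize its torus; if x
    inverts y, it normalizes the torus of y. *)
Lemma Dset_inv : Dset x = Uset :|: \bigcup_(A in [set A in tori p | x \in 'N_G(A)]) 'N_G(A).
Proof.
apply/setP=> y; apply/DsetP/setUP => [[z Gz [Nx Ny]]|[|/bigcupP[A]]].
- have [cz|/eqP nepz] := eqVneq #|T z| p.
    right; apply/bigcupP; exists (T z) => //; rewrite inE Nx andbT.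
    by apply/toriP; exists z.
  left; have Gy : y \in G by case/setIP: Ny.
  rewrite inE Gy /=; have [Tx|Tx] := boolP (x \in T z).
    have eT := T_meet Gx1 Gz (memT Gx1) Tx x1.
    have : y \in 'C_G[x] by rewrite cent_inv // eT.
    by case/setIP=> _ /cent1P <-; rewrite eqxx.
  have Dx : x \in 'N_G(T z) :\: T z by rewrite inE Tx.
  have [Ty|Ty] := boolP (y \in T z).
    by have := T_invert Gz nepz Dx Ty; rewrite conjgE xV mulgA => ->; rewrite eqxx !orbT.
  have Dy : y \in 'N_G(T z) :\: T z by rewrite inE Ty.
  by rewrite -(expgS y 1) -(order_T_normD Gz nepz Dy) expg_order eqxx orbT.
- case/setIdP=> Gy /or3P[/eqP cxy|/eqP y2|/eqP e].
  + exists x; rewrite // T_inN ?memT // -cent_inv // inE Gy; split=> //.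
    exact/cent1P/commute_sym.
  + have [exy|xy1] := eqVneq (x * y) 1.
      exists x; rewrite // T_inN ?memT //; split=> //.
      have -> : y = x by rewrite -xV; apply/eqP; rewrite eq_sym eq_invg_mul exy.
      by rewrite T_inN ?memT.
    have Gz : x * y \in G^# by rewrite !inE xy1 groupM.
    have yV : y^-1 = y by apply/eqP; rewrite eq_invg_mul y2.
    have ezV : (x * y)^-1 = y * x by rewrite invMg xV yV.
    exists (x * y) => //; split; apply: (T_normP Gz _ (T_mem1 Gz)) => //.
      by rewrite conjgE xV !mulgA xx mul1g -ezV groupV memT.
    by rewrite conjgE yV -!mulgA y2 mulg1 -ezV groupV memT.
  have [->|y1] := eqVneq y 1.
    by exists x; rewrite // T_inN ?memT // group1.
  have Gz : y \in G^# by rewrite !inE y1.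
  exists y => //; split; last by apply: T_inN; rewrite ?memT.
  by apply: (T_normP Gz Gx (T_mem1 Gz)); rewrite conjgE xV mulgA e groupV memT.
by case/setIdP=> /toriP[z Gz [-> _]] Nx Ny; exists z.
Qed.

(** The excluded part is 16 out of 24 or 4 out of 12. *)
Lemma klein_Dset_inv (V : {group gT}) : V \in kleins -> x \in 'N_G(V) ->
  #|'N_G(V) :\: Dset x| = 8.
Proof.
move=> kV Vx; rewrite cardsD.
have -> : 'N_G(V) :&: Dset x =
    [set y in 'N_G(V) | [|| x * y == y * x, y * y == 1 | x * y * x == y^-1]].
  apply/setP=> y; apply/setIP/setIdP => -[Vy]; have Gy : y \in G by case/setIP: Vy.
    rewrite Dset_inv => /setUP[/setIdP[] //|/bigcupP[A]].
    case/setIdP=> /toriP[z Gz [-> cz]] Nx Ny; split=> //.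
    by rewrite (klein_Borel_commute kV Gz cz Vx Vy Nx Ny) eqxx.
  by move=> h; split=> //; rewrite Dset_inv inE inE Gy h.
rewrite card_klein_norm //; case: ifPn => q4.
  by rewrite (klein24_inv2 q4 kV Vx ox).
by rewrite (klein12_inv2 q4 kV Vx ox).
Qed.

Let I := [set y in G | y * y == 1].

Let cardI : #|I| = #|invols|.+1.
Proof.
rewrite (cardsD1 1 I) inE group1 mulg1 eqxx add1n; congr _.+1.
congr #|pred_of_set _|; apply/setP=> y; rewrite !inE order2E andbCA.
by congr (_ && _); rewrite andbC.
Qed.

Let C := 'C_G[x].

Let cardIC : #|I :&: C| = q.+2.
Proof.
have eC : C = 'N_G(T x) by rewrite /C cent_inv.
have -> : I :&: C = [set 1; x] :|: ('N_G(T x) :\: T x).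
  apply/setP=> y; apply/setIP/setUP => [[/setIdP[Gy y2] Cy]|].
    have [Ty|Ty] := boolP (y \in T x); last by right; rewrite inE Ty -eC.
    left; rewrite in_set2; have [//|y1 /=] := eqVneq y 1.
    apply/eqP; apply: (uniq_inv Gx1) => //; first exact: memT.
    by apply/eqP; rewrite order2E y2.
  case=> [/set2P[]->|Dy].
  - by rewrite inE group1 mulg1 eqxx group1.
  - by rewrite inE Gx xx eqxx inE Gx cent1id.
  case/setDP: (Dy) => Ny _; rewrite eC Ny inE; case/setIP: (Ny) => -> _.
  by rewrite -(expgS y 1) -(order_T_normD Gx1 nep Dy) expg_order eqxx.
have d0 : [set 1; x] :&: ('N_G(T x) :\: T x) = set0.
  apply/setP=> y; rewrite in_set0; apply/setIP => -[/set2P e /setDP[_]].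
  by case: e => ->; rewrite ?group1 ?memT.
rewrite cardsU d0 cards0 subn0; by rewrite cards2 eq_sym x1 card_T_normD // cTx.
Qed.

(** With J the involutions not commuting with x, the set is the disjoint union of C(x), J and x J,
    because x inverts y exactly when x y squares to 1. *)
Lemma card_Uset : #|Uset| = (2 * #|invols| - 2)%N.
Proof.
have q3 := q_ge4.
pose J := I :\: C; pose xJ := [set x * y | y in J].
have cJ : #|J| = (#|invols|.+1 - q.+2)%N by rewrite cardsD cardIC cardI.
have cxJ : #|xJ| = #|J| by rewrite card_imset //; apply: mulgI.
have leIC : q.+2 <= #|invols|.+1 by rewrite -cardIC -cardI subset_leq_card ?subsetIl.
have xC y : (x * y \in C) = (y \in C).
  by rewrite groupMl // inE Gx cent1id.
have inI y : y \in G -> (x * y \in I) = (x * y * x == y^-1).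
  move=> Gy; rewrite inE groupM //= -[RHS](inj_eq (mulIg y)) mulVg mulgA.
  by [].
have eU : Uset = C :|: (J :|: xJ).
  apply/setP=> y; apply/setIdP/setUP => [[Gy]|].
    have [Cy|Cy] := boolP (y \in C); first by left.
    case/or3P=> [/eqP cxy|y2|e].
    - by case/negP: Cy; rewrite inE Gy; apply/cent1P/commute_sym.
    - by right; rewrite !in_setU in_setD Cy inE Gy y2.
    right; apply/setUP; right; apply/imsetP; exists (x * y); last by rewrite mulgA xx mul1g.
    by rewrite in_setD xC Cy inI.
  case=> [/setIP[Gy /cent1P cxy]|/setUP[/setDP[/setIdP[Gy y2] _]|/imsetP[z /setDP[Iz _] ->]]].
  - by rewrite Gy cxy eqxx.
  - by rewrite Gy y2 orbT.
  have Gz : z \in G by case/setIdP: Iz.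
  rewrite groupM //; split=> //; rewrite -inI ?groupM // mulgA xx mul1g Iz.
  by rewrite !orbT.
have d0 : C :&: (J :|: xJ) = set0.
  apply/setP=> y; rewrite in_set0; apply/setIP => -[Cy /setUP[/setDP[_]|/imsetP[z /setDP[_ Cz] ey]]].
    by rewrite Cy.
  by rewrite ey xC (negPf Cz) in Cy.
have d1 : J :&: xJ = set0.
  apply/setP=> y; rewrite in_set0; apply/setIP => -[/setDP[/setIdP[Gy y2] Cy] /imsetP[z /setDP[/setIdP[Gz z2] Cz] ey]].
  case/negP: Cz; rewrite -xC -ey inE Gy; apply/cent1P.
  have yV : y^-1 = y by apply/eqP; rewrite eq_invg_mul y2.
  have zV : z^-1 = z by apply/eqP; rewrite eq_invg_mul z2.
  by rewrite /commute -{1}yV ey invMg zV xV -mulgA xx mulg1 mulgA xx mul1g.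
rewrite eU cardsU d0 cards0 subn0 cardsU d1 cards0 subn0 cxJ cJ card_cent_inv //.
by rewrite -mul2n; lia.
Qed.

(** The intersection with the Borel subgroup consists of [T x], A and x A, where [T x] shares only 1
    and x with the others: k + 2p - 2 elements. *)
Lemma card_Borel_Uset A : #|T x| = k -> A \in tori p -> x \in 'N_G(A) ->
  #|'N_G(A) :\: Uset| = (p * k - (k + 2 * p - 2))%N.
Proof.
move=> cT tA Ax; have [u Gu [eA cA]] := toriP _ _ tA.
have cB : #|'N_G(A)| = (p * k)%N by rewrite eA card_Borel.
have sTA := Borel_sub_T Gx1 cT tA Ax.
rewrite cardsD cB; congr (_ - _)%N.
have cAp : #|A| = p by rewrite eA.
have sAB : A \subset 'N_G(A) by rewrite subsetI normG eA TsubG.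
have neTA : T x <> T u by move=> e; case: nep; rewrite e.
have tiTA : T x :&: A = 1 by rewrite eA; apply: T_TI.
have xA : x \notin A.
  by apply/negP=> Ax'; have : x \in T x :&: A; [rewrite inE memT|rewrite tiTA inE (negPf x1)].
have oddA y : y \in A -> y * y = 1 -> y = 1.
  move=> Ay y2; apply/eqP; rewrite -order_eq1; have : #[y] %| #|A| by rewrite order_dvdG.
  have : #[y] %| 2 by rewrite order_dvdn -[y ^+ 2]/(y * y) y2.
  rewrite cAp dvdn_divisors // inE => /orP[//|]; rewrite inE => /eqP-> /=.
  by rewrite dvdn2 p_odd.
have nAx : x \in 'N(A) by case/setIP: Ax.
have defB : A * T x = 'N_G(A).
  by apply/eqP; rewrite eqEcard mul_subG //= cB TI_cardMg ?cAp ?cT // setIC.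
(* Here z = x y is outside A and z^2 is in A; were z^2 nontrivial, the torus of z would be A. *)
have invA y : y \in A -> (x * y) * (x * y) = 1.
  move=> Ay; pose z := x * y; have Az : z \notin A by rewrite groupMr.
  have Gz : z \in G^#.
    rewrite !inE; apply/andP; split; first by apply: contraNneq Az => ->.
    by rewrite groupM //; case/setIP: (subsetP sAB y Ay).
  have Az2 : z * z \in A.
    have -> : z * z = (x * y * x) * y by rewrite /z !mulgA.
    by rewrite groupM // -{1}xV -mulgA -conjgE memJ_norm.
  apply/eqP; apply: contraT => z2; case/negP: Az.
  rewrite eA -(@T_meet z u (z * z)) ?memT //; first by rewrite groupM ?memT.
  by rewrite -eA.
(* The component s of z in [T x] has its square in A, hence s = 1 or s = x. *)
have aux z : z \in 'N_G(A) -> z * z = 1 -> z = 1 \/ z \in x *: A.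
  rewrite -defB => /mulsgP[a s Aa Ts ->] e.
  have sA : s * a * s^-1 \in A.
    have : a ^ s^-1 \in A.
      by rewrite memJ_norm // groupV; have /setIP[] := subsetP sTA s Ts.
    by rewrite conjgE invgK mulgA.
  have s2A : s * s \in A.
    have e2 : (a * s) * (a * s) = (a * (s * a * s^-1)) * (s * s).
      by rewrite !mulgA mulgKV.
    by rewrite -(groupMl _ (groupM Aa sA)) -e2 e group1.
  have s2 : s * s = 1.
    have : s * s \in T x :&: A by rewrite inE s2A groupM.
    by rewrite tiTA inE => /eqP.
  have [s1|s1] := eqVneq s 1.
    by left; rewrite s1 !mulg1 in e *; apply: oddA.
  have os : #[s] = 2 by apply/eqP; rewrite order2E s2 eqxx.
  right; rewrite (uniq_inv Gx1 Ts (memT Gx1) os ox) conjgC mem_lcoset mulKg.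
  by rewrite memJ_norm.
have -> : 'N_G(A) :&: Uset = T x :|: (A :|: x *: A).
  apply/setP=> y; apply/setIP/setUP => [[Ny /setIdP[Gy]]|].
    case/or3P=> [/eqP cxy|/eqP y2|/eqP e].
    - left; rewrite -(Borel_meet_T_norm Gx1 cT tA Ax) in_setI Ny andbT.
      by rewrite -cent_inv // inE Gy; apply/cent1P/commute_sym.
    - have [->|xAy] := aux y Ny y2; first by left; rewrite group1.
      by right; rewrite in_setU xAy orbT.
    have [|xy1|] := aux (x * y) (groupM Ax Ny); first by rewrite mulgA e mulVg.
      by left; rewrite -(mulKg x y) xy1 mulg1 groupV memT.
    by rewrite mem_lcoset mulKg => Ay; right; rewrite in_setU Ay.
  case=> [Ty|/setUP[Ay|]].
  - have Ny := subsetP sTA y Ty; rewrite Ny; split=> //; rewrite inE.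
    rewrite (centsP (T_abelian Gx1) x (memT Gx1) y Ty) eqxx andbT.
    by case/setIP: Ny.
  - have Ny := subsetP sAB y Ay; rewrite Ny; split=> //; rewrite inE.
    have Gy : y \in G by case/setIP: Ny.
    by rewrite Gy -[x * y * x == _](inj_eq (mulIg y)) mulVg -mulgA invA // eqxx !orbT.
  rewrite mem_lcoset xV => Axy; have Nxy := subsetP sAB _ Axy.
  have Ny : y \in 'N_G(A) by rewrite -(groupMl _ Ax).
  split=> //; rewrite inE; have := invA _ Axy.
  rewrite (_ : x * (x * y) = y) => [->|]; last by rewrite mulgA xx mul1g.
  rewrite eqxx orbT andbT.
  by case/setIP: Ny.
have eT : T x :&: (A :|: x *: A) = [set 1; x].
  apply/setP=> y; rewrite in_set2; apply/setIP/orP => [[Ty /setUP[Ay|]]|[]/eqP->].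
  - by left; have : y \in T x :&: A; [rewrite inE Ty|rewrite tiTA inE].
  - rewrite mem_lcoset => Axy; right; have : x^-1 * y \in T x :&: A.
      by rewrite inE Axy groupM // groupV memT.
    by rewrite tiTA inE -eq_mulVg1 eq_sym.
  - by rewrite group1 inE group1.
  by rewrite memT // in_setU mem_lcoset mulVg group1 orbT.
have eA2 : A :&: (x *: A) = set0.
  apply/setP=> y; rewrite in_set0; apply/setIP; rewrite mem_lcoset => -[Ay Axy].
  by case/negP: xA; move: Axy; rewrite groupMr // groupV.
rewrite cardsU eT cardsU eA2 cards0 subn0 card_lcoset cAp cT cards2 eq_sym x1.
by rewrite mul2n addnn.
Qed.

End InvolutionSol.

(** * Counts and solubilizer sizes by the order of x *)

Lemma nklein0 x : x \in G^# -> ~~ separate_order p #[x] -> nklein x = 0.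
Proof.
move=> Gx nsep; apply/eqP; rewrite cards_eq0; apply/eqP/setP=> V; rewrite in_set0.
apply/setIdP => -[kV Vx]; have x1 : x != 1 by case/setD1P: Gx.
(* Nonidentity elements of ['N_G(V)] have order 2, 3 or 4, the last only if 4 divides q. *)
have := klein_norm_order_in kV Vx x1; move: nsep.
rewrite /separate_order mod8_q !inE !negb_or negb_and => /and3P[/negPf-> /negPf->].
case/orP=> [q4|/negPf->] //= /eqP o4.
have := card_klein12_order q4 kV 4; rewrite /= => /eqP; rewrite cards_eq0 => /eqP/setP/(_ x).
by rewrite in_set0 in_setI Vx inE (TG Gx) o4.
Qed.

Lemma nklein0_mem x (V : {group gT}) : nklein x = 0 -> V \in kleins -> x \in 'N_G(V) -> False.
Proof.
move=> /eqP; rewrite cards_eq0 => /eqP/setP/(_ V) h kV Vx.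
by move: h; rewrite in_set0 inE kV Vx.
Qed.

(** The quadruple (b, d_-, d_+, e) in terms of normalized tori and four-groups. *)
Definition counts x := (ntori p x, ntori k x, ntori k.+1 x, nklein x).

Lemma p_not_separate : ~~ separate_order p p.
Proof. by have := p_gt6; rewrite /separate_order !negb_or negb_and; lia. Qed.

Lemma row_p x : x \in G^# -> #[x] = p ->
  counts x = (1, 0, 0, 0)%N /\ #|Sol G x| = (p * k)%N.
Proof.
move=> Gx ox; have cT : #|T x| = p by apply/eqP; rewrite -T_card_pE // ox.
have o2 : #[x] != 2 by rewrite ox; have := p_gt6; lia.
have nk : nklein x = 0 by apply: nklein0; rewrite // ox p_not_separate.
split.
  rewrite /counts ntori_p_p // nk !ntori_ge3 ?cT //; try by rewrite /p; lia.
  have -> : (p == k) = false by rewrite /p; lia.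
  by have -> : (p == k.+1) = false by rewrite /p; lia.
rewrite (@card_Sol x 0) ?nk ?addn0 ?Dset_p ?card_Borel //.
by move=> V kV Vx; case: (nklein0_mem nk kV Vx).
Qed.

Lemma counts_ge3 x : x \in G^# -> #|T x| <> p -> #[x] != 2 ->
  counts x = (if #|T x| == k then 2 else 0, #|T x| == k : nat, #|T x| == k.+1 : nat, nklein x)%N /\
  #|Dset x| = (if #|T x| == k then p * k.*2 else k.+1.*2)%N.
Proof.
move=> Gx nep o2; have kp : k <> p by rewrite /p; lia.
have k1p : k.+1 <> p by rewrite /p; lia.
rewrite /counts (ntori_ge3 Gx kp o2) (ntori_ge3 Gx k1p o2).
have [cT|cT] := eqVneq #|T x| k; first by rewrite ntori_p_split // card_Dset_split.
have cT1 : #|T x| = k.+1.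
  by case: (ts_card tsG Gx) cT => [/nep//|->|->//]; rewrite eqxx.
by rewrite ntori_p_nonsplit // card_Dset_nonsplit.
Qed.

Lemma row_generic x : x \in G^# -> #|T x| <> p -> ~~ separate_order p #[x] ->
  counts x = (if #|T x| == k then 2 else 0, #|T x| == k : nat, #|T x| == k.+1 : nat, 0)%N /\
  #|Sol G x| = (if #|T x| == k then p * k.*2 else k.+1.*2)%N.
Proof.
move=> Gx nep nsep; have nk := nklein0 Gx nsep.
have o2 : #[x] != 2 by case/norP: nsep.
have [-> eD] := counts_ge3 Gx nep o2; rewrite nk; split=> //.
rewrite (@card_Sol x 0) ?nk ?addn0 //.
by move=> V kV Vx; case: (nklein0_mem nk kV Vx).
Qed.

(** Each normalizer of a four-group has eight elements of order 3, and 24 - 6 or 12 - 3 of its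
    elements are outside [Dset x]. *)
Lemma row3 x : x \in G^# -> #|T x| <> p -> #[x] = 3 ->
  (3 * nklein x = 2 * #|T x|)%N /\
  #|Sol G x| = (#|Dset x| + nklein x * (if 4 %| q then 18 else 9))%N.
Proof.
move=> Gx nep ox; split.
  have /= := @nklein_mul x 8 Gx nep; rewrite ox.
  have cV (V : {group gT}) : V \in kleins -> #|'N_G(V) :&: [set y in G | #[y] == 3]| = 8.
    by move=> kV; have [q4|q4] := boolP (4 %| q)%N; [rewrite (card_klein24_order q4 kV)|rewrite (card_klein12_order q4 kV)].
  by move/(_ cV); rewrite -[totient 3]/2; lia.
apply: card_Sol => // V kV Vx; rewrite klein_Dset_ge3 ?ox //.
rewrite card_klein_norm //; case: ifPn => q4.
  by rewrite (klein24_conj q4 kV Vx) ?ox.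
by rewrite (klein12_conj3 q4 kV Vx ox).
Qed.

Lemma row4 x : (4 %| q)%N -> x \in G^# -> #|T x| <> p -> #[x] = 4 ->
  (2 * nklein x = #|T x|)%N /\ #|Sol G x| = (#|Dset x| + nklein x * 16)%N.
Proof.
move=> q4 Gx nep ox; split.
  have /= := @nklein_mul x 6 Gx nep; rewrite ox.
  have cV (V : {group gT}) : V \in kleins -> #|'N_G(V) :&: [set y in G | #[y] == 4]| = 6.
    by move=> kV; rewrite card_klein24_order.
  by move/(_ cV); rewrite -[totient 4]/2; lia.
apply: card_Sol => // V kV Vx; rewrite klein_Dset_ge3 ?ox //.
by rewrite card_klein_norm // q4 (klein24_conj q4 kV Vx) ?ox.
Qed.

(** There are p k involutions for k odd and p (k + 1) for k even; only for k even does x lie in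
    Borel subgroups, namely two. *)
Lemma row2 x : x \in G -> #[x] = 2 ->
  [/\ counts x = (if odd k then 0 else 2, q + (k == q), q + (k.+1 == q), nklein x)%N,
      (6 * nklein x = q * (if 4 %| q then 9 else 3))%N &
      #|Sol G x| = ((if odd k then 2 * (p * k) - 2
        else 2 * (p * k.+1) - 2 + 2 * (p * k - (k + 2 * p - 2))) + nklein x * 8)%N].
Proof.
move=> Gx ox; have Gx1 := invG Gx ox; have nep := inv_nep Gx1 ox.
have cT : #|T x| = q by rewrite inv_type.
have i0 : 0 < q by have := q_ge4; case: (q).
have cI : (#|invols| * q = p * (k * k.+1))%N.
  apply/eqP; rewrite -(eqn_pmul2l (ltn0Sn 1)); apply/eqP.
  by have := card_invols; rewrite (ts_order tsG) -muln2; lia.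
split.
- rewrite /counts (ntori_inv (or_introl erefl) Gx ox) (ntori_inv (or_intror erefl) Gx ox).
  congr (_, _, _, _).
  case: ifP => ok; first by rewrite ntori_p_nonsplit // cT /q ok.
  by rewrite ntori_p_split // cT /q ok.
- have /= := @nklein_mul x (if 4 %| q then 9 else 3)%N Gx1 nep; rewrite ox cT.
  have cV (V : {group gT}) : V \in kleins -> #|'N_G(V) :&: [set y in G | #[y] == 2]| = (if 4 %| q then 9 else 3)%N.
    by move=> kV; case: ifPn => q4; [rewrite (card_klein24_order q4 kV)|rewrite (card_klein12_order q4 kV)].
  by move/(_ cV); rewrite -[totient 2]/1%N muln1.
rewrite (@card_Sol x 8 Gx1); last by move=> V; apply: klein_Dset_inv.
congr (_ + _)%N; rewrite Dset_inv //; case: ifP => ok.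
  have cT1 : #|T x| = k.+1 by rewrite cT /q ok.
  have /eqP := ntori_p_nonsplit Gx1 cT1; rewrite cards_eq0 => /eqP->.
  rewrite big_set0 setU0 card_Uset //; congr (_ * _ - _)%N.
  by apply/eqP; rewrite -(eqn_pmul2r i0) cI /q ok mulnA.
have cT1 : #|T x| = k by rewrite cT /q ok.
have sTU : T x \subset Uset x.
  apply/subsetP=> y Ty; rewrite inE (subsetP (TsubG Gx1)) //=.
  by rewrite (centsP (T_abelian Gx1) x (memT Gx1) y Ty) eqxx.
rewrite (card_Borels_U Gx1 cT1 sTU (fun A => @card_Borel_Uset x Gx ox A cT1)).
rewrite card_Uset //; congr (_ * _ - _ + _)%N.
by apply/eqP; rewrite -(eqn_pmul2r i0) cI /q ok mulnA mulnAC.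
Qed.

End TorusSystem.

(** * The rows of the classification in terms of k *)

Section Rows.

Local Open Scope nat_scope.

Variables (gT : finGroupType) (G : {group gT}) (k : nat) (T : gT -> {group gT}).
Let p := k.*2.+1.
Hypotheses (tsG : torus_system G k T) (p_prime : prime p) (k_ge3 : 2 < k).
Hypothesis n5G : ~~ (5 %| #|G|)%N.
Implicit Type x : gT.

Definition is_row x c s := counts G k T x = c /\ #|Sol G x| = s.

Let ord_p x n : #[x] = n -> n < 5 -> x \in G^# -> #|T x| <> p.
Proof.
move=> ox n5 Gx cT; have := T_card_pE tsG p_prime k_ge3 Gx.
by rewrite cT eqxx ox /p; lia.
Qed.

Lemma torus_card_cases x : x \in G^# -> #[x] != p -> #|T x| = k \/ #|T x| = k.+1.
Proof.
move=> Gx; rewrite (T_card_pE tsG) // => /eqP nep.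
by case: (ts_card tsG Gx) => [/nep[]|h|h]; [left | right].
Qed.

Lemma row2_even x : x \in G^# -> #[x] = 2 -> ~~ odd k ->
  is_row x (2, k.+1, k, (if 4 %| k then 3 * k else k) %/ 2)
    (k.*2 * (if 4 %| k then 2 * p + 3 else 2 * p - 1)).
Proof.
move=> /setD1P[_ Gx] ox ok; have [ec eN es] := row2 tsG p_prime k_ge3 n5G Gx ox.
rewrite /is_row ec es; move: eN; rewrite /q (negPf ok) eqxx -/p; move: (nklein G x) => N eN.
split; first by congr (_, _, _, _); case: ifP eN; lia.
by case: ifP eN; rewrite /p; nia.
Qed.

Lemma row2_odd x : x \in G^# -> #[x] = 2 -> odd k ->
  is_row x (0, k.+1, k.+2, (if 4 %| k.+1 then 3 * k.+1 else k.+1) %/ 2)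
    (if 4 %| k.+1 then k.+1.*2 * (p + 4) else p * k.+1.*2).
Proof.
move=> /setD1P[_ Gx] ox ok; have [ec eN es] := row2 tsG p_prime k_ge3 n5G Gx ox.
rewrite /is_row ec es; move: eN; rewrite /q ok eqxx -/p; move: (nklein G x) => N eN.
split; first by congr (_, _, _, _); case: ifP eN; lia.
by case: ifP eN; rewrite /p; nia.
Qed.

Lemma row3_split x : x \in G^# -> #[x] = 3 -> 3 %| k ->
  is_row x (2, 1, 0, k.*2 %/ 3) (k.*2 * (if 4 %| q k then p + 6 else p + 3)).
Proof.
move=> Gx ox k3; have nep := ord_p ox isT Gx; have [||] := torus_card_cases Gx; first by rewrite ox /p; lia.
  move=> cT; have [eN es] := row3 tsG p_prime k_ge3 n5G Gx nep ox.
  have [|ec ed] := counts_ge3 tsG p_prime k_ge3 n5G Gx nep; first by rewrite ox.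
  rewrite /is_row ec es ed cT eqxx (_ : (k == k.+1) = false); last by lia.
  rewrite cT in eN; move: (nklein G x) eN => N eN.
  split; first by congr (_, _, _, _); lia.
  by case: ifP; rewrite -/p; nia.
move=> cT; have := T_order_dvd tsG Gx; rewrite ox cT; lia.
Qed.

Lemma row3_nonsplit x : x \in G^# -> #[x] = 3 -> 3 %| k.+1 ->
  is_row x (0, 0, 1, k.+1.*2 %/ 3) (if 4 %| q k then 7 * k.+1.*2 else 4 * k.+1.*2).
Proof.
move=> Gx ox k3; have nep := ord_p ox isT Gx; have [||] := torus_card_cases Gx; first by rewrite ox /p; lia.
  move=> cT; have := T_order_dvd tsG Gx; rewrite ox cT; lia.
move=> cT; have [eN es] := row3 tsG p_prime k_ge3 n5G Gx nep ox.
have [|ec ed] := counts_ge3 tsG p_prime k_ge3 n5G Gx nep; first by rewrite ox.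
rewrite /is_row ec es ed cT eqxx (_ : (k.+1 == k) = false); last by lia.
rewrite cT in eN; move: (nklein G x) eN => N eN.
split; first by congr (_, _, _, _); lia.
by case: ifP; rewrite -/p; nia.
Qed.

Lemma row4_split x : x \in G^# -> #[x] = 4 -> 4 %| k ->
  is_row x (2, 1, 0, k.*2 %/ 4) (k.*2 * (p + 4)).
Proof.
move=> Gx ox k4; have nep := ord_p ox isT Gx; have [||] := torus_card_cases Gx; first by rewrite ox /p; lia.
  have q4 : 4 %| q k by rewrite /q (_ : odd k = false); lia.
  move=> cT; have [eN es] := row4 tsG p_prime k_ge3 n5G q4 Gx nep ox.
  have [|ec ed] := counts_ge3 tsG p_prime k_ge3 n5G Gx nep; first by rewrite ox.
  rewrite /is_row ec es ed cT eqxx (_ : (k == k.+1) = false); last by lia.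
  rewrite cT in eN; move: (nklein G x) eN => N eN.
  split; first by congr (_, _, _, _); lia.
  by rewrite -/p; nia.
move=> cT; have := T_order_dvd tsG Gx; rewrite ox cT; lia.
Qed.

Lemma row4_nonsplit x : x \in G^# -> #[x] = 4 -> 4 %| k.+1 ->
  is_row x (0, 0, 1, k.+1.*2 %/ 4) (5 * k.+1.*2).
Proof.
move=> Gx ox k4; have nep := ord_p ox isT Gx; have [||] := torus_card_cases Gx; first by rewrite ox /p; lia.
  move=> cT; have := T_order_dvd tsG Gx; rewrite ox cT; lia.
have q4 : 4 %| q k by rewrite /q (_ : odd k = true); lia.
move=> cT; have [eN es] := row4 tsG p_prime k_ge3 n5G q4 Gx nep ox.
have [|ec ed] := counts_ge3 tsG p_prime k_ge3 n5G Gx nep; first by rewrite ox.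
rewrite /is_row ec es ed cT eqxx (_ : (k.+1 == k) = false); last by lia.
rewrite cT in eN; move: (nklein G x) eN => N eN.
split; first by congr (_, _, _, _); lia.
by rewrite -/p; nia.
Qed.

Lemma row_split x : x \in G^# -> #[x] %| k.*2 -> ~~ separate_order p #[x] ->
  is_row x (2, 1, 0, 0) (p * k.*2).
Proof.
move=> Gx ok sep; have x1 : 1 < #[x] by rewrite order_gt1; case/setD1P: Gx.
have ox2 : #[x] != 2 by apply: contra sep => /eqP ->.
have oxp : #[x] != p by apply: contraL ok => /eqP ->; rewrite gtnNdvd // /p; lia.
have nep : #|T x| <> p by apply/eqP; rewrite -(T_card_pE tsG).
have [ec es] := row_generic tsG p_prime k_ge3 n5G Gx nep sep; rewrite /is_row ec es.
have [//|cT|cT] := torus_card_cases Gx; rewrite cT ?eqxx.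
  by rewrite (_ : (k == k.+1) = false) //; lia.
have := T_order_dvd tsG Gx; rewrite cT => d1.
(* The order divides 2 (k + 1) and 2 k, hence their difference. *)
have : #[x] %| 2.
  have -> : 2 = k.+1.*2 - k.*2 by lia.
  by rewrite dvdn_sub // -mul2n dvdn_mull.
by move/(@dvdn_leq _ 2 isT) => x2; case/negP: ox2; lia.
Qed.

Lemma row_nonsplit x : x \in G^# -> #[x] %| k.+1.*2 -> ~~ separate_order p #[x] ->
  is_row x (0, 0, 1, 0) k.+1.*2.
Proof.
move=> Gx ok sep; have x1 : 1 < #[x] by rewrite order_gt1; case/setD1P: Gx.
have ox2 : #[x] != 2 by apply: contra sep => /eqP ->.
have oxp : #[x] != p.
  apply: contraL ok => /eqP ->; rewrite (_ : k.+1.*2 = p + 1) /p; last by lia.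
  by rewrite dvdn_addr // gtnNdvd //; lia.
have nep : #|T x| <> p by apply/eqP; rewrite -(T_card_pE tsG).
have [ec es] := row_generic tsG p_prime k_ge3 n5G Gx nep sep; rewrite /is_row ec es.
have [//|cT|cT] := torus_card_cases Gx; rewrite cT ?eqxx; last first.
  by rewrite (_ : (k.+1 == k) = false) //; lia.
have := T_order_dvd tsG Gx; rewrite cT => d1.
have : #[x] %| 2.
  have -> : 2 = k.+1.*2 - k.*2 by lia.
  by rewrite dvdn_sub // -[k.*2]mul2n dvdn_mull.
by move/(@dvdn_leq _ 2 isT) => x2; case/negP: ox2; lia.
Qed.

End Rows.

(** * Two by two matrices *)

Section TwoByTwo.

Import GRing.Theory.
Local Open Scope ring_scope.

Variable F : fieldType.
Implicit Types A B C P : 'M[F]_2.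

Definition mx2 (a b c d : F) : 'M[F]_2 :=
  \matrix_(i, j) (if i == 0 then if j == 0 then a else b else if j == 0 then c else d).

Lemma mx2E a b c d : (mx2 a b c d 0 0 = a) * (mx2 a b c d 0 1 = b) *
  (mx2 a b c d 1 0 = c) * (mx2 a b c d 1 1 = d).
Proof. by rewrite !mxE. Qed.

Lemma mx2P A B : A 0 0 = B 0 0 -> A 0 1 = B 0 1 -> A 1 0 = B 1 0 -> A 1 1 = B 1 1 -> A = B.
Proof.
move=> e00 e01 e10 e11; apply/matrixP=> i j.
have ord2 (l : 'I_2) : l = 0 \/ l = 1.
  by case: l => [[|[|l]] lt] //; [left|right]; apply: val_inj.
by case: (ord2 i) => ->; case: (ord2 j) => ->.
Qed.

Lemma mul2E A B i j : (A *m B) i j = A i 0 * B 0 j + A i 1 * B 1 j.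
Proof. by rewrite mxE !big_ord_recl big_ord0 addr0; congr (_ + A i _ * B _ j); apply: val_inj. Qed.

Lemma det2E A : \det A = A 0 0 * A 1 1 - A 0 1 * A 1 0.
Proof.
rewrite (expand_det_row _ 0) !big_ord_recl big_ord0 addr0 /cofactor /= !det_mx11 !mxE /=.
rewrite expr0 expr1 mul1r mulN1r mulrN; congr (_ * A _ _ - A _ _ * A _ _); exact: val_inj.
Qed.

Lemma tr2E A : \tr A = A 0 0 + A 1 1.
Proof. by rewrite /mxtrace !big_ord_recl big_ord0 addr0; congr (_ + A _ _); apply: val_inj. Qed.

Lemma scal2E a b A i j : (a%:M + b *: A) i j = a *+ (i == j) + b * A i j.
Proof. by rewrite !mxE. Qed.

Lemma scalar2P A : reflect [/\ A 0 1 = 0, A 1 0 = 0 & A 0 0 = A 1 1] (is_scalar_mx A).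
Proof.
apply: (iffP is_scalar_mxP) => [[a ->]|[e01 e10 e]]; first by rewrite !mxE.
by exists (A 0 0); apply: mx2P; rewrite !mxE //= ?e01 ?e10 ?e.
Qed.

(** The coefficient b is a quotient by whichever of A 0 1, A 1 0 and A 0 0 - A 1 1 is nonzero. *)
Lemma comm2P A B : ~~ is_scalar_mx A -> A *m B = B *m A ->
  exists a b, B = a%:M + b *: A.
Proof.
move=> nsA /matrixP e; have e00 := e 0 0; have e01 := e 0 1; have e10 := e 1 0.
rewrite !mul2E in e00 e01 e10.
have [b0|b0] := eqVneq (A 0 1) 0; last first.
  have eC : B 1 0 = B 0 1 * A 1 0 / A 0 1.
    by apply: (canRL (mulfK b0)); rewrite [LHS]mulrC; apply: (addrI (A 0 0 * B 0 0)); rewrite e00; ring.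
  have eD : B 1 1 = (B 0 0 * A 0 1 + B 0 1 * (A 1 1 - A 0 0)) / A 0 1.
    by apply: (canRL (mulfK b0)); apply: (addrI (A 0 0 * B 0 1)); rewrite [B 1 1 * _]mulrC e01; ring.
  exists (B 0 0 - B 0 1 / A 0 1 * A 0 0), (B 0 1 / A 0 1).
  by apply: mx2P; rewrite scal2E /= ?mulr1n ?mulr0n ?eC ?eD; field.
rewrite b0 in e00 e01.
have [c0|c0] := eqVneq (A 1 0) 0; last first.
  have eC : B 0 1 = 0.
    by apply: (mulIf c0); rewrite mul0r; apply: (addrI (B 0 0 * A 0 0)); rewrite -e00; ring.
  have eD : B 1 1 = (B 0 0 * A 1 0 + B 1 0 * (A 1 1 - A 0 0)) / A 1 0.
    by apply: (canRL (mulfK c0)); apply: (addrI (B 1 0 * A 0 0)); rewrite -e10; ring.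
  exists (B 0 0 - B 1 0 / A 1 0 * A 0 0), (B 1 0 / A 1 0).
  by apply: mx2P; rewrite scal2E /= ?mulr1n ?mulr0n ?eC ?eD ?b0; field.
rewrite c0 in e10.
have d0 : A 0 0 - A 1 1 != 0.
  by rewrite subr_eq0; apply: contra nsA => /eqP d0; apply/scalar2P.
have eB : B 0 1 = 0.
  by apply: (mulIf d0); rewrite mul0r; apply: (addrI (B 0 1 * A 1 1)); rewrite addr0 -[RHS](addr0) -[in RHS](mulr0 (B 0 0)) [RHS]addrC -e01; ring.
have eC : B 1 0 = 0.
  by apply: (mulIf d0); rewrite mul0r; apply: (addrI (A 1 1 * B 1 0)); have := e10; rewrite !mul0r add0r mulr0 addr0 => h; rewrite [in LHS]h; ring: h.
exists (B 0 0 - (B 0 0 - B 1 1) / (A 0 0 - A 1 1) * A 0 0), ((B 0 0 - B 1 1) / (A 0 0 - A 1 1)).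
by apply: mx2P; rewrite scal2E /= ?mulr1n ?mulr0n ?eC ?eB ?b0 ?c0; field.
Qed.

Lemma comm2_trans A B C : ~~ is_scalar_mx A -> A *m B = B *m A -> A *m C = C *m A ->
  B *m C = C *m B.
Proof.
move=> nsA /(comm2P nsA)[a [b ->]] /(comm2P nsA)[c [d ->]].
by apply: mx2P; rewrite !mul2E !scal2E /=; ring.
Qed.

Lemma char2E A : A *m A = \tr A *: A - (\det A)%:M.
Proof. by apply: mx2P; rewrite mul2E !mxE tr2E det2E /= ?mulr1n ?mulr0n; ring. Qed.

Lemma det_scal2E a b A : \det (a%:M + b *: A) = a ^+ 2 + a * b * \tr A + b ^+ 2 * \det A.
Proof. by rewrite !det2E tr2E !scal2E /= ?mulr1n ?mulr0n; ring. Qed.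

Lemma tr_scal2E a b A : \tr (a%:M + b *: A) = a *+ 2 + b * \tr A.
Proof. by rewrite !tr2E !scal2E /= ?mulr1n; ring. Qed.

(** The discriminant of the characteristic polynomial; being zero, a nonzero square or a nonsquare
    distinguishes the three kinds of tori. *)
Definition disc A : F := \tr A ^+ 2 - \det A *+ 4.

Lemma discE A : disc A = (A 1 1 - A 0 0) ^+ 2 + A 0 1 * A 1 0 *+ 4.
Proof. by rewrite /disc tr2E det2E; ring. Qed.

Lemma disc_scal2E a b A : disc (a%:M + b *: A) = b ^+ 2 * disc A.
Proof. by rewrite /disc det_scal2E tr_scal2E; ring. Qed.

Lemma disc_nonscalar A : disc A != 0 -> ~~ is_scalar_mx A.
Proof.
apply: contra => /scalar2P[e01 e10 e]; rewrite discE e01 e; apply/eqP; ring.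
Qed.

(* The conjugating matrix has rows w and w A, where w = (x, y). *)
Lemma companion2 A x y :
    A 0 1 * x ^+ 2 + (A 1 1 - A 0 0) * x * y - A 1 0 * y ^+ 2 = 1 ->
  exists2 P, \det P = 1 & P *m A = mx2 0 1 (- \det A) (\tr A) *m P.
Proof.
move=> e; exists (mx2 x y (x * A 0 0 + y * A 1 0) (x * A 0 1 + y * A 1 1)).
  by rewrite -e det2E !mx2E; ring.
by apply: mx2P; rewrite !mul2E !mx2E ?det2E ?tr2E; ring.
Qed.

Lemma scal2_inj A a b c d : ~~ is_scalar_mx A ->
  a%:M + b *: A = c%:M + d *: A -> a = c /\ b = d.
Proof.
move=> nsA /matrixP e; have e00 := e 0 0; have e01 := e 0 1; have e10 := e 1 0; have e11 := e 1 1.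
rewrite !scal2E /= ?mulr1n ?mulr0n ?add0r in e00 e01 e10 e11.
have ebd : b = d.
  have [b0|b0] := eqVneq (A 0 1) 0; last exact: (mulIf b0).
  have [c0|c0] := eqVneq (A 1 0) 0; last exact: (mulIf c0).
  have d0 : A 0 0 - A 1 1 != 0.
    by rewrite subr_eq0; apply: contra nsA => /eqP d0; apply/scalar2P.
  apply: (mulIf d0); rewrite !mulrBr.
  have -> : b * A 0 0 = c + d * A 0 0 - a by rewrite -e00 addrC addKr.
  have -> : b * A 1 1 = c + d * A 1 1 - a by rewrite -e11 addrC addKr.
  by ring.
by split=> //; move: e00; rewrite ebd => /addIr.
Qed.

End TwoByTwo.

(** * Squares and quadratic equations over a finite field *)

Section FiniteField.

Import GRing.Theory.
Local Open Scope ring_scope.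

Variable F : finFieldType.
Hypothesis two_neq0 : (2 : F) != 0.

Definition squares : {set F} := [set x ^+ 2 | x in F].

Lemma card_squares : (#|F| < 2 * #|squares|)%N.
Proof.
have S0 : 0 \in squares by apply/imsetP; exists 0; rewrite ?expr0n.
have -> : #|F| = (\sum_(s in squares) \sum_(x in F | x ^+ 2 == s) 1)%N.
  by rewrite -sum1_card (partition_big_imset (fun x => x ^+ 2)).
rewrite (big_setD1 0) //= (cardsD1 0 squares) S0 mulnDr muln1 addnC.
have -> : (\sum_(x in F | x ^+ 2 == 0%R) 1 = 1)%N.
  rewrite sum1dep_card -(cards1 (0 : F)); congr #|pred_of_set _|.
  by apply/setP=> x; rewrite !inE expf_eq0.
rewrite addn1 add2n ltnS ltnS mulnC -sum_nat_const; apply: leq_sum => s /setD1P[_ /imsetP[x0 _ ->]].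
rewrite sum1dep_card; apply: leq_trans (_ : #|[set x0; - x0]| <= 2)%N; last by rewrite cards2; case: (_ != _).
by apply/subset_leq_card/subsetP=> x; rewrite !inE /= eqf_sqr.
Qed.

Lemma sets_meet (X Y : {set F}) : (#|F| < #|X| + #|Y|)%N -> exists2 z, z \in X & z \in Y.
Proof.
rewrite -cardsUI => h; have : (0 < #|X :&: Y|)%N.
  by rewrite lt0n; apply: contraTneq h => ->; rewrite addn0 -leqNgt max_card.
by case/card_gt0P=> z /setIP[]; exists z.
Qed.

(** The values x^2 and the values N + D y^2 each fill more than half of the field. *)
Lemma represent_norm D N : D != 0 -> exists x y : F, x ^+ 2 - D * y ^+ 2 = N.
Proof.
move=> D0; have inj : injective (fun s : F => N + D * s) by move=> s t /addrI/(mulfI D0).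
have [|z /imsetP[x _ ez] /imsetP[_ /imsetP[y _ ->] e]] :=
  @sets_meet squares [set N + D * s | s in squares].
  by rewrite (card_imset _ inj) addnn -mul2n card_squares.
by exists x, y; rewrite -ez e addrK.
Qed.

(** Completing the square: 4 a times the form is (2 a x + b y)^2 - D y^2 with D = b^2 - 4 a c. *)
Lemma represent1 (a b c : F) : b ^+ 2 - a * c *+ 4 != 0 ->
  exists x y, a * x ^+ 2 + b * x * y + c * y ^+ 2 = 1.
Proof.
move=> D0; have [a0|a0] := eqVneq a 0.
  have b0 : b != 0.
    by apply: contraNneq D0 => ->; rewrite a0; apply/eqP; ring.
  by exists ((1 - c) / b), 1; rewrite a0; field.
have [X [y e]] := represent_norm (a *+ 4) D0.
exists ((X - b * y) / (a *+ 2)), y.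
have a2 : a *+ 2 != 0 by rewrite -mulr_natl mulf_neq0.
apply: (mulfI a2); apply: (mulfI two_neq0).
have eX : X ^+ 2 = a *+ 4 + (b ^+ 2 - a * c *+ 4) * y ^+ 2 by rewrite -e; ring.
by field: eX; rewrite two_neq0 a0.
Qed.

(** The squares, D times and E times the nonzero squares are together too many to be disjoint. *)
Lemma nonsquare_ratio (D E : F) : D \notin squares -> E \notin squares ->
  exists2 s, s != 0 & D = s ^+ 2 * E.
Proof.
move=> nD nE; have S0 : 0 \in squares by apply/imsetP; exists 0; rewrite ?expr0n.
have nz z : z \notin squares -> z != 0 by apply: contraNneq => ->.
have D0 := nz D nD; have E0 := nz E nE.
have h := card_squares.
pose S1 := squares :\ 0.
have cS : #|squares| = #|S1|.+1 by rewrite (cardsD1 0 squares) S0.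
pose X z := [set z * s | s in S1].
have cX z : z != 0 -> #|X z| = #|S1| by move=> z0; rewrite (card_imset _ (mulfI z0)).
have XP z w : z \in X w -> exists2 y, y != 0 & z = w * y ^+ 2.
  case/imsetP=> s /setD1P[s0 /imsetP[y _ es]] ->; exists y; last by rewrite es.
  by apply: contraNneq s0 => y0; rewrite es y0 expr0n.
have dis z w : w \notin squares -> z \in squares -> z \notin X w.
  move=> nw /imsetP[x _ ->]; apply: contra nw => /XP[y y0 e].
  apply/imsetP; exists (x / y) => //; rewrite expr_div_n e mulfK //.
  by rewrite expf_neq0.
have [|z] := @sets_meet (squares :|: X D) (X E).
  have d0 : squares :&: X D = set0.
    apply/setP=> z; rewrite in_set0; apply/setIP => -[sz].
    by apply/negP; apply: dis.
  have S1_gt0 : (0 < #|S1|)%N.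
    apply/card_gt0P; exists 1; rewrite !inE oner_neq0 /=.
    by apply/imsetP; exists 1; rewrite ?expr1n.
  rewrite cX // cardsU d0 cards0 subn0 cX //.
  by move: #|S1| #|squares| cS h S1_gt0 => s1 s -> ; lia.
case/setUP=> [sz|/XP[y y0 ->] /XP[w w0 e]]; first by move=> Xz; case/negP: (dis z E nE sz).
exists (w / y); first by rewrite mulf_neq0 ?invr_eq0.
apply: (mulIf (expf_neq0 2 y0)); rewrite e; field.
exact: y0.
Qed.

Lemma square_ratio (D E : F) : D != 0 -> E != 0 ->
  (D \in squares) = (E \in squares) -> exists s, D = s ^+ 2 * E.
Proof.
move=> D0 E0; have [/imsetP[a _ ->]|nD] := boolP (D \in squares); last first.
  by move/esym/negbT=> nE; have [s _ ->] := nonsquare_ratio nD nE; exists s.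
move/esym/imsetP=> [b _ eb]; exists (a / b); rewrite eb -exprMn divfK //.
by apply: contraNneq E0 => b0; rewrite eb b0 expr0n.
Qed.

Lemma card_prod_eq (a : F) :
  #|[set x : F * F | x.1 * x.2 == a]| = (#|F|.-1 + (a == 0%R) * #|F|)%N.
Proof.
rewrite -sum1_card (partition_big (fun x => x.1) predT) //= (bigD1 0) //= addnC; congr (_ + _)%N.
  transitivity (\sum_(i in [set~ 0%R : F]) 1)%N; last by rewrite sum1_card cardsC1.
  apply: eq_big => [i|i i0]; first by rewrite !inE.
  rewrite sum1dep_card -(cards1 (i, a / i)); congr #|pred_of_set _|; apply/setP=> -[x y].
  rewrite !inE /= xpair_eqE; apply/andP/andP => -[].
    by move=> /eqP <- /eqP ei; rewrite ei eqxx mulrC mulKf // -ei.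
  by move=> /eqP -> /eqP ->; rewrite mulrC divfK.
rewrite sum1dep_card; have [a0|a0] := eqVneq a 0.
  rewrite mul1n -(card_imset _ (_ : injective (fun y : F => (0 : F, y)))); last by move=> y z [].
  congr #|pred_of_set _|; apply/setP=> -[x y]; rewrite !inE /= a0.
  apply/andP/imsetP => [[_ /eqP ->]|[z _ [-> _]]]; first by exists y.
  by rewrite mul0r !eqxx.
rewrite mul0n; apply/eqP; rewrite cards_eq0; apply/eqP/setP=> -[x y]; rewrite !inE /=.
by apply/andP => -[/eqP e /eqP x0]; move: e; rewrite x0 mul0r => /esym/eqP; rewrite (negPf a0).
Qed.

(** These a are the eigenvalues in F of a matrix of trace t and determinant 1. *)
Lemma card_roots2 (t : F) : t ^+ 2 - 4 != 0 ->
  #|[set a : F | a * (t - a) == 1]| = (if (t ^+ 2 - 4)%R \in squares then 2 else 0)%N.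
Proof.
move=> D0; case: ifP => [/imsetP[d _ ed]|nD]; last first.
  apply/eqP; rewrite cards_eq0; apply/eqP/setP=> a; rewrite !inE; apply/negP=> /eqP e.
  case/negP: (negbT nD); apply/imsetP; exists (t - a *+ 2) => //.
  have -> : 4 = a * (t - a) *+ 4 :> F by rewrite e; ring.
  ring.
have d0 : d != 0 by apply: contraNneq D0 => d0; rewrite ed d0 expr0n.
have -> : [set a : F | a * (t - a) == 1] = [set (t + d) / 2; (t - d) / 2].
  apply/setP=> a; rewrite !inE.
  have -> : (a * (t - a) == 1) = ((a *+ 2 - t) ^+ 2 == d ^+ 2).
    rewrite -ed -[LHS]subr_eq0 -[RHS]subr_eq0.
    have -> : (a *+ 2 - t) ^+ 2 - (t ^+ 2 - 4) = - (2 * 2) * (a * (t - a) - 1) by ring.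
    by rewrite mulf_eq0 oppr_eq0 mulf_eq0 (negPf two_neq0).
  rewrite eqf_sqr; congr (_ || _); rewrite -[RHS](inj_eq (mulIf two_neq0)) divfK //.
    by rewrite subr_eq addrC mulr_natr.
  by rewrite subr_eq addrC mulr_natr.
rewrite cards2 -[_ == _](inj_eq (mulIf two_neq0)) !divfK // (inj_eq (addrI t)).
by rewrite -subr_eq0 opprK -mulr2n -mulr_natl mulf_eq0 (negPf two_neq0) (negPf d0).
Qed.

Lemma sum_roots2 : (\sum_(t : F) #|[set a : F | (a * (t - a) == 1)%R]| = #|F|.-1)%N.
Proof.
have := card_prod_eq 1; rewrite oner_eq0 mul0n addn0 => <-.
rewrite -[RHS]sum1_card (partition_big (fun x => x.1 + x.2) predT) //=.
apply: eq_bigr => t _; rewrite sum1dep_card.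
rewrite -(card_imset _ (_ : injective (fun a : F => (a, t - a)))); last by move=> a b [].
congr #|pred_of_set _|; apply/setP=> -[x y]; apply/imsetP/idP; rewrite !inE /=.
  by case=> a /[!inE] h [-> ->]; rewrite h addrC subrK /=.
by case/andP=> h /eqP e; exists x; rewrite ?inE -e addrC addKr // mulrC.
Qed.

End FiniteField.

(** * Conjugacy classes and order of SL(2, p) *)

Section SL2.

Import GRing.Theory.
Local Open Scope group_scope.

Variable p : nat.
Hypotheses (p_prime : prime p) (p_gt3 : 3 < p).

Local Notation F := 'F_p.
Local Notation L := (SL2 p).
Implicit Types u g h : {'GL_2(p)}.

Lemma natF_neq0 n : (0 < n < p)%N -> (n%:R : F)%R != 0%R.
Proof.
case/andP=> n0 np; rewrite -(dvdn_pcharf (pchar_Fp p_prime)).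
by rewrite gtnNdvd.
Qed.

Lemma two_neq0F : (2 : F)%R != 0%R.
Proof. by apply: natF_neq0; rewrite (ltn_trans _ p_gt3). Qed.

Definition toGL (A : 'M[F]_2) : {'GL_2(p)} := insubd (1%g : {'GL_2(p)}) A.

Lemma toGLK A : (\det A = 1)%R -> GLval (toGL A) = A.
Proof. by move=> d; apply: insubdK; rewrite -topredE /= -[_ \in _]/(A \in unitmx) unitmxE d unitr1. Qed.

Lemma toGL_inj A B : (\det A = 1)%R -> (\det B = 1)%R -> toGL A = toGL B -> A = B.
Proof. by move=> dA dB e; rewrite -(toGLK dA) e toGLK. Qed.

Lemma mem_SL2 u : (u \in L) = (\det (GLval u) == 1)%R.
Proof. by rewrite inE. Qed.

Lemma toGL_SL2 A : (\det A = 1)%R -> toGL A \in L.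
Proof. by move=> d; rewrite mem_SL2 toGLK // d. Qed.

Lemma SL2_det u : u \in L -> (\det (GLval u) = 1)%R.
Proof. by rewrite mem_SL2 => /eqP. Qed.

Lemma GLval_inj2 u g : GLval u = GLval g -> u = g.
Proof. exact: val_inj. Qed.

Lemma commuteE u g : commute u g <-> (GLval u *m GLval g = GLval g *m GLval u)%R.
Proof.
split=> [e|e]; first by rewrite -!GL_MxE e.
by apply: GLval_inj2; rewrite !GL_MxE.
Qed.

Lemma SL2_centerP u : u \in L -> reflect (u \in 'Z(L)) (is_scalar_mx (GLval u)).
Proof.
move=> Lu; apply: (iffP idP) => [/is_scalar_mxP[a ea]|/centerP[_ cu]].
  apply/centerP; split=> // g Lg; apply/commuteE; rewrite ea.
  by rewrite mul_scalar_mx mul_mx_scalar.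
(* Commuting with these two unipotent matrices already makes u scalar. *)
pose E := toGL (mx2 1 1 0 1)%R; pose E' := toGL (mx2 1 0 1 1)%R.
have dE : (\det (mx2 1 1 0 1 : 'M[F]_2) = 1)%R by rewrite det2E !mx2E; ring.
have dE' : (\det (mx2 1 0 1 1 : 'M[F]_2) = 1)%R by rewrite det2E !mx2E; ring.
have /commuteE := cu E (toGL_SL2 dE); rewrite toGLK // => /matrixP e.
have /commuteE := cu E' (toGL_SL2 dE'); rewrite toGLK // => /matrixP e'.
have := e 0%R 0%R; have := e 0%R 1%R; have := e' 0%R 0%R.
rewrite !mul2E !mx2E !(mulr1, mul1r, mulr0, mul0r, addr0, add0r) => h1 h2 h3.
have u01 : (GLval u 0 1 = 0)%R by apply: (addrI (GLval u 0 0)%R); rewrite h1 addr0.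
apply/scalar2P; split=> //; first by apply: (addrI (GLval u 0 0)%R); rewrite addr0 -h3.
by move: h2; rewrite u01 addr0 add0r.
Qed.

Lemma card_center : #|'Z(L)| = 2.
Proof.
have d1 a : (a ^+ 2 = 1 -> \det (a%:M : 'M[F]_2) = 1)%R by rewrite det_scalar.
have -> : 'Z(L) = [set toGL 1%:M; toGL (-1)%:M]%R.
  apply/setP=> u; rewrite in_set2; apply/idP/orP.
    move=> Zu; have Lu : u \in L by apply: subsetP (center_sub _) u Zu.
    have /is_scalar_mxP[a ea] := introT (SL2_centerP Lu) Zu.
    have := SL2_det Lu; rewrite ea det_scalar => /eqP; rewrite sqrf_eq1.
    by case/orP=> /eqP ea1; [left|right]; apply/eqP/GLval_inj2; rewrite ea ea1 toGLK // d1; ring.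
  have sc a : (a ^+ 2 = 1)%R -> toGL a%:M%R \in 'Z(L).
    move=> a2; apply/SL2_centerP; first by apply: toGL_SL2; rewrite d1.
    by rewrite toGLK ?d1 // scalar_mx_is_scalar.
  by case=> /eqP ->; apply: sc; ring.
have d11 := d1 1%R (expr1n _ _); have d1N : (\det ((-1)%:M : 'M[F]_2) = 1)%R by apply: d1; ring.
rewrite cards2; case: eqP => // /(toGL_inj d11 d1N)/matrixP/(_ 0%R 0%R); rewrite !mxE /= !mulr1n => /eqP.
by rewrite -subr_eq0 opprK (negPf two_neq0F).
Qed.

Local Notation noncentral g := (~~ is_scalar_mx (GLval g)).

Lemma SL2_CA g h u : noncentral g -> commute g h -> commute g u -> commute h u.
Proof. by move=> ng /commuteE gh /commuteE gu; apply/commuteE/(comm2_trans ng). Qed.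

Lemma cent_SL2_abelian g : noncentral g -> abelian 'C_L[g].
Proof.
move=> ng; apply/centsP=> h /setIP[_ /cent1P gh] u /setIP[_ /cent1P gu].
by apply: (SL2_CA ng); apply: commute_sym.
Qed.

Lemma cent_SL2_eq g h : noncentral g -> noncentral h -> commute g h -> 'C_L[g] = 'C_L[h].
Proof.
move=> ng nh gh; apply/setP=> u.
apply/setIP/setIP => -[Lu /cent1P/commute_sym c]; split=> //; apply/cent1P/commute_sym.
  exact: (SL2_CA ng).
exact: (SL2_CA nh (commute_sym gh)).
Qed.

Local Notation tr g := (\tr (GLval g))%R.
Local Notation dsc g := (disc (GLval g)).

Lemma disc_SL2 g : g \in L -> (dsc g = tr g ^+ 2 - 4)%R.
Proof. by move=> Lg; rewrite /disc SL2_det. Qed.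

Lemma tr_conj g h : (tr (g ^ h) = tr g)%R.
Proof.
have e : (GLval (g ^ h) = GLval h^-1 *m (GLval g *m GLval h))%R by rewrite conjgE !GL_MxE.
by rewrite e mxtrace_mulC -mulmxA -GL_MxE mulgV GL_1E mulmx1.
Qed.

(** The base change has determinant 1 because the quadratic form of [companion2], of discriminant
    [disc A], represents 1. *)
Lemma SL2_companion (A : 'M[F]_2) : (disc A != 0)%R ->
  exists2 u, u \in L & (GLval u *m A = mx2 0 1 (- \det A) (\tr A) *m GLval u)%R.
Proof.
move=> D0; have [|x [y e]] := @represent1 F two_neq0F (A 0 1)%R (A 1 1 - A 0 0)%R (- A 1 0)%R.
  by rewrite mulrN mulNrn opprK -discE.
have [|P dP eP] := @companion2 F A x y; first by rewrite -e; ring.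
by exists (toGL P); rewrite ?toGL_SL2 ?toGLK.
Qed.

(** Both matrices are conjugate under SL(2, p) to the same companion matrix. *)
Lemma SL2_conj_mx (A B : 'M[F]_2) : (disc A != 0 -> \tr A = \tr B -> \det A = \det B ->
  exists2 u, u \in L & GLval u *m A = B *m GLval u)%R.
Proof.
move=> D0 et ed; have [u Lu eu] := SL2_companion D0.
have [v Lv ev] : exists2 v, v \in L & (GLval v *m B = mx2 0 1 (- \det A) (\tr A) *m GLval v)%R.
  by rewrite et ed; apply: SL2_companion; rewrite /disc -et -ed.
exists (v^-1 * u); first by rewrite groupM ?groupV.
set C := mx2 _ _ _ _ in eu ev.
have vV : (GLval v *m GLval v^-1 = 1%:M)%R by rewrite -GL_MxE mulgV GL_1E.
have Vv : (GLval v^-1 *m GLval v = 1%:M)%R by rewrite -GL_MxE mulVg GL_1E.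
have key : (GLval v^-1 *m C = B *m GLval v^-1)%R.
  transitivity (GLval v^-1 *m (C *m GLval v) *m GLval v^-1)%R.
    by rewrite -!mulmxA vV mulmx1.
  by rewrite -ev !mulmxA Vv mul1mx.
by rewrite GL_MxE -mulmxA eu mulmxA key -mulmxA.
Qed.

Lemma SL2_conj g h : g \in L -> h \in L -> (dsc g != 0)%R -> (tr g = tr h)%R ->
  exists2 u, u \in L & g ^ u = h.
Proof.
move=> Lg Lh D0 et; have [|u Lu e] := SL2_conj_mx D0 et; first by rewrite !SL2_det.
exists u^-1; first by rewrite groupV.
apply: (mulIg u); apply: GLval_inj2; rewrite -[RHS]/(GLval (h * u)) GL_MxE -e -GL_MxE.
by rewrite conjgE invgK !mulgA mulgKV.
Qed.

Definition trace_class (t : F) := [set u in L | tr u == t]%R.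

Lemma trace_classE g : g \in L -> (dsc g != 0)%R -> g ^: L = trace_class (tr g).
Proof.
move=> Lg D0; apply/setP=> h; apply/imsetP/setIdP => [[u Lu ->]|[Lh /eqP e]].
  by rewrite groupJ // tr_conj.
by have [u Lu <-] := SL2_conj Lg Lh D0 (esym e); exists u.
Qed.

Lemma card_Fp_p : #|F| = p. Proof. exact: card_Fp. Qed.

(** For diagonal entries a and t - a, the other two have product a (t - a) - 1: p - 1 solutions, and
    p more if this is 0. *)
Lemma card_trace_class t :
  #|trace_class t| = (p * p.-1 + #|[set a : F | a * (t - a) == 1]%R| * p)%N.
Proof.
pose f (x : F * (F * F)) := toGL (mx2 x.1 x.2.1 x.2.2 (t - x.1))%R.
pose X := [set x : F * (F * F) | x.2.1 * x.2.2 == x.1 * (t - x.1) - 1]%R.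
have fd x : x \in X -> (\det (mx2 x.1 x.2.1 x.2.2 (t - x.1)) = 1)%R.
  by rewrite inE det2E !mx2E => /eqP ->; ring.
have fI : {in X &, injective f}.
  move=> [a [b c]] [a' [b' c']] Xx Xx' /(toGL_inj (fd _ Xx) (fd _ Xx')) /matrixP /= e.
  have := e 0%R 0%R; have := e 0%R 1%R; have := e 1%R 0%R.
  by rewrite !mx2E => -> -> ->.
have -> : trace_class t = f @: X.
  apply/setP=> u; apply/setIdP/imsetP => [[Lu /eqP et]|[x Xx ->]].
    exists (GLval u 0 0, (GLval u 0 1, GLval u 1 0))%R.
      have := SL2_det Lu; rewrite det2E inE /= -et tr2E => d.
      by apply/eqP; rewrite -d; ring.
    apply: GLval_inj2; rewrite /f /= toGLK -et tr2E.
      by apply: mx2P; rewrite !mx2E; ring.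
    by rewrite det2E !mx2E -(SL2_det Lu) det2E; ring.
  rewrite toGL_SL2 ?fd // toGLK ?fd // tr2E !mx2E; split=> //.
  by apply/eqP; ring.
rewrite card_in_imset // -sum1_card (partition_big (fun x => x.1) predT) //=.
have step a : (\sum_(x in X | x.1 == a) 1 = p.-1 + (a * (t - a) == 1)%R * p)%N.
  have := @card_prod_eq F (a * (t - a) - 1)%R; rewrite card_Fp_p subr_eq0 => <-.
  rewrite sum1dep_card -(card_imset _ (_ : injective (fun y : F * F => (a, y)))); last by move=> y z [].
  congr #|pred_of_set _|; apply/setP=> -[x y]; apply/setIdP/imsetP => [[/[!inE] h /eqP ex]|[z /[!inE] h [-> ->]]].
    by exists y; rewrite ?inE /= -?ex //; apply/eqP/esym.
  by split; rewrite ?inE /=.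
rewrite (eq_bigr _ (fun a _ => step a)) big_split /= sum_nat_const cardT -cardE card_Fp_p.
congr (_ + _)%N; rewrite -big_distrl /=; congr (_ * _)%N.
by rewrite -sum1dep_card [RHS]big_mkcond; apply: eq_bigr => a _; case: eqP.
Qed.

Lemma card_SL2 : #|L| = (p * (p.-1 * p.+1))%N.
Proof.
have -> : #|L| = (\sum_(t : F) #|trace_class t|)%N.
  rewrite -sum1_card (partition_big (fun u => tr u) predT) //=.
  by apply: eq_bigr => t _; rewrite -sum1_card; apply: eq_bigl => u; apply/andP/setIdP.
rewrite (eq_bigr _ (fun t _ => card_trace_class t)) big_split /= sum_nat_const.
rewrite cardT -cardE card_Fp_p -big_distrl /=.
rewrite sum_roots2 card_Fp_p.
by case: (p) p_gt3 => // n _ /=; lia.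
Qed.

End SL2.

(** * Centralizers in SL(2, p) *)

Section Centralisers.

Import GRing.Theory.
Local Open Scope group_scope.

Variable p : nat.
Hypotheses (p_prime : prime p) (p_gt3 : 3 < p).

Local Notation F := 'F_p.
Local Notation L := (SL2 p).
Local Notation noncentral g := (~~ is_scalar_mx (GLval g)).
Local Notation tr g := (\tr (GLval g))%R.
Local Notation dsc g := (disc (GLval g)).
Implicit Types u g h : {'GL_2(p)}.

Lemma cent_SL2E g u : noncentral g -> u \in 'C_L[g] ->
  exists a b, GLval u = (a%:M + b *: GLval g)%R.
Proof. by move=> ng /setIP[_ /cent1P/commute_sym/commuteE]; apply: comm2P. Qed.

Lemma mem_cent_SL2 g u a b : u \in L -> GLval u = (a%:M + b *: GLval g)%R -> u \in 'C_L[g].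
Proof.
move=> Lu e; rewrite inE Lu; apply/cent1P/commuteE; rewrite e mulmxDl mulmxDr.
by rewrite mul_scalar_mx mul_mx_scalar -scalemxAl -scalemxAr.
Qed.

Lemma tr2_central g u : g \in L -> (dsc g != 0)%R -> u \in 'C_L[g] -> (tr u = 2)%R -> u = 1.
Proof.
move=> Lg D0 Cu t2; have Lu : u \in L by case/setIP: Cu.
have [a [b e]] := cent_SL2E (disc_nonscalar D0) Cu.
have : (disc (GLval u) = 0)%R by rewrite disc_SL2 // t2; ring.
rewrite e disc_scal2E => /eqP; rewrite mulf_eq0 (negPf D0) orbF expf_eq0 /= => /eqP b0.
move: t2; rewrite e tr_scal2E b0 mul0r addr0 => h.
have a1 : a = 1%R.
  by apply: (mulIf (two_neq0F p_prime p_gt3)); rewrite mul1r mulr_natr h.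
by apply: GLval_inj2; rewrite e b0 a1 scale0r addr0 GL_1E.
Qed.

(** In this abelian group u - 1 is invertible for u other than 1, its determinant being 2 - tr u;
    [tr2_central] applies. *)
Lemma cyclic_cent g : g \in L -> (dsc g != 0)%R -> cyclic 'C_L[g].
Proof.
move=> Lg D0.
apply: (@div_ring_mul_group_cyclic _ _ 'M[F]_2 (fun u => GLval u)).
- by rewrite [LHS]GL_1E.
- by move=> u v _ _; rewrite [LHS]GL_MxE.
- move=> u /setD1P[u1 Cu]; have Lu : u \in L by case/setIP: Cu.
  rewrite -[_ \is a _]/(_ \in unitmx) unitmxE unitfE.
  have -> : (GLval u - 1 = (-1)%:M + 1 *: GLval u)%R by rewrite scale1r addrC -scalemx1 scaleN1r.
  rewrite det_scal2E SL2_det // !mulr1; apply: contra u1 => /eqP h; apply/eqP.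
  apply: (tr2_central Lg D0 Cu); apply/eqP; rewrite eq_sym -subr_eq0 -h; apply/eqP; ring.
- exact: cent_SL2_abelian (disc_nonscalar D0).
Qed.

(** The class of g is its trace class, of size p (p + 1) or p (p - 1). *)
Lemma card_cent g : g \in L -> (dsc g != 0)%R ->
  #|'C_L[g]| = if (dsc g)%R \in squares F then p.-1 else p.+1.
Proof.
move=> Lg D0; have := Lagrange (subsetIl L 'C[g]).
rewrite index_cent1 trace_classE // card_trace_class // card_SL2 //.
rewrite disc_SL2 // in D0 *; rewrite card_roots2 ?two_neq0F //.
move: #|_| => c; case: ifP => _; case: (p) p_gt3 => // n n3 /=; nia.
Qed.

(** With tr g = 2 s and s^2 = 1, the determinant of a + b g is (a + s b)^2, so each b allows two
    values of a. *)
Lemma card_cent0 g : g \in L -> noncentral g -> (dsc g = 0)%R -> #|'C_L[g]| = p.*2.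
Proof.
move=> Lg ng D0; have two0 := two_neq0F p_prime p_gt3.
pose s : F := (tr g / 2)%R.
have ets : (tr g = s * 2)%R by rewrite /s divfK.
have s2 : (s ^+ 2 = 1)%R.
  have := D0; rewrite disc_SL2 // ets => h.
  apply: (mulIf two0); apply: (mulIf two0); rewrite -[RHS]addr0 -h.
  by ring.
pose e (b : bool) : F := (if b then 1 else -1)%R.
pose f (x : bool * F) := toGL ((e x.1 - s * x.2)%:M + x.2 *: GLval g)%R.
have fd x : (\det ((e x.1 - s * x.2)%:M + x.2 *: GLval g) = 1)%R.
  rewrite det_scal2E SL2_det // ets.
  have e2 : (e x.1 ^+ 2 = 1)%R by rewrite /e; case: (x.1); ring.
  by ring: s2 e2.
have fI : injective f.
  move=> [b x] [b' x'] /(toGL_inj (fd _) (fd _)) /(scal2_inj ng)[/= h ex].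
  rewrite ex in h *; have {h} /eqP := addIr _ h; rewrite /e; case: b b' => [] [] //.
    by rewrite -subr_eq0 opprK (negPf two0).
  by rewrite eq_sym -subr_eq0 opprK (negPf two0).
have -> : 'C_L[g] = f @: [set: bool * F].
  apply/setP=> u; apply/idP/imsetP => [Cu|[x _ ->]]; last first.
    apply: (@mem_cent_SL2 _ _ (e x.1 - s * x.2)%R x.2); first by rewrite toGL_SL2 ?fd.
    by rewrite toGLK ?fd.
  have [a [b ea]] := cent_SL2E ng Cu; have Lu : u \in L by case/setIP: Cu.
  have : ((a + s * b) ^+ 2 == 1)%R.
    have := SL2_det Lu; rewrite ea det_scal2E SL2_det // ets => <-.
    by apply/eqP; ring: s2.
  rewrite sqrf_eq1 => h; have [c hc] : exists c, (a + s * b = e c)%R.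
    by case/orP: h => /eqP h; [exists true | exists false].
  exists (c, b); rewrite ?inE //; apply: GLval_inj2.
  by rewrite toGLK ?fd // ea /= -hc addrK.
by rewrite card_imset // cardsT card_prod card_bool card_Fp_p // mul2n.
Qed.

Lemma SL2_inv g : g \in L -> GLval g^-1 = ((tr g)%:M + -1 *: GLval g)%R.
Proof.
move=> Lg; have e : (GLval g *m ((tr g)%:M + -1 *: GLval g) = 1%:M)%R.
  rewrite scaleN1r mulmxDr mulmxN char2E mul_mx_scalar SL2_det //.
  by rewrite opprB addrCA addrN addr0.
by rewrite -[LHS]mulmx1 -e mulmxA -GL_MxE mulVg GL_1E mul1mx.
Qed.

Lemma tr_inv g : g \in L -> (tr g^-1 = tr g)%R.
Proof. by move=> Lg; rewrite SL2_inv // tr_scal2E; ring. Qed.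

(** The conjugate is a + b g. Equal discriminants give b = 1 or -1 and equal traces then fix a,
    leaving g and tr g - g = g^-1. *)
Lemma cent_normaliser g u : g \in L -> (dsc g != 0)%R -> u \in L ->
  g ^ u \in 'C_L[g] -> u \notin 'C_L[g] -> g ^ u = g^-1.
Proof.
move=> Lg D0 Lu Cgu nCu; have two0 := two_neq0F p_prime p_gt3.
have [a [b e]] := cent_SL2E (disc_nonscalar D0) Cgu.
have et : (tr g = a *+ 2 + b * tr g)%R by rewrite -tr_scal2E -e tr_conj.
have : (b ^+ 2 == 1)%R.
  apply/eqP/(mulIf D0); rewrite -(disc_scal2E a) -e !disc_SL2 ?groupJ // tr_conj.
  by rewrite mul1r.
rewrite sqrf_eq1 => /orP[] /eqP eb; rewrite eb in e et.
  have a0 : a = 0%R.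
    apply: (mulIf two0); rewrite mul0r mulr_natr; apply: (addIr (1 * tr g)%R).
    by rewrite -et add0r mul1r.
  case/negP: nCu; rewrite inE Lu; apply/cent1P/commute_sym/commgP/conjg_fixP.
  by apply: GLval_inj2; rewrite e a0 scale1r -scalemx1 scale0r add0r.
have ea : a = tr g.
  by apply: (mulIf two0); rewrite mulr_natr [in RHS]mulr_natr [RHS]mulr2n {1}et; ring.
by apply: GLval_inj2; rewrite SL2_inv // e ea.
Qed.

End Centralisers.

(** * The tori of PSL(2, p) *)

Section ProjectiveTori.

Import GRing.Theory.
Local Open Scope group_scope.

Variable p : nat.
Hypotheses (p_prime : prime p) (p_gt3 : 3 < p).

Local Notation F := 'F_p.
Local Notation L := (SL2 p).
Local Notation Z := 'Z(SL2 p).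
Local Notation noncentral g := (~~ is_scalar_mx (GLval g)).
Local Notation tr g := (\tr (GLval g))%R.
Local Notation dsc g := (disc (GLval g)).
Implicit Types (u g h : {'GL_2(p)}) (x y : coset_of Z).

Definition torus x : {group coset_of Z} := ('C_L[repr x] / Z)%G.

Lemma SL2_normZ u : u \in L -> u \in 'N(Z).
Proof. by apply: subsetP; apply: normal_norm (center_normal _). Qed.

Lemma coset_SL2P x : x \in (PSL2 p)^# ->
  exists g, [/\ g \in L, noncentral g & x = coset Z g].
Proof.
case/setD1P=> x1 /morphimP[g Ng Lg ex]; exists g; split=> //.
by apply: contra x1 => /(SL2_centerP Lg) Zg; apply/eqP; rewrite ex; apply: coset_id.
Qed.

Lemma coset_SL2 x : x \in PSL2 p -> exists2 g, g \in L & x = coset Z g.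
Proof. by case/morphimP=> g _ Lg ->; exists g. Qed.

Lemma sub_center_cent g : g \in L -> Z \subset 'C_L[g].
Proof.
by move=> Lg; apply/subsetP=> z /centerP[Lz cz]; rewrite inE Lz; apply/cent1P/cz.
Qed.

Lemma mem_coset_cent g u : g \in L -> u \in L -> (coset Z u \in 'C_L[g] / Z) = (u \in 'C_L[g]).
Proof.
move=> Lg Lu; apply/idP/idP => [/morphimP[v Nv Cv e]|]; last exact: mem_quotient.
have : u \in Z :* v by rewrite -val_coset // -e val_coset ?SL2_normZ ?rcoset_refl.
by case/rcosetP=> z /(subsetP (sub_center_cent Lg)) Cz ->; rewrite groupM.
Qed.

Lemma torus_coset g : g \in L -> noncentral g -> torus (coset Z g) = ('C_L[g] / Z)%G.
Proof.
move=> Lg ng; suff e : 'C_L[g] = 'C_L[repr (coset Z g)] by apply: group_inj; rewrite /= e.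
have := mem_repr_coset (coset Z g); rewrite val_coset ?SL2_normZ //.
case/rcosetP=> z Zz ->; have /centerP[Lz cz] := Zz.
have nzg : noncentral (z * g).
  apply: contra ng => /(SL2_centerP (groupM Lz Lg)) h.
  by apply/(SL2_centerP Lg); rewrite -(mulKg z g) groupM ?groupV.
by apply: (cent_SL2_eq ng nzg); apply: commuteM; [apply/commute_sym/cz | ].
Qed.

Lemma noncentralJ g h : g \in L -> h \in L -> noncentral g -> noncentral (g ^ h).
Proof.
move=> Lg Lh; apply: contra => /(SL2_centerP (groupJ Lg Lh)) Zgh.
by apply/(SL2_centerP Lg); rewrite -(memJ_norm _ (SL2_normZ Lh)).
Qed.

Lemma torusJ g h : g \in L -> h \in L -> noncentral g ->
  torus (coset Z (g ^ h)) = (torus (coset Z g) :^ coset Z h)%G.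
Proof.
move=> Lg Lh ng; have nJ := noncentralJ Lg Lh ng.
rewrite !torus_coset ?groupJ //; apply: group_inj.
have e : 'C_L[g ^ h] = 'C_L[g] :^ h by rewrite conjIg -cent1J conjGid.
by have := quotientJ 'C_L[g] (SL2_normZ Lh); rewrite -e.
Qed.

Lemma card_torus_mul2 g : g \in L -> noncentral g ->
  (2 * #|torus (coset Z g)| = #|'C_L[g]|)%N.
Proof.
move=> Lg ng; have nC : 'C_L[g] \subset 'N(Z).
  by apply: subset_trans (subsetIl _ _) _; apply: normal_norm (center_normal _).
have := card_quotient nC; rewrite torus_coset // => ->.
by have := Lagrange (sub_center_cent Lg); rewrite card_center.
Qed.

Lemma card_torus g : g \in L -> noncentral g ->
  #|torus (coset Z g)| =
    if (dsc g == 0)%R then p else if (dsc g)%R \in squares F then p./2 else p./2.+1.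
Proof.
move=> Lg ng; have := card_torus_mul2 Lg ng; have p_odd : odd p by case: (even_prime p_prime) p_gt3 => // ->.
have := odd_double_half p; rewrite p_odd -!muln2.
have [D0|D0] := eqVneq (dsc g) 0%R; first by rewrite card_cent0 // -muln2; lia.
by rewrite card_cent //; move: #|_| => c; case: ifP => _; lia.
Qed.

Lemma torus_inverts g u : g \in L -> (dsc g != 0)%R -> u \in L ->
    coset Z u \in 'N_(PSL2 p)(torus (coset Z g)) :\: torus (coset Z g) ->
  g ^ u = g^-1 /\ u \notin 'C_L[g].
Proof.
move=> Lg D0 Lu; rewrite torus_coset ?disc_nonscalar // => /setDP[/setIP[_ Nu]].
rewrite /= mem_coset_cent // => nCu; split=> //; apply: (cent_normaliser p_prime p_gt3) => //.
rewrite -mem_coset_cent ?groupJ // morphJ ?SL2_normZ // memJ_norm //.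
by rewrite mem_coset_cent // inE Lg cent1id.
Qed.

(** The traceless parts of g and s h have equal determinant, so they are conjugate in SL(2, p);
    adding scalars back makes a conjugate of g a polynomial in h. *)
Lemma cent_conj_disc g h (s : F) : g \in L -> h \in L -> (dsc g != 0)%R ->
    (dsc g = s ^+ 2 * dsc h)%R ->
  exists2 u, u \in L & commute h (g ^ u).
Proof.
move=> Lg Lh dg es; have two0 := two_neq0F p_prime p_gt3.
pose A : 'M[F]_2 := ((- (tr g / 2))%:M + 1 *: GLval g)%R.
pose B : 'M[F]_2 := ((- (s * tr h / 2))%:M + s *: GLval h)%R.
have trA : (\tr A = 0)%R by rewrite tr_scal2E; field.
have trB : (\tr B = 0)%R by rewrite tr_scal2E; field.
have dA : disc A = dsc g by rewrite disc_scal2E expr1n mul1r.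
have detAB : (\det A = \det B)%R.
  have four0 : (4 != 0 :> F)%R by rewrite (_ : 4 = 2 * 2)%R ?mulf_neq0 //; ring.
  apply: (mulIf four0); rewrite !mulr_natr.
  have : disc A = disc B by rewrite dA disc_scal2E.
  by rewrite /disc trA trB => /addrI/oppr_inj.
have dA0 : disc A != 0%R by rewrite dA.
have [u Lu eu] := SL2_conj_mx p_prime p_gt3 dA0 (etrans trA (esym trB)) detAB.
exists u^-1; first by rewrite groupV.
suff /setIP[_ /cent1P] : g ^ u^-1 \in 'C_L[h] by [].
pose c := (tr g / 2 - s * tr h / 2)%R.
apply: (@mem_cent_SL2 _ _ _ c s); first by rewrite groupJ ?groupV.
have eA : GLval g = (A + (tr g / 2)%:M)%R.
  by rewrite /A scale1r addrAC -raddfD /= addNr -scalemx1 scale0r add0r.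
have e : (GLval u *m GLval g = (c%:M + s *: GLval h) *m GLval u)%R.
  rewrite eA mulmxDr eu mul_mx_scalar -mul_scalar_mx -mulmxDl; congr (_ *m _)%R.
  by rewrite /B /c addrAC -raddfD /= [(- _ + _)%R]addrC.
by rewrite conjgE invgK !GL_MxE mulmxA e -mulmxA -GL_MxE mulgV GL_1E mulmx1.
Qed.

End ProjectiveTori.

Arguments torus {p}.

(** * The torus axioms for PSL(2, p) *)

Section TorusSystemPSL2.

Import GRing.Theory.
Local Open Scope group_scope.

Variable p : nat.
Hypotheses (p_prime : prime p) (p_gt3 : 3 < p).

Local Notation F := 'F_p.
Local Notation L := (SL2 p).
Local Notation Z := 'Z(SL2 p).
Local Notation noncentral g := (~~ is_scalar_mx (GLval g)).
Local Notation tr g := (\tr (GLval g))%R.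
Local Notation dsc g := (disc (GLval g)).
Implicit Types (u g h : {'GL_2(p)}) (x y : coset_of Z).

Lemma PSL2_torus_system : torus_system (PSL2 p) p./2 torus.
Proof.
have two0 := two_neq0F p_prime p_gt3.
have pE : p = p./2.*2.+1.
  by rewrite -{1}(odd_double_half p); case: (even_prime p_prime) p_gt3 => [->|->].
have D0 g : g \in L -> noncentral g -> #|torus (coset Z g)| <> p./2.*2.+1 -> (dsc g != 0)%R.
  by move=> Lg ng; rewrite -pE card_torus //; case: (dsc g == 0)%R.
split.
- by move=> x _; apply/quotientS/subsetIl.
- move=> x /coset_SL2P[g [Lg ng ->]].
  by rewrite torus_coset //= mem_coset_cent // inE Lg cent1id.
- move=> x y /coset_SL2P[g [Lg ng ->]] /setD1P[y1 Ty].
  have /coset_SL2P[h [Lh nh ey]] : y \in (PSL2 p)^#.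
    by rewrite !inE y1; apply: subsetP Ty; apply/quotientS/subsetIl.
  move: Ty; rewrite ey !torus_coset //= mem_coset_cent // => /setIP[_ /cent1P gh].
  by apply: group_inj; rewrite /= (cent_SL2_eq ng nh (commute_sym gh)).
- move=> x y /coset_SL2P[g [Lg ng ->]] /coset_SL2[h Lh ->].
  by rewrite -morphJ ?SL2_normZ // torusJ.
- move=> x /coset_SL2P[g [Lg ng ->]]; rewrite card_torus //.
  by case: ifP => _; [constructor 1 | case: ifP => _; [constructor 2 | constructor 3]].
- move=> x /coset_SL2P[g [Lg ng ->]] /(D0 g Lg ng) dg.
  by rewrite torus_coset //; apply/quotient_cyclic/cyclic_cent.
- move=> x y /coset_SL2P[g [Lg ng ->]] /coset_SL2P[h [Lh nh ->]] e np.
  have np' : #|torus (coset Z h)| <> p./2.*2.+1 by rewrite -e.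
  have {np} dg := D0 _ Lg ng np; have {np'} dh := D0 _ Lh nh np'.
  (* Equal orders mean that the discriminants are both squares or both nonsquares. *)
  have [|s es] := square_ratio two0 dg dh.
    by move: e; rewrite !card_torus // (negPf dg) (negPf dh); case: ifP; case: ifP => // _ _; lia.
  have [u Lu gu] := cent_conj_disc p_prime p_gt3 Lg Lh dg es.
  exists (coset Z u); first exact: mem_quotient.
  have nu := noncentralJ Lg Lu ng; rewrite -torusJ // !torus_coset ?groupJ //.
  by apply: group_inj; rewrite /= (cent_SL2_eq nh nu gu).
- move=> x /coset_SL2P[g [Lg ng ->]] /(D0 g Lg ng) dg.
  have LgV : g^-1 \in L by rewrite groupV.
  (* Having the trace of g, its inverse is conjugate to it by some u; u does not centralize g, since
     g^-1 = tr g - g is not g. *)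
  have etr : (tr g = tr g^-1)%R by rewrite tr_inv.
  have [u Lu gu] := SL2_conj p_prime p_gt3 Lg LgV dg etr.
  exists (coset Z u).
    have nV : noncentral g^-1 by rewrite -gu noncentralJ.
    have eT : torus (coset Z g^-1) = torus (coset Z g).
      rewrite !torus_coset ?groupV //; apply: group_inj.
      by rewrite /= (cent_SL2_eq ng nV (commuteV (commute_refl g))).
    apply/setIP; split; first exact: mem_quotient.
    by apply/normP; have := congr1 (@gval _) (torusJ Lg Lu ng); rewrite gu eT.
  rewrite torus_coset //= mem_coset_cent // inE Lu /=; apply/cent1P => /commute_sym/commgP/conjg_fixP.
  rewrite gu => /(congr1 (fun v => GLval v)); rewrite SL2_inv // => gV.
  have [] := scal2_inj ng (etrans gV (_ : _ = 0%:M + 1 *: GLval g)%R).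
    by rewrite -scalemx1 scale0r add0r scale1r.
  by move=> _ /eqP; rewrite eq_sym -subr_eq0 opprK (negPf two0).
- move=> x m n /coset_SL2P[g [Lg ng ->]] /(D0 g Lg ng) dg Nm Nn.
  have /coset_SL2[u Lu eu] : m \in PSL2 p by case/setDP: Nm => /setIP[].
  have /coset_SL2[v Lv ev] : n \in PSL2 p by case/setDP: Nn => /setIP[].
  rewrite eu in Nm *; rewrite ev in Nn *.
  have [gu _] := torus_inverts p_prime p_gt3 Lg dg Lu Nm; have [gv _] := torus_inverts p_prime p_gt3 Lg dg Lv Nn.
  have -> : coset Z u * (coset Z v)^-1 = coset Z (u * v^-1).
    by rewrite morphM ?morphV ?groupV ?SL2_normZ.
  have Luv : u * v^-1 \in L by rewrite groupM ?groupV.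
  rewrite torus_coset //= mem_coset_cent // inE Luv /=; apply/cent1P/commute_sym/commgP/conjg_fixP.
  by rewrite conjgM gu -gv conjgK.
- move=> x n /coset_SL2P[g [Lg ng ->]] /(D0 g Lg ng) dg Nn.
  have /coset_SL2[u Lu eu] : n \in PSL2 p by case/setDP: Nn => /setIP[].
  rewrite eu in Nn *; have [gu nCu] := torus_inverts p_prime p_gt3 Lg dg Lu Nn.
  rewrite -morphX ?SL2_normZ //; apply: coset_id; apply/SL2_centerP; first by rewrite groupX.
  (* The square of u commutes with g; if it were noncentral, its centralizer, which contains u,
     would be that of g. *)
  apply: contraR nCu => nu2.
  have gu2 : commute g (u ^+ 2).
    by apply/commgP/conjg_fixP; rewrite expgS expg1 conjgM gu conjVg gu invgK.
  by rewrite (cent_SL2_eq ng nu2 gu2) inE Lu; apply/cent1P; rewrite /commute expgS expg1 !mulgA.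
(* The diagonal matrix (2, 1/2) has discriminant (3/2)^2, nonzero as p > 3. *)
- have d1 : (\det (mx2 2 0 0 2^-1 : 'M[F]_2) = 1)%R.
    by rewrite det2E !mx2E mulr0 subr0 divff.
  have eD : (disc (mx2 2 0 0 2^-1 : 'M[F]_2) = (3 / 2) ^+ 2)%R.
    by rewrite discE !mx2E; field.
  have D1 : ((3 / 2) ^+ 2 != 0 :> F)%R.
    by rewrite expf_neq0 // mulf_neq0 ?invr_eq0 // natF_neq0.
  pose g := toGL (mx2 2 0 0 2^-1 : 'M[F]_2)%R.
  have Lg : g \in L by apply: toGL_SL2.
  have eg : (dsc g = (3 / 2) ^+ 2)%R by rewrite toGLK.
  have ng : noncentral g by apply: disc_nonscalar; rewrite eg.
  exists (coset Z g); last first.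
    by rewrite card_torus // eg (negPf D1); case: imsetP => // -[]; exists (3 / 2)%R.
  rewrite !inE mem_quotient // andbT; apply: contra ng => /eqP h.
  by apply/(SL2_centerP Lg); rewrite coset_idr ?SL2_normZ.
(* The root counts sum to p - 1 over p traces, so some t has no root and t^2 - 4 is a nonsquare. *)
- have [t /eqP t0] : exists t : F, #|[set a : F | (a * (t - a) == 1)%R]| == 0%N.
    apply/existsP; apply: contraT; rewrite negb_exists => /forallP all_gt0.
    have : (\sum_(t : F) 1 <= \sum_(t : F) #|[set a : F | (a * (t - a) == 1)%R]|)%N.
      by apply: leq_sum => t _; rewrite lt0n.
    by rewrite sum_roots2 sum1_card card_Fp_p // leqNgt ltn_predL prime_gt0.
  have D1 : (t ^+ 2 - 4 != 0)%R.
    apply: contra_eqN t0 => /eqP e; rewrite -lt0n; apply/card_gt0P; exists (t / 2)%R.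
    rewrite inE; apply/eqP; apply: (mulIf two0); apply: (mulIf two0).
    by rewrite mul1r -[RHS]addr0 -e; field.
  have nS : (t ^+ 2 - 4)%R \notin squares F.
    by have := card_roots2 two0 D1; rewrite t0; case: ifP.
  have d1 : (\det (mx2 0 1 (-1) t : 'M[F]_2) = 1)%R by rewrite det2E !mx2E; ring.
  have eD : (disc (mx2 0 1 (-1) t : 'M[F]_2) = t ^+ 2 - 4)%R by rewrite discE !mx2E; ring.
  pose g := toGL (mx2 0 1 (-1) t : 'M[F]_2)%R.
  have Lg : g \in L by apply: toGL_SL2.
  have eg : (dsc g = t ^+ 2 - 4)%R by rewrite toGLK.
  have ng : noncentral g by apply: disc_nonscalar; rewrite eg.
  exists (coset Z g); last by rewrite card_torus // eg (negPf D1) (negPf nS).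
  rewrite !inE mem_quotient // andbT; apply: contra ng => /eqP h.
  by apply/(SL2_centerP Lg); rewrite coset_idr ?SL2_normZ.
- have := card_quotient (normal_norm (center_normal L)).
  have := Lagrange (center_sub L); rewrite card_center // card_SL2 // => h e.
  by apply/eqP; rewrite -(eqn_pmul2l (isT : 0 < 2)) [#|_|]e h {1}pE; apply/eqP; lia.
Qed.

End TorusSystemPSL2.

(** * The classification for PSL(2, p) *)

Lemma PSL2_5'group p : prime p -> (3 < p)%N -> (p %% 5 = 2 \/ p %% 5 = 3)%N ->
  ~~ (5 %| #|PSL2 p|)%N.
Proof.
move=> p_prime p_gt3 p_mod5; rewrite (ts_order (PSL2_torus_system p_prime p_gt3)).
have pE : p = (p./2.*2.+1)%N.
  by rewrite -{1}(odd_double_half p); case: (even_prime p_prime) p_gt3 => [->|->].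
(* So 5 divides none of 2, p, k and k + 1. *)
have k5 : ((p./2) %% 5 = 1 \/ (p./2) %% 5 = 3)%N by move: p_mod5; rewrite {1 2}pE; lia.
by rewrite !Euclid_dvdM //; apply/norP; split; [|apply/norP; split; [|apply/norP; split]]; lia.
Qed.

(** At p = 7 the dihedral entries count all subgroups, so [nb_dihedral_subE] applies. Otherwise k >
    4, as k = 4 gives 9, and [nb_dihedral_maxE] applies. *)
Lemma max_countsE k (x : coset_of 'Z(SL2 k.*2.+1)) :
    prime k.*2.+1 -> (2 < k)%N -> ~~ (5 %| #|PSL2 k.*2.+1|)%N ->
  max_counts x = counts (PSL2 k.*2.+1) k torus x.
Proof.
move=> p_prime k_gt2 n5; have p_gt3 : (3 < k.*2.+1)%N by lia.
have := PSL2_torus_system p_prime p_gt3; rewrite -[in torus_system _ _]divn2.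
rewrite (_ : (_ %/ 2)%N = k) => [tsG|]; last by lia.
rewrite /max_counts /nb_borel /nb_E /counts (nb_borelE tsG) // (nb_EE tsG) //.
have nbE m : m = k \/ m = k.+1 -> nb_dihedral x m.*2 = ntori (PSL2 k.*2.+1) torus m x.
  move=> mk; rewrite /nb_dihedral; case: eqP => [_|p7]; first exact: (nb_dihedral_subE tsG).
  apply: (nb_dihedral_maxE tsG) => //.
  have k4 : k <> 4 by move=> k4; move: p_prime; rewrite k4.
  by lia.
have -> : (k.*2.+1 - 1 = k.*2)%N by lia.
have -> : (k.*2.+1 + 1 = k.+1.*2)%N by lia.
by rewrite !nbE //; [right | left].
Qed.

Local Open Scope nat_scope.

Theorem theorem3p4 (p : nat) (p_prime : prime p) (p_gt3 : 3 < p)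
    (p_mod5 : p %% 5 = 2 \/ p %% 5 = 3)
    (x : coset_of 'Z(SL2 p)) (Gx : x \in PSL2 p) (x_neq1 : x != 1%g) :
  [/\ Sol (PSL2 p) x =
        \bigcup_(M : {group coset_of 'Z(SL2 p)}
                  | maximal M (PSL2 p) && (x \in M)) M,
      (forall M : {group coset_of 'Z(SL2 p)},
        maximal M (PSL2 p) -> x \in M ->
        [|| borel_type p M, dihedral_type (p - 1) M,
            dihedral_type (p + 1) M | E_type p M]),
      [|| #[x] == p, #[x] %| p - 1 | #[x] %| p + 1],
      [/\ #[x] = p -> sol_row x (1, 0, 0, 0) ((p * (p - 1)) %/ 2),
          (#[x] %| p - 1 -> ~~ separate_order p #[x] ->
            sol_row x (2, 1, 0, 0) (p * (p - 1))) &
          (#[x] %| p + 1 -> ~~ separate_order p #[x] ->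
            sol_row x (0, 0, 1, 0) (p + 1))]
    &
      (p %% 24 = 1 ->
        (#[x] = 2 ->
          sol_row x (2, (p + 1) %/ 2, (p - 1) %/ 2, (3 * (p - 1)) %/ 4)
            ((p - 1) * (2 * p + 3))) /\
        (#[x] = 3 ->
          sol_row x (2, 1, 0, (p - 1) %/ 3)
            ((p - 1) * (p + 6))) /\
        (#[x] = 4 ->
          sol_row x (2, 1, 0, (p - 1) %/ 4)
            ((p - 1) * (p + 4)))) /\
      (p %% 24 = 5 ->
        (#[x] = 2 ->
          sol_row x (2, (p + 1) %/ 2, (p - 1) %/ 2, (p - 1) %/ 4)
            ((p - 1) * (2 * p - 1))) /\
        (#[x] = 3 ->
          sol_row x (0, 0, 1, (p + 1) %/ 3)
            (4 * (p + 1)))) /\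
      (p %% 24 = 7 ->
        (#[x] = 2 ->
          sol_row x (0, (p + 1) %/ 2, (p + 3) %/ 2, (3 * (p + 1)) %/ 4)
            ((p + 1) * (p + 4))) /\
        (#[x] = 3 ->
          sol_row x (2, 1, 0, (p - 1) %/ 3)
            ((p - 1) * (p + 6))) /\
        (#[x] = 4 ->
          sol_row x (0, 0, 1, (p + 1) %/ 4)
            (5 * (p + 1)))) /\
      (p %% 24 = 11 ->
        (#[x] = 2 ->
          sol_row x (0, (p + 1) %/ 2, (p + 3) %/ 2, (p + 1) %/ 4)
            (p * (p + 1))) /\
        (#[x] = 3 ->
          sol_row x (0, 0, 1, (p + 1) %/ 3)
            (4 * (p + 1)))) /\
      (p %% 24 = 13 ->
        (#[x] = 2 ->
          sol_row x (2, (p + 1) %/ 2, (p - 1) %/ 2, (p - 1) %/ 4)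
            ((p - 1) * (2 * p - 1))) /\
        (#[x] = 3 ->
          sol_row x (2, 1, 0, (p - 1) %/ 3)
            ((p - 1) * (p + 3)))) /\
      (p %% 24 = 17 ->
        (#[x] = 2 ->
          sol_row x (2, (p + 1) %/ 2, (p - 1) %/ 2, (3 * (p - 1)) %/ 4)
            ((p - 1) * (2 * p + 3))) /\
        (#[x] = 3 ->
          sol_row x (0, 0, 1, (p + 1) %/ 3)
            (7 * (p + 1))) /\
        (#[x] = 4 ->
          sol_row x (2, 1, 0, (p - 1) %/ 4)
            ((p - 1) * (p + 4)))) /\
      (p %% 24 = 19 ->
        (#[x] = 2 ->
          sol_row x (0, (p + 1) %/ 2, (p + 3) %/ 2, (p + 1) %/ 4)
            (p * (p + 1))) /\
        (#[x] = 3 ->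
          sol_row x (2, 1, 0, (p - 1) %/ 3)
            ((p - 1) * (p + 3)))) /\
      (p %% 24 = 23 ->
        (#[x] = 2 ->
          sol_row x (0, (p + 1) %/ 2, (p + 3) %/ 2, (3 * (p + 1)) %/ 4)
            ((p + 1) * (p + 4))) /\
        (#[x] = 3 ->
          sol_row x (0, 0, 1, (p + 1) %/ 3)
            (7 * (p + 1))) /\
        (#[x] = 4 ->
          sol_row x (0, 0, 1, (p + 1) %/ 4)
            (5 * (p + 1))))].
Proof.
have [k pE] : exists k, p = k.*2.+1.
  exists p./2; rewrite -{1}(odd_double_half p).
  by case: (even_prime p_prime) p_gt3 => [->|->].
have n5G := PSL2_5'group p_prime p_gt3 p_mod5; have tsG := PSL2_torus_system p_prime p_gt3.
(* The congruence modulo 5 excludes p = 5. *)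
subst p; have k_gt2 : 2 < k by clear -p_gt3 p_mod5; lia.
have hk : (k.*2.+1)./2 = k by clear; lia.
rewrite hk in tsG.
have G1x : x \in (PSL2 k.*2.+1)^# by rewrite !inE x_neq1.
have e1 : (k.*2.+1 - 1 = k.*2)%N by clear; lia.
have e2 : (k.*2.+1 + 1 = k.+1.*2)%N by clear; lia.
have rowE c s : is_row (PSL2 k.*2.+1) k torus x c s -> sol_row x c s.
  by case=> ec es; split=> //; rewrite max_countsE.
have [k_neq_p k1_neq_p] : k <> k.*2.+1 /\ k.+1 <> k.*2.+1 by clear -k_gt2; lia.
have p_half : (k.*2.+1 * k.*2) %/ 2 = k.*2.+1 * k by clear; lia.
split.
- exact: (Sol_bigcup tsG).
- move=> M maxM _; rewrite e1 e2; apply/or4P.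
  have [[y G1y ->]|[V kV ->]] := maximal_cases tsG p_prime k_gt2 n5G maxM; last first.
    by constructor 4; apply: (klein_norm_E tsG).
  have [cT|cT|cT] := ts_card tsG G1y.
  + by constructor 1; apply: (Borel_borel_type tsG).
  + by constructor 2; have := T_norm_dihedral tsG p_prime k_gt2 n5G G1y; rewrite cT; apply.
  + by constructor 3; have := T_norm_dihedral tsG p_prime k_gt2 n5G G1y; rewrite cT; apply.
- have := T_order_dvd tsG G1x; rewrite e1 e2 (T_card_pE tsG) //.
  have dvd2 d m : d %| m -> d %| m.*2 by rewrite -mul2n; apply: dvdn_mull.
  by case: (ts_card tsG G1x) => -> /dvd2 d; rewrite ?eqxx ?d ?orbT.
- split.
  + by move=> ox; rewrite e1 p_half; apply/rowE/(row_p tsG).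
  + rewrite e1 => d sep; have r := row_split tsG p_prime k_gt2 n5G G1x d sep.
    exact: rowE.
  + rewrite e2 => d sep; have r := row_nonsplit tsG p_prime k_gt2 n5G G1x d sep.
    exact: rowE.
rewrite e1 e2.
have r2e ok ox := rowE _ _ (row2_even tsG p_prime k_gt2 n5G G1x ox ok).
have r2o ok ox := rowE _ _ (row2_odd tsG p_prime k_gt2 n5G G1x ox ok).
have r3s k3 ox := rowE _ _ (row3_split tsG p_prime k_gt2 n5G G1x ox k3).
have r3n k3 ox := rowE _ _ (row3_nonsplit tsG p_prime k_gt2 n5G G1x ox k3).
have r4s k4 ox := rowE _ _ (row4_split tsG p_prime k_gt2 n5G G1x ox k4).
have r4n k4 ox := rowE _ _ (row4_nonsplit tsG p_prime k_gt2 n5G G1x ox k4).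
rewrite /q in r3s r3n.
(* Only arithmetic in k remains, so the group is forgotten. *)
move: (sol_row x) #[x] r2e r2o r3s r3n r4s r4n => row n; clear => r2e r2o r3s r3n r4s r4n.
have rowE a b c d s a' b' c' d' s' : row (a, b, c, d) s ->
    [/\ a = a', b = b', c = c', d = d' & s = s'] -> row (a', b', c', d') s'.
  by move=> r [<- <- <- <- <-].
split; [|split; [|split; [|split; [|split; [|split; [|split]]]]]].
- move=> pm; have ok : odd k = false by lia.
  have k4 : (4 %| k) = true by lia.
  have k3 : 3 %| k by lia.
  rewrite ok k4 in r2e r3s; split; [|split]; move=> ox.
  + by apply: rowE (r2e isT ox) _; split; lia.
  + by apply: rowE (r3s k3 ox) _; split; lia.
  + by apply: rowE (r4s k4 ox) _; split; lia.
- move=> pm; have ok : odd k = false by lia.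
  have k4 : (4 %| k) = false by lia.
  have k3 : 3 %| k.+1 by lia.
  rewrite ok k4 in r2e r3n; split; [|]; move=> ox.
  + by apply: rowE (r2e isT ox) _; split; lia.
  + by apply: rowE (r3n k3 ox) _; split; lia.
- move=> pm; have ok : odd k = true by lia.
  have k4 : (4 %| k.+1) = true by lia.
  have k3 : 3 %| k by lia.
  rewrite ok k4 in r2o r3s; split; [|split]; move=> ox.
  + by apply: rowE (r2o isT ox) _; split; lia.
  + by apply: rowE (r3s k3 ox) _; split; lia.
  + by apply: rowE (r4n k4 ox) _; split; lia.
- move=> pm; have ok : odd k = true by lia.
  have k4 : (4 %| k.+1) = false by lia.
  have k3 : 3 %| k.+1 by lia.
  rewrite ok k4 in r2o r3n; split; [|]; move=> ox.
  + by apply: rowE (r2o isT ox) _; split; lia.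
  + by apply: rowE (r3n k3 ox) _; split; lia.
- move=> pm; have ok : odd k = false by lia.
  have k4 : (4 %| k) = false by lia.
  have k3 : 3 %| k by lia.
  rewrite ok k4 in r2e r3s; split; [|]; move=> ox.
  + by apply: rowE (r2e isT ox) _; split; lia.
  + by apply: rowE (r3s k3 ox) _; split; lia.
- move=> pm; have ok : odd k = false by lia.
  have k4 : (4 %| k) = true by lia.
  have k3 : 3 %| k.+1 by lia.
  rewrite ok k4 in r2e r3n; split; [|split]; move=> ox.
  + by apply: rowE (r2e isT ox) _; split; lia.
  + by apply: rowE (r3n k3 ox) _; split; lia.
  + by apply: rowE (r4s k4 ox) _; split; lia.
- move=> pm; have ok : odd k = true by lia.
  have k4 : (4 %| k.+1) = false by lia.
  have k3 : 3 %| k by lia.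
  rewrite ok k4 in r2o r3s; split; [|]; move=> ox.
  + by apply: rowE (r2o isT ox) _; split; lia.
  + by apply: rowE (r3s k3 ox) _; split; lia.
- move=> pm; have ok : odd k = true by lia.
  have k4 : (4 %| k.+1) = true by lia.
  have k3 : 3 %| k.+1 by lia.
  rewrite ok k4 in r2o r3n; split; [|split]; move=> ox.
  + by apply: rowE (r2o isT ox) _; split; lia.
  + by apply: rowE (r3n k3 ox) _; split; lia.
  + by apply: rowE (r4n k4 ox) _; split; lia.
Qed.
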